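(* Let $\Phi$ be a point-stationary point process in $\mathbb R^k$ endowed with the Euclidean metric, and let $\alpha\ge0$. Then there exists an equivariant weight function $\boldsymbol w$ on $\Phi$ such that, almost surely, $$\forall v\in\Phi,\ \forall r\ge1:\quad\boldsymbol w(N_r(v))\le r^{\alpha},$$ and $$\mathbb E[\boldsymbol w(0)]\ge3^{-k}\,\mathcal H^{\alpha}_1(\Phi).$$ In particular, if $\mathcal H^{\alpha}_1(\Phi)>0$, then $\boldsymbol w(0)$ is not identical to zero.
   Context: A discrete space is a metric space $D$ in which every closed ball $N_r(v)=\{u\in D:d(u,v)\le r\}$ is finite; by convention $N_0(v)=\emptyset$. $\mathcal D_*$ (resp. $\mathcal D_{**}$) is the set of discrete spaces with one (resp. two) distinguished points modulo isometries preserving the distinguished points, with its natural Borel structure (local Gromov–Hausdorff topology); $[D,o]$ denotes the class of $(D,o)$. If points (or pairs of points) carry marks in a complete separable metric space $\Xi$, one gets the analogous space $\mathcal D'_*$ of classes $[D,o;m]$ modulo mark-preserving pointed isometries. A random pointed (marked) discrete space $[\boldsymbol D,\boldsymbol o]$ is unimodular if the mass transport principle holds: for every measurable $g\ge0$ on doubly pointed (marked) spaces, $\mathbb E\big[\sum_{v\in\boldsymbol D}g(\boldsymbol D,\boldsymbol o,v)\big]=\mathbb E\big[\sum_{v\in\boldsymbol D}g(\boldsymbol D,v,\boldsymbol o)\big]$. An equivariant process $\boldsymbol Z$ with values in $\Xi$ assigns to each (deterministic) discrete space $D$ a random marking $\boldsymbol Z_D:D\to\Xi$ (extra randomness is allowed)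 such that (a) for every isometry $\rho:D_1\to D_2$, $\boldsymbol Z_{D_2}\circ\rho$ has the same law as $\boldsymbol Z_{D_1}$, and (b) for every measurable $A\subseteq\mathcal D'_*$, the map $[D,o]\mapsto\mathbb P([D,o;\boldsymbol Z_D]\in A)$ is measurable. When a random $[\boldsymbol D,\boldsymbol o]$ is fixed, it suffices to define $\boldsymbol Z$ on almost every realization, and $\boldsymbol Z_{\boldsymbol D}$ is sampled conditionally on $\boldsymbol D$. A point-stationary point process in $\mathbb R^k$ is a random locally finite set $\Phi\subset\mathbb R^k$ with $0\in\Phi$ a.s. such that $\mathbb E[\sum_{x\in\Phi}g(\Phi,0,x)]=\mathbb E[\sum_{x\in\Phi}g(\Phi,x,0)]$ for every measurable translation-invariant $g\ge0$; then $[\Phi,0]$ is a unimodular discrete space. An equivariant weight function $\boldsymbol w$ is an equivariant process with values in $\mathbb R^{\ge0}$; $\boldsymbol w(S):=\sum_{v\in S}\boldsymbol w(v)$. An equivariant covering of $[\boldsymbol D,\boldsymbol o]$ is an equivariant process $\boldsymbol R$ with values in $\mathbb R^{\ge0}$ such that a.s. $\bigcup_{v\in\boldsymbol D}N_{\boldsymbol R(v)}(v)=\boldsymbol D$ ($\boldsymbol R(v)=0$ means no ball at $v$). $\mathcal H^{\alpha}_1(\boldsymbol D):=\inf\mathbb E[\boldsymbol R(\boldsymbol o)^{\alpha}]$ over equivariant coverings with all values in $\{0\}\cup[1,\infty)$ a.s. (with $0^0:=0$); $\mathcal H^\alpha_1(\Phi)$ is this quantity for $[\Phi,0]$. *)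

(* Defs.v *)
From HB Require Import structures.
From mathcomp Require Import all_boot all_order all_algebra.
From mathcomp Require Import all_classical all_reals all_analysis.
From mathcomp Require Import measurable_realfun ring.

Set Implicit Arguments.
Unset Strict Implicit.
Unset Printing Implicit Defensive.

Import Order.TTheory GRing.Theory Num.Theory.
Import numFieldNormedType.Exports.

Local Open Scope classical_set_scope.
Local Open Scope ring_scope.

(* Base points are only there because the library's measurable types need one. *)
#[short(type="pmetricType")]
HB.structure Definition PMetric (K : numDomainType) :=
  { M of Metric K M & Pointed M }.

Section SubsetMetric.
Context (R : realType) (X : metricType R) (A : set X).

Let dist (x y : A) : R := mdist (val x) (val y).

Let dist_ge0 x y : 0 <= dist x y.
Proof. exact: mdist_ge0. Qed.

Let dist_positivity x y : dist x y = 0 -> x = y.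
Proof. by move=> /mdist_positivity /val_inj. Qed.

Let ballEdist (x : A) d : ball x d = [set y | dist x y < d].
Proof.
have -> : ball x d = val @^-1` (ball (val x) d) by [].
by rewrite ballEmdist.
Qed.

HB.instance Definition _ := PseudoMetric_isMetric.Build R (A : Type)
  dist_ge0 dist_positivity ballEdist.

End SubsetMetric.

Section Euclid.
Context (R : realType) (k : nat).

Definition euclid : Type := 'rV[R]_k.

HB.instance Definition _ := GRing.Zmodule.on euclid.
HB.instance Definition _ := isPointed.Build euclid (0 : 'rV[R]_k).

Definition euclid_dist (x y : euclid) : R :=
  Num.sqrt (\sum_(i < k) (x ord0 i - y ord0 i) ^+ 2).

Lemma cauchy_schwarz_sum (a b : 'I_k -> R) :
  (\sum_i a i * b i) ^+ 2 <= (\sum_i a i ^+ 2) * (\sum_i b i ^+ 2).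
Proof.
rewrite -subr_ge0 -(pmulr_rge0 _ (ltr0n _ 2)).
suff -> : 2 * ((\sum_i a i ^+ 2) * (\sum_i b i ^+ 2) - (\sum_i a i * b i) ^+ 2)
    = \sum_i \sum_j (a i * b j - a j * b i) ^+ 2.
  by apply: sumr_ge0 => i _; apply: sumr_ge0 => j _; exact: sqr_ge0.
have E1 : \sum_i \sum_j (a i ^+ 2 * b j ^+ 2)
    = (\sum_i a i ^+ 2) * (\sum_i b i ^+ 2).
  by rewrite big_distrl/=; apply: eq_bigr => i _; rewrite big_distrr.
have E2 : \sum_i \sum_j (a j ^+ 2 * b i ^+ 2)
    = (\sum_i a i ^+ 2) * (\sum_i b i ^+ 2) by rewrite exchange_big.
have E3 : \sum_i \sum_j ((a i * b i) * (a j * b j))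
    = (\sum_i a i * b i) ^+ 2.
  by rewrite expr2 big_distrl/=; apply: eq_bigr => i _; rewrite big_distrr.
transitivity (\sum_i \sum_j (a i ^+ 2 * b j ^+ 2)
  + \sum_i \sum_j (a j ^+ 2 * b i ^+ 2)
  - 2 * \sum_i \sum_j ((a i * b i) * (a j * b j))).
  by rewrite E1 E2 E3; ring.
rewrite -big_split/= big_distrr/= -sumrB; apply: eq_bigr => i _.
rewrite -big_split/= big_distrr/= -sumrB; apply: eq_bigr => j _.
ring.
Qed.

Lemma euclid_distxx x : euclid_dist x x = 0.
Proof. by rewrite /euclid_dist big1 ?sqrtr0// => i _; rewrite subrr expr0n. Qed.

Lemma euclid_dist_positivity x y : euclid_dist x y = 0 -> x = y.
Proof.
move/eqP; rewrite sqrtr_eq0 => xy0.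
apply/rowP => i; apply/eqP; rewrite -subr_eq0 -sqrf_eq0 eq_le sqr_ge0 andbT.
apply: le_trans xy0; rewrite (bigD1 i)//= lerDl.
by apply: sumr_ge0 => j _; exact: sqr_ge0.
Qed.

Lemma euclid_dist_sym x y : euclid_dist x y = euclid_dist y x.
Proof.
by rewrite /euclid_dist; congr Num.sqrt; apply: eq_bigr => i _; rewrite -sqrrN opprB.
Qed.

Lemma euclid_dist_triangle y x z : euclid_dist x z <= euclid_dist x y + euclid_dist y z.
Proof.
have S0 u v : 0 <= \sum_(i < k) ((u : euclid) ord0 i - v ord0 i) ^+ 2 :> R.
  by apply: sumr_ge0 => j _; exact: sqr_ge0.
rewrite -(ler_pXn2r (ltn0Sn 1)) ?nnegrE ?addr_ge0 ?sqrtr_ge0//.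
rewrite sqrrD !sqr_sqrtr//.
have -> : \sum_(i < k) (x ord0 i - z ord0 i) ^+ 2 =
    \sum_(i < k) (x ord0 i - y ord0 i) ^+ 2
    + (\sum_(i < k) (x ord0 i - y ord0 i) * (y ord0 i - z ord0 i)) *+ 2
    + \sum_(i < k) (y ord0 i - z ord0 i) ^+ 2.
  rewrite -sumrMnl -!big_split/=; apply: eq_bigr => i _; ring.
rewrite lerD2r lerD2l lerMn2r/=; apply: (le_trans (ler_norm _)).
rewrite -(ler_pXn2r (ltn0Sn 1)) ?nnegrE ?mulr_ge0 ?sqrtr_ge0//.
by rewrite exprMn !sqr_sqrtr// real_normK ?num_real// cauchy_schwarz_sum.
Qed.

HB.instance Definition _ := isMetric.Build R euclid
  euclid_distxx euclid_dist_positivity euclid_dist_sym euclid_dist_triangle.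

End Euclid.

Section DiscreteSpaces.
Context (R : realType).

Record discreteSpace := DiscreteSpace {
  ds_sort :> metricType R ;
  ds_finite : forall (v : ds_sort) (r : R), finite_set [set u | mdist v u <= r] }.

Definition locally_finite (X : metricType R) (A : set X) : Prop :=
  forall (x : X) (r : R), finite_set (A `&` [set u | mdist x u <= r]).

Lemma locally_finite_sub (X : metricType R) (A : set X) : locally_finite A ->
  forall (v : A) (r : R), finite_set [set u : A | mdist v u <= r].
Proof.
move=> lfA v r.
have : finite_set ((val : A -> X) @^-1` (A `&` [set u | mdist (val v) u <= r])).
  by apply: finite_preimage (lfA _ r) => x y _ _; exact: val_inj.
by apply: sub_finite_set => u /= vu; split => //; exact/set_mem/(valP u).
Qed.

Definition subspace_ds (X : metricType R) (A : set X) (lfA : locally_finite A) :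
  discreteSpace := DiscreteSpace (locally_finite_sub lfA).

(* The convention N_0(v) = set0 makes a mark R(v) = 0 mean "no ball at v". *)
Definition cball (D : discreteSpace) (v : D) (r : R) : set D :=
  if r == 0 then set0 else [set u | mdist v u <= r].

Definition isometry (D1 D2 : discreteSpace) (rho : D1 -> D2) : Prop :=
  bijective rho /\ forall u v, mdist (rho u) (rho v) = mdist u v.

(* The sigma-algebra generated by [G].  It only differs from the library's <<s G >>
   in that it does not go through [set], whose universe is too small for the type
   of all discrete spaces. *)
Inductive gen_sigma (T : Type) (G : (T -> Prop) -> Prop) : (T -> Prop) -> Prop :=
| gen_sigma_gen A : G A -> gen_sigma G A
| gen_sigma_compl A : gen_sigma G A -> gen_sigma G (fun x => ~ A x)
| gen_sigma_bigcup (F : nat -> T -> Prop) :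
    (forall n, gen_sigma G (F n)) -> gen_sigma G (fun x => exists n, F n x)
| gen_sigma_ext A B : (forall x, A x <-> B x) -> gen_sigma G A -> gen_sigma G B.

(* [C] is a correspondence witnessing that the pointed spaces are close in the
   local Gromov-Hausdorff sense: it relates the roots, covers both balls of
   radius 1/e around the roots, distorts distances by less than e, and only
   relates points satisfying [E] (used to compare marks). *)
Definition gh_close (D1 D2 : discreteSpace) (o1 : D1) (o2 : D2)
    (E : D1 -> D2 -> Prop) (e : R) : Prop :=
  exists C : D1 -> D2 -> Prop,
  [/\ C o1 o2,
      forall u, mdist o1 u <= e^-1 -> exists v, C u v,
      forall v, mdist o2 v <= e^-1 -> exists u, C u v,
      forall u v u' v', C u v -> C u' v' -> `|mdist u u' - mdist v v'| < e &
      forall u v, C u v -> E u v].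

(* The sets [D_*] and [D'_*] are represented by their representatives (D, o) and
   (D, o; m), the identification modulo isometries being carried by the
   sigma-algebras: these are generated by the open sets of the (non-separated)
   local Gromov-Hausdorff topologies, so that their elements are invariant under
   pointed isometries, see [ps_borel_isometry] and [mps_borel_isometry], and are
   exactly the preimages of the Borel sets of the quotients. *)
Record pspace := PSpace { ps_space :> discreteSpace ; ps_root : ps_space }.

Definition ps_open (U : pspace -> Prop) : Prop :=
  forall p, U p -> exists2 e : R, 0 < e & forall q,
    gh_close (ps_root p) (ps_root q) (fun _ _ => True) e -> U q.

Definition ps_borel : (pspace -> Prop) -> Prop := gen_sigma ps_open.

Lemma locally_finite1 : locally_finite [set (0 : R^o)].
Proof. by move=> x r; apply: (@sub_finite_set _ _ [set 0]) => // y []. Qed.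

Definition singleton_pspace : pspace :=
  @PSpace (subspace_ds locally_finite1) (exist _ 0 (mem_set erefl)).

Section Marks.
Context (Xi : pmetricType R).

Record mpspace := MPSpace { mps_pspace :> pspace ; mps_mark : mps_pspace -> Xi }.

Definition mps_open (U : mpspace -> Prop) : Prop :=
  forall p, U p -> exists2 e : R, 0 < e & forall q : mpspace,
    gh_close (ps_root p) (ps_root q)
      (fun u v => mdist (mps_mark u) (mps_mark v) < e) e -> U q.

Definition mps_borel : (mpspace -> Prop) -> Prop := gen_sigma mps_open.

(* Maps D -> Xi with the product sigma-algebra. *)
Definition cylinders (D : discreteSpace) : set (set (D -> Xi)) :=
  [set C | exists v : D, exists2 B : set Xi, <<s open >> B &
           C = [set m | B (m v)]].

Definition marking (D : discreteSpace) := g_sigma_algebraType (@cylinders D).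

(* A random marking is given by its law, extra randomness being integrated out.
   The law is given for every discrete space, not only for almost every
   realization of a given random one. *)
Record eqprocess := EqProcess {
  ep_law :> forall D : discreteSpace, probability (marking D) R ;
  ep_equivariant : forall (D1 D2 : discreteSpace) (rho : D1 -> D2),
    isometry rho -> forall B : set (marking D1), measurable B ->
    ep_law D2 [set m : marking D2 | B (fun u => m (rho u))] = ep_law D1 B ;
  ep_measurable : forall A : mpspace -> Prop, mps_borel A ->
    forall B : set (\bar R), measurable B ->
    ps_borel (fun p => B (ep_law p [set m | A (@MPSpace p m)])) }.

(* For a random pointed space X, the marking is sampled from the law Z (X x)
   conditionally on the outcome x. *)
Definition as_marked d (T : measurableType d) (P : probability T R)
    (X : T -> pspace) (Z : eqprocess) (Q : mpspace -> Prop) : Prop :=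
  {ae P, forall x, {ae Z (X x), forall m, Q (@MPSpace (X x) m)}}.

Definition mean_marked d (T : measurableType d) (P : probability T R)
    (X : T -> pspace) (Z : eqprocess) (f : mpspace -> \bar R) : \bar R :=
  (\int[P]_x \int[Z (X x)]_m f (@MPSpace (X x) m))%E.

End Marks.

Lemma gen_sigma_iff (T : Type) (G : (T -> Prop) -> Prop) (p q : T) :
  (forall U, G U -> U p <-> U q) -> forall A, gen_sigma G A -> A p <-> A q.
Proof.
move=> Gpq A; elim=> {A} [A GA|A _ [pq qp]|F _ Fpq|A B AB _ pq].
- exact: Gpq.
- by split=> nA aq; apply: nA; [exact: qp | exact: pq].
- by split=> -[n Fn]; exists n; exact/Fpq.
- by split=> [/AB/pq/AB|/AB/pq/AB].
Qed.

Lemma isometry_inv (D1 D2 : discreteSpace) (rho : D1 -> D2) : isometry rho ->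
  exists rho', [/\ cancel rho rho', cancel rho' rho & isometry rho'].
Proof.
move=> [[rho' K K'] rhod]; exists rho'; split => //.
by split=> [|u v]; [exists rho | rewrite -rhod !K'].
Qed.

Lemma ps_borel_isometry (A : pspace -> Prop) (p q : pspace) (rho : p -> q) :
  ps_borel A -> isometry rho -> rho (ps_root p) = ps_root q -> A p <-> A q.
Proof.
move=> bA irho rhoo; apply: (gen_sigma_iff _ bA) => U oU {A bA}.
suff H (p1 q1 : pspace) (r : p1 -> q1) : isometry r ->
    r (ps_root p1) = ps_root q1 -> U p1 -> U q1.
  have [rho' [K _ irho']] := isometry_inv irho.
  by split; [exact: H irho rhoo | apply: H irho' _; rewrite -rhoo K].
move=> [[r' K K'] rd] ro Up; have [e e0 sU] := oU _ Up; apply: sU.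
exists (fun u v => r u = v); split => // [u _|v _|u v u' v' <- <-].
- by exists (r u).
- by exists (r' v).
- by rewrite rd subrr normr0.
Qed.

Lemma mps_borel_isometry (Xi : pmetricType R) (A : mpspace Xi -> Prop)
    (p q : mpspace Xi) (rho : p -> q) :
  mps_borel A -> isometry rho -> rho (ps_root p) = ps_root q ->
  (forall u, mps_mark (rho u) = mps_mark u) -> A p <-> A q.
Proof.
move=> bA irho rhoo rhom; apply: (gen_sigma_iff _ bA) => U oU {A bA}.
suff H (p1 q1 : mpspace Xi) (r : p1 -> q1) : isometry r ->
    r (ps_root p1) = ps_root q1 ->
    (forall u, mps_mark (r u) = mps_mark u) -> U p1 -> U q1.
  have [rho' [K K' irho']] := isometry_inv irho.
  split; [exact: H irho rhoo rhom | apply: H irho' _ _].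
    by rewrite -rhoo K.
  by move=> u; rewrite -rhom K'.
move=> [[r' K K'] rd] ro rm Up; have [e e0 sU] := oU _ Up; apply: sU.
exists (fun u v => r u = v).
split => // [u _|v _|u v u' v' <- <-|u v <-].
- by exists (r u).
- by exists (r' v).
- by rewrite rd subrr normr0.
- by rewrite rm mdistxx.
Qed.

Definition nnreal : Type := [set x : R^o | 0 <= x].

HB.instance Definition _ := Metric.on nnreal.
HB.instance Definition _ :=
  isPointed.Build nnreal (exist _ 0 (mem_set (lexx (0 : R)))).

Definition nnval (x : nnreal) : R := val x.

Definition weight (p : mpspace nnreal) (S : set p) : \bar R :=
  \esum_(v in S) (nnval (mps_mark v))%:E.

Definition root_mark (p : mpspace nnreal) : R := nnval (mps_mark (ps_root p)).

(* x ^ alpha with the convention 0 ^ 0 = 0 *)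
Definition pow0 (x alpha : R) : R := if x == 0 then 0 else x `^ alpha.

Definition covers (p : mpspace nnreal) : Prop :=
  \bigcup_(v in [set: p]) cball v (nnval (mps_mark v)) = [set: p].

Definition radii_ge1 (p : mpspace nnreal) : Prop :=
  forall v : p, nnval (mps_mark v) = 0 \/ 1 <= nnval (mps_mark v).

Definition hausdorff_content1 d (T : measurableType d) (P : probability T R)
    (X : T -> pspace) (alpha : R) : \bar R :=
  ereal_inf [set h : \bar R | exists Z : eqprocess nnreal,
    [/\ as_marked P X Z covers, as_marked P X Z radii_ge1 &
        h = mean_marked P X Z (fun p => (pow0 (root_mark p) alpha)%:E)]].

End DiscreteSpaces.

Arguments weight {R} p S.
Arguments root_mark {R} p.

Section PointProcesses.
Context (R : realType) (k : nat).

Definition borel_euclid := g_sigma_algebraType (@open (euclid R k)).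

Definition lfset_ := {A : set (euclid R k) | locally_finite A}.

Lemma locally_finite0 : locally_finite (@set0 (euclid R k)).
Proof. by move=> x r; rewrite set0I. Qed.

HB.instance Definition _ := gen_eqMixin lfset_.
HB.instance Definition _ := gen_choiceMixin lfset_.
HB.instance Definition _ := isPointed.Build lfset_ (exist _ _ locally_finite0).

(* The usual sigma-algebra on configurations, generated by the counting maps
   phi |-> #(phi `&` B) for Borel sets B. *)
Definition counting_events : set (set lfset_) :=
  [set E | exists B : set borel_euclid, exists2 n : nat, measurable B &
           E = [set phi | ((sval phi `&` B) #= `I_n)%card]].

Definition lfset := g_sigma_algebraType counting_events.

Definition translation_invariant
    (g : lfset * borel_euclid * borel_euclid -> \bar R) : Prop :=
  forall (phi psi : lfset) (t x y : euclid R k),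
    sval psi = [set (z : euclid R k) + t | z in sval phi] ->
    g (psi, x + t, y + t) = g (phi, x, y).

Definition point_stationary d (T : measurableType d) (P : probability T R)
    (Phi : T -> lfset) : Prop :=
  [/\ measurable_fun [set: T] Phi,
      {ae P, forall w, sval (Phi w) 0} &
      forall g : lfset * borel_euclid * borel_euclid -> \bar R,
        measurable_fun setT g -> (forall z, (0 <= g z)%E) ->
        translation_invariant g ->
        ((\int[P]_w \esum_(x in sval (Phi w)) g (Phi w, 0%R : euclid R k, x)) =
         (\int[P]_w \esum_(x in sval (Phi w)) g (Phi w, x, 0%R : euclid R k)))%E].

(* The pointed space (phi, 0), with a default value if 0 is not in phi. *)
Definition at0 (phi : lfset) : pspace R :=
  match pselect (sval phi 0) with
  | left phi0 =>
      @PSpace R (subspace_ds (svalP phi)) (exist _ 0 (mem_set phi0))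
  | right _ => singleton_pspace R
  end.

End PointProcesses.

(* Main.v *)
(* All processes used are factors of iid fair bits: the mark of a point is a measurable
   function of countably many local rules evaluated at that point.

   If alpha < k, fix q > 1 and theta < 1 with (3q)^alpha <= 3^k theta, and give the balls
   of radius c = q, q^2, ..., q^I the capacity (c/q)^alpha.  A deterministic local
   procedure fills the balls with weight w without exceeding any capacity, until every
   point lies in an almost full ball.  Among the almost full balls, a random greedy
   selection (Luby's algorithm run on the largest radii first) picks disjoint ones, whose
   threefold enlargements cover all but a small proportion of the points (Vitali).  As a
   full ball B of radius c satisfies (3c)^alpha <= 3^k w(B), mass transport from the
   centres of the selected balls to their points bounds the cost of this covering by
   3^k E[w(0)], which is thus almost the content.  The weights obtained for I = 1, 2, ... are
   combined by Mazur's lemma: midpoints minimizing E[w(0)^2] form a Cauchy sequence, and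
   the lower limit of a fast subsequence satisfies the constraint at all radii by Fatou.

   If alpha >= k, the weight is 3^-k on a maximal 1-separated subset S: the constraint is
   a packing bound, and the balls of radius 1 around S are a covering. *)

From HB Require Import structures.
From mathcomp Require Import all_boot all_order all_algebra.
From mathcomp Require Import all_classical all_reals all_analysis.
From mathcomp Require Import finmap measurable_realfun ring lra zify.
Require Import Defs.

Set Implicit Arguments.
Unset Strict Implicit.
Unset Printing Implicit Defensive.

Import Order.TTheory GRing.Theory Num.Theory.
Import numFieldNormedType.Exports.
Import HBNNSimple.

Local Open Scope classical_set_scope.
Local Open Scope ring_scope.

(** * Local rules *)

Section Family.
Context (R : realType) (X : Type).

(** For alpha < k, the gap between 3^alpha and 3^k pays for two losses: the constraint is only
    imposed on a geometric grid of radii (the factor q), and balls are only almost filled (the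
    factor theta). This room vanishes at alpha = k, hence the separate case, where packing alone
    suffices. One filling controls bounded radii only, so a limit is unavoidable. A limit of laws
    would have to be realized again as an equivariant process on every discrete space. The fillings,
    however, use no bits: they are functions of the space, the admissible ones are closed under
    midpoints, and the uniform convexity of E[w(0)^2] makes the weights themselves converge in mean.
    Bits only break symmetries, in the selection of balls. A process must be defined, equivariant
    and measurable on all discrete spaces, not just on samples of the given one. Hence rules are a
    syntax of terms: that a value depends only on a finite ball and finitely many bits, measurably
    so, is proved once by induction on terms, and pi-lambda arguments carry the consequences over to
    countable families of rules. *)

Definition coordinate_sets : set (set (X -> measurableTypeR R)) :=
  [set C | exists x, exists2 O : set R, open O & C = [set f | O (f x)]].

(** The product sigma-algebra on real families; distance matrices, values of rules and indicators of
    patterns all live in such spaces. *)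
Definition rfamily := g_sigma_algebraType coordinate_sets.

Lemma measurable_coordinate (x : X) :
  measurable_fun setT (fun f : rfamily => (f x : R)).
Proof.
apply: (@measurability _ _ _ _ setT _ (@RGenOpens.G R)).
  exact: RGenOpens.measurableE.
move=> _ [U GU <-]; rewrite setTI; apply: sub_sigma_algebra.
exists x; exists U => //.
by case: GU => [a [b ->]]; exact: interval_open.
Qed.

Lemma measurable_rfamily d (T : measurableType d) (f : T -> rfamily) :
  (forall x, measurable_fun setT (fun t => (f t x : R))) -> measurable_fun setT f.
Proof.
move=> mf; apply: (@measurability _ _ T rfamily setT f (coordinate_sets : set (set rfamily))) => //.
move=> _ [_ [x [U oU ->]] <-].
by apply: (mf x) => //; exact: open_measurable.
Qed.

(** The pi-system behind all the uniqueness and Dynkin arguments. [X] carries no decidable equality,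
    hence lists with [List.In]. *)
Definition finite_cylinders : set (set rfamily) :=
  [set C | exists2 s : seq (X * set R), (forall z, List.In z s -> open z.2) &
    C = [set f | forall z, List.In z s -> z.2 (f z.1)]].

Lemma finite_cylindersI : setI_closed finite_cylinders.
Proof.
move=> _ _ [s os ->] [t ot ->]; exists (s ++ t).
  by move=> z /List.in_app_iff[/os|/ot].
apply/seteqP; split=> f /=.
  by move=> [fs ft] z /List.in_app_iff[/fs|/ft].
by move=> fst; split=> z zs; apply: fst; apply/List.in_app_iff; [left|right].
Qed.

Lemma measurable_finite_cylinder C : finite_cylinders C -> measurable C.
Proof.
move=> [s os ->]; elim: s os => [_|z s IH os].
  have -> : [set f : rfamily | forall z, List.In z [::] -> z.2 (f z.1)] = setT
    by apply/seteqP; split=> // f _ z [].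
  exact: measurableT.
have -> : [set f : rfamily | forall z0, List.In z0 (z :: s) -> z0.2 (f z0.1)] =
    [set f | z.2 (f z.1)] `&`
    [set f | forall z0, List.In z0 s -> z0.2 (f z0.1)].
  apply/seteqP; split=> f /=.
    by move=> H; split; [apply: H; left|move=> z' z's; apply: H; right].
  by move=> [H1 H2] z' [<-//|]; exact: H2.
apply: measurableI.
  rewrite -[X in measurable X]setTI; apply: measurable_coordinate => //.
  by apply: open_measurable; apply: os; left.
by apply: IH => z' z's; apply: os; right.
Qed.

Lemma measurable_rfamilyE : @measurable _ rfamily = <<s finite_cylinders >>.
Proof.
apply/seteqP; split.
  apply: smallest_sub; first exact: smallest_sigma_algebra.
  move=> _ [x [U oU ->]]; apply: sub_sigma_algebra.
  exists [:: (x, U)]; first by move=> z [<-|].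
  by apply/seteqP; split=> f /=; [move=> Uf z [<-|]//|move=> /(_ (x, U)); apply; left].
apply: smallest_sub; first exact: sigma_algebra_measurable.
exact: measurable_finite_cylinder.
Qed.

End Family.

Lemma fsbig_fintype (V : Type) (idx : V) (op : Monoid.com_law idx)
    (I : finType) (A : set I) (F : I -> V) :
  \big[op/idx]_(i \in A) F i = \big[op/idx]_i (if i \in A then F i else idx).
Proof.
rewrite -[A in LHS]set_mem_set -(@bigfs _ _ _ _ (index_enum I)) ?index_enum_uniq//.
  by rewrite big_mkcond.
by move=> i _; rewrite mem_index_enum.
Qed.

Lemma fsbig_fin (V : pzRingType) (I : finType) (A : set I) (F : I -> V) :
  \sum_(i \in A) F i = \sum_i (i \in A)%:R * F i.
Proof.
rewrite fsbig_fintype; apply: eq_bigr => i _.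
by case: (i \in A); rewrite ?mul1r ?mul0r.
Qed.

Section Rules.
Context (R : realType).

(** [ROp] combines two values at the same point by a measurable function, and [RSum rho] sums over
    the closed ball of radius [rho]: these are the only ways to move information. *)
Inductive rule : Type :=
| RConst of R
| RBit of nat
| ROp (h : R -> R -> R) of
    measurable_fun [set: R * R] (fun z : R * R => h z.1 z.2) & rule & rule
| RSum of R & rule.

(** Evaluation makes sense for any function [d], not only a metric, so that the same rule can be run
    on a discrete space and on the indices of a finite distance matrix. *)
Fixpoint eval (T : choiceType) (d : T -> T -> R) (b : nat -> T -> bool)
    (r : rule) (x : T) : R :=
  match r with
  | RConst c => c
  | RBit t => (b t x)%:R
  | ROp h _ r1 r2 => h (eval d b r1 x) (eval d b r2 x)
  | RSum rho r' => \sum_(y \in [set y | d x y <= rho]) eval d b r' y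
  end.

Fixpoint radius (r : rule) : R :=
  match r with
  | RConst _ | RBit _ => 0
  | ROp _ _ r1 r2 => Num.max (radius r1) (radius r2)
  | RSum rho r' => Num.max rho 0 + radius r'
  end.

Fixpoint depth (r : rule) : nat :=
  match r with
  | RConst _ => 0
  | RBit t => t.+1
  | ROp _ _ r1 r2 => maxn (depth r1) (depth r2)
  | RSum _ r' => depth r'
  end.

Lemma radius_ge0 r : 0 <= radius r.
Proof.
elim: r => //= [h _ r1 H1 r2 H2|rho r H]; first by rewrite le_max H1.
by rewrite addr_ge0// le_max lexx orbT.
Qed.

Lemma eval_embed (T T' : choiceType) (d : T -> T -> R) (d' : T' -> T' -> R)
    (b : nat -> T -> bool) (b' : nat -> T' -> bool) (i : T' -> T) (r : rule) :
  (forall x y z, d x z <= d x y + d y z) ->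
  injective i -> (forall x y, d' x y = d (i x) (i y)) ->
  (forall t x, (t < depth r)%N -> b' t x = b t (i x)) ->
  forall x, (forall y, d (i x) y <= radius r -> exists z, y = i z) ->
  eval d' b' r x = eval d b r (i x).
Proof.
move=> tri inji did.
elim: r => [//|t|h mh r1 IH1 r2 IH2|rho r IH] /= bb x sx.
- by rewrite bb.
- rewrite IH1; last first.
  + by move=> y dy; apply: sx; rewrite le_max dy.
  + by move=> t z tr; apply: bb; rewrite leq_max tr.
  rewrite IH2 //.
  + by move=> t z tr; apply: bb; rewrite leq_max tr orbT.
  + by move=> y dy; apply: sx; rewrite le_max dy orbT.
- rewrite (_ : [set y | d (i x) y <= rho] = i @` [set y | d' x y <= rho]); last first.
    apply/seteqP; split=> [y /= dy|_ [y /= dy <-]]; last by rewrite -did.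
    have [|z yz] := sx y; last by exists z => //=; rewrite did -yz.
    by rewrite (le_trans dy)// ler_wpDr ?radius_ge0// le_max lexx.
  rewrite fsbig_image; last by move=> y z _ _; exact: inji.
  apply: eq_fsbigr => y /set_mem /= dy; apply: IH => // z dz.
  apply: sx; rewrite (le_trans (tri _ (i y) _))// lerD//.
  by rewrite -did le_max dy.
Qed.

(** Here the bits are fixed and the matrix varies: a sum over a ball becomes a finite sum weighted
    by the indicators of [f (i, j) <= rho]. *)
Lemma measurable_eval_matrix n (b : nat -> 'I_n -> bool) (r : rule) (i : 'I_n) :
  measurable_fun setT
    (fun f : rfamily R ('I_n * 'I_n) => eval (fun i j => f (i, j)) b r i).
Proof.
elim: r i => [c|t|h mh r1 IH1 r2 IH2|rho r IH] i /=.
- exact: measurable_cst.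
- exact: measurable_cst.
- exact: (measurableT_comp mh (measurable_fun_pair (IH1 i) (IH2 i))).
- rewrite (_ : (fun _ => _) = (fun f : rfamily R ('I_n * 'I_n) => \sum_(j < n)
     (\1_[set f : rfamily R ('I_n * 'I_n) | f (i, j) <= rho] f * eval (fun i j => f (i, j)) b r j))).
    apply: measurable_sum => j; apply: measurable_funM => //.
    apply: measurable_indic.
    rewrite -[X in measurable X]setTI.
    apply: (measurable_fun_ler (measurable_coordinate (i, j)) (measurable_cst rho)) => //.
  by apply/funext => f; rewrite fsbig_fin; apply: eq_bigr => j _; rewrite indicE.
Qed.

Lemma measurable_eval_random d (O : measurableType d) (T : choiceType)
    (dist : T -> T -> R) (b : O -> nat -> T -> bool) (r : rule) (x : T) :
  (forall x r, finite_set [set y | dist x y <= r]) ->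
  (forall t x, measurable_fun setT (fun o => b o t x)) ->
  measurable_fun setT (fun o => eval dist (b o) r x).
Proof.
move=> fin mb; elim: r x => [c|t|h mh r1 IH1 r2 IH2|rho r IH] x /=.
- exact: measurable_cst.
- rewrite (_ : (fun _ => _) = \1_[set o | b o t x]).
    apply: measurable_indic; rewrite -[X in measurable X]setTI.
    exact: mb.
  by apply/funext => o; rewrite indicE/= mem_setE.
- exact: (measurableT_comp mh (measurable_fun_pair (IH1 x) (IH2 x))).
- by under eq_fun do rewrite fsbig_finite//; exact: measurable_sum.
Qed.

End Rules.

(** * Fair bits from a uniform variable *)

Section Bits.
Context (R : realType).

Definition coin : set (measurableTypeR R) -> \bar R :=
  mrestr lebesgue_measure (measurable_itv `[0%R, 1%R[).

HB.instance Definition _ := Measure.on coin.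

Let coin_setT : coin setT = 1%E.
Proof.
rewrite /coin /mrestr setTI.
by rewrite lebesgue_measure_itv/= lte01 oppr0 adde0.
Qed.

HB.instance Definition _ := Measure_isProbability.Build _ _ R coin coin_setT.

(** The binary digit of rank [n] after the point, for [x] in [0, 1). *)
Definition bit (n : nat) (x : measurableTypeR R) : bool :=
  odd (Num.truncn (2 ^+ n.+1 * (x : R))).

Lemma measurable_bit n : measurable_fun setT (bit n).
Proof.
apply: (measurable_fun_bool true); rewrite setTI.
rewrite (_ : _ @^-1` _ = \bigcup_(m in [set m | odd m])
    [set x : R | m%:R / 2 ^+ n.+1 <= x < m.+1%:R / 2 ^+ n.+1]).
  apply: bigcup_measurable => m _; exact: measurable_itv `[_, _[.
have c0 : 0 < 2 ^+ n.+1 :> R by rewrite exprn_gt0.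
apply/seteqP; split=> x /=; rewrite /bit.
  move=> bx; exists (Num.truncn (2 ^+ n.+1 * x)) => //=.
  rewrite ler_pdivrMr// ltr_pdivlMr// [x * _]mulrC truncn_itv//.
  by rewrite (@le_trans _ _ 1)// -truncn_gt0; case: (Num.truncn _) bx.
move=> [m /= om]; rewrite ler_pdivrMr// ltr_pdivlMr// [x * _]mulrC.
by move=> /truncn_def ->.
Qed.

Lemma truncn_double (y : R) : 0 <= y ->
  Num.truncn (2 * y) = (odd (Num.truncn (2 * y)) + (Num.truncn y).*2)%N.
Proof.
move=> y0; have /andP[a b] := truncn_itv y0.
have /andP[c e] : (Num.truncn (2 * y))%:R <= 2 * y < (Num.truncn (2 * y)).+1%:R.
  by rewrite truncn_itv// mulr_ge0.
rewrite -[LHS]odd_double_half; congr (_ + _.*2)%N.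
set p := Num.truncn (2 * y) in c e *; set q := Num.truncn y in a b *.
have h1 : (q.*2 < p.+1)%N.
  rewrite -(ltr_nat R) (le_lt_trans _ e)// -mul2n natrM ler_pM2l//.
have h2 : (p < q.+1.*2)%N.
  rewrite -(ltr_nat R) (le_lt_trans c)// -mul2n natrM ltr_pM2l//.
lia.
Qed.

(** Prescribing the first [N] digits amounts to prescribing the integer part of 2^N x, that is, to
    choosing one dyadic interval. *)
Lemma coin_prefix N (b : nat -> bool) :
  coin [set x | forall i, (i < N)%N -> bit i x = b i] = (2 ^- N)%:E.
Proof.
have key : exists2 K : nat, (K < 2 ^ N)%N & forall x : R, 0 <= x < 1 ->
    (forall i, (i < N)%N -> bit i x = b i) <-> Num.truncn (2 ^+ N * x) = K.
  elim: N => [|N [K KN IH]].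
    exists 0%N => // x /andP[x0 x1]; split=> // _.
    by rewrite expr0 mul1r; apply: truncn_def; rewrite x0.
  exists (b N + K.*2)%N; first by rewrite expnS; case: (b N) => /=; lia.
  move=> x x01; have x0 : 0 <= x by case/andP: x01.
  have h : Num.truncn (2 ^+ N.+1 * x) = (bit N x + (Num.truncn (2 ^+ N * x)).*2)%N.
    by rewrite /bit exprS -mulrA; apply: truncn_double; rewrite mulr_ge0// exprn_ge0.
  split=> [bx|].
    rewrite h bx//; congr (_ + _.*2)%N; apply/(IH x x01) => i iN.
    by apply: bx; rewrite ltnS ltnW.
  rewrite h => hK; have bN : bit N x = b N.
    by move: hK; case: (bit N x); case: (b N) => //=; lia.
  have tK : Num.truncn (2 ^+ N * x) = K by move: hK; rewrite bN; lia.
  move=> i; rewrite ltnS leq_eqVlt => /orP[/eqP->//|]; move: i.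
  exact/(IH x x01).
have [K KN HK] := key.
have c0 : 0 < 2 ^+ N :> R by rewrite exprn_gt0.
rewrite /coin /mrestr.
rewrite (_ : _ `&` _ = `[K%:R / 2 ^+ N, K.+1%:R / 2 ^+ N[%classic); last first.
  apply/seteqP; split=> x /=; rewrite !in_itv/= ler_pdivrMr// ltr_pdivlMr//.
    move=> [bx x01]; have /(HK x x01) <- := bx.
    by rewrite [x * _]mulrC truncn_itv// mulr_ge0//; case/andP: x01.
  move=> xK; have x01 : 0 <= x < 1.
    case/andP: xK => xK1 xK2; apply/andP; split.
      by rewrite -(pmulr_lge0 _ c0) (le_trans _ xK1).
    rewrite -(ltr_pM2r c0) mul1r (lt_le_trans xK2)// -natrX ler_nat//.
  by split=> //; apply/(HK x x01); apply: truncn_def; rewrite mulrC.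
rewrite lebesgue_measure_itv/= lte_fin ltr_pM2r ?invr_gt0// ltr_nat ltnSn.
by rewrite -EFinD -mulrBl -natrB// subSnn mul1r.
Qed.

Lemma measurable_bits (a : pred nat) (b : nat -> bool) N :
  measurable [set x | forall i, (i < N)%N -> a i -> bit i x = b i].
Proof.
rewrite (_ : [set _ | _] = \bigcap_(i in [set i | (i < N)%N && a i])
   (bit i @^-1` [set b i])).
  apply: bigcap_measurableType => i _.
  by rewrite -[X in measurable X]setTI; exact: measurable_bit.
apply/seteqP; split=> x /= H i; first by move=> /andP[]; exact: H.
by move=> iN ai; apply: H => /=; rewrite iN.
Qed.

(** Induction on the number of unconstrained indices: constraining one more index [j] splits the
    event into two disjoint halves, one for each value of that bit. *)
Lemma coin_bits (a : pred nat) (b : nat -> bool) N :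
  coin [set x | forall i, (i < N)%N -> a i -> bit i x = b i] =
  (2 ^- count a (iota 0 N))%:E.
Proof.
move: {2}(count (predC a) (iota 0 N)) (erefl (count (predC a) (iota 0 N))) => m.
elim: m a b => [|m IH] a b am.
  have cN : count a (iota 0 N) = N.
    by have := count_predC a (iota 0 N); rewrite am addn0 size_iota.
  rewrite cN -(coin_prefix N b); congr coin; apply/seteqP; split=> x /= H i iN.
    apply: H => //; move: am => /eqP; rewrite -leqn0 leqNgt -has_count.
    by move=> /hasPn /(_ i); rewrite mem_iota iN/= negbK; exact.
  by move=> _; exact: H.
have /hasP[j] : has (predC a) (iota 0 N) by rewrite has_count am.
rewrite mem_iota/= add0n => jN aj.
pose a' i := (i == j) || a i.
pose b' c i := if i == j then c else b i.
have ca' : count a' (iota 0 N) = (count a (iota 0 N)).+1.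
  have -> : count a' (iota 0 N) =
      (count (pred1 j) (iota 0 N) + count a (iota 0 N))%N.
    rewrite -count_predUI (@eq_count _ (predI (pred1 j) a) pred0) ?count_pred0 ?addn0//.
    by move=> i /=; case: eqP => // ->; exact/negbTE.
  by rewrite count_uniq_mem ?iota_uniq// mem_iota jN.
have am' : count (predC a') (iota 0 N) = m.
  have := count_predC a' (iota 0 N); have := count_predC a (iota 0 N).
  by rewrite am ca' addSnnS => <- /addnI[].
rewrite (_ : [set _ | _] =
    [set x | forall i, (i < N)%N -> a' i -> bit i x = b' true i] `|`
    [set x | forall i, (i < N)%N -> a' i -> bit i x = b' false i]); last first.
  apply/seteqP; split=> x /=.
    move=> H; case bj : (bit j x); [left|right] => i iN; rewrite /a' /b';
    case: eqP => [->//|_ /=]; exact: H.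
  move=> [H|H] i iN ai; move: (H i iN); rewrite /a' /b' ai orbT => /(_ isT);
  by case: eqP => // ij; move: ai aj; rewrite ij /= => ->.
rewrite measureU; [|exact: measurable_bits|exact: measurable_bits|]; last first.
  rewrite -subset0 => x /= [/(_ j jN) + /(_ j jN)].
  by rewrite /a' /b' eqxx => /(_ isT) -> /(_ isT).
have h c := IH a' (b' c) am'.
rewrite [LHS](congr2 _ (h true) (h false)) ca' -EFinD exprS invfM; congr EFin.
by rewrite -mulrDl -[RHS]mul1r; congr (_ * _); field.
Qed.

Lemma coin_word (K : finType) (idx : K -> nat) (b : K -> bool) :
  injective idx ->
  coin [set x | forall k, bit (idx k) x = b k] = (2 ^- #|K|)%:E.
Proof.
move=> inji.
pose N := (\max_k idx k).+1.
pose a i := i \in codom idx.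
pose b' i := if [pick k | idx k == i] is Some k then b k else false.
have idxN k : (idx k < N)%N by rewrite ltnS leq_bigmax.
rewrite (_ : [set _ | _] =
  [set x | forall i, (i < N)%N -> a i -> bit i x = b' i]); last first.
  apply/seteqP; split=> x /= H => [i iN /codomP[k ->]|k].
    by rewrite H /b'; case: pickP => [l /eqP/inji ->//|/(_ k)]; rewrite eqxx.
  rewrite H//; last exact: codom_f.
  by rewrite /b'; case: pickP => [l /eqP/inji ->//|/(_ k)]; rewrite eqxx.
rewrite coin_bits; congr (2 ^- _)%:E.
rewrite -size_filter -(size_codom idx); apply: perm_size; apply: uniq_perm.
- exact: filter_uniq (iota_uniq _ _).
- by rewrite map_inj_uniq// enum_uniq.
- move=> i; rewrite mem_filter mem_iota/= add0n.
  by apply/andP/idP => [[]//|ai]; split=> //; case/codomP: ai => k ->.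
Qed.

(** The right-hand side does not mention [idx]: the law of finitely many distinct bits does not
    depend on which ones are used. This is what makes the labels of points irrelevant. *)
Lemma coin_event (K : finType) (idx : K -> nat) (Q : {ffun K -> bool} -> bool) :
  injective idx ->
  coin [set x | Q [ffun k => bit (idx k) x]] =
  (\sum_(b : {ffun K -> bool}) (Q b)%:R * 2 ^- #|K|)%:E.
Proof.
move=> inji.
rewrite (_ : [set _ | _] = \big[setU/set0]_(b <- enum Q)
    [set x | forall k, bit (idx k) x = b k]); last first.
  rewrite -bigcup_seq; apply/seteqP; split=> x /=.
    move=> Qx; exists [ffun k => bit (idx k) x]; first by rewrite /= mem_enum.
    by move=> k; rewrite ffunE.
  move=> [b /=]; rewrite mem_enum => Qb bx.
  by rewrite (_ : [ffun _ => _] = b)//; apply/ffunP => k; rewrite ffunE.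
rewrite -bigcup_seq measure_fin_bigcup//=; last 2 first.
- apply/trivIsetP => b c _ _ bc; rewrite -subset0 => x /= [xb xc].
  by move/eqP: bc; apply; apply/ffunP => k; rewrite -xb.
- move=> b _.
  rewrite (_ : [set _ | _] = \bigcap_(k in setT) (bit (idx k) @^-1` [set b k])).
    apply: fin_bigcap_measurable => // k _.
    by rewrite -[X in measurable X]setTI; exact: measurable_bit.
  by apply/seteqP; split=> x /= H k; [move=> _; exact: H|exact: H].
under eq_fsbigr do rewrite coin_word//.
rewrite -fsbig_seq ?enum_uniq// sumEFin; congr EFin.
rewrite big_enum/= big_mkcond/=; apply: eq_bigr => b _.
by rewrite -[b \in Q]/(Q b); case: (Q b); rewrite ?mul1r ?mul0r.
Qed.

End Bits.

(** * Measurability of functions of pointed spaces *)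

Section GenSigma.
Context (T : Type) (G : (T -> Prop) -> Prop).

Lemma gen_sigmaU A B : gen_sigma G A -> gen_sigma G B ->
  gen_sigma G (fun x => A x \/ B x).
Proof.
move=> GA GB.
apply: (@gen_sigma_ext _ _ (fun x => exists n, (if n is 0 then A else B) x)).
  move=> x; split=> [[[|n] ABx]|[Ax|Bx]]; [by left|by right|by exists 0%N|].
  by exists 1%N.
by apply: gen_sigma_bigcup => -[|n].
Qed.

Lemma gen_sigmaI A B : gen_sigma G A -> gen_sigma G B ->
  gen_sigma G (fun x => A x /\ B x).
Proof.
move=> GA GB; apply: (@gen_sigma_ext _ _ (fun x => ~ (~ A x \/ ~ B x))).
  by move=> x; split=> [/not_orP[/contrapT ? /contrapT]//|[Ax Bx] []].
apply: gen_sigma_compl; apply: gen_sigmaU; exact: gen_sigma_compl.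
Qed.

End GenSigma.

Section PsMeasurable.
Context (R : realType).

Lemma ps_openT : ps_open (fun _ : pspace R => True).
Proof. by move=> p _; exists 1. Qed.

Lemma ps_borelT : ps_borel (fun _ : pspace R => True).
Proof. exact: gen_sigma_gen ps_openT. Qed.

Lemma ps_borel_cst (P : Prop) : ps_borel (fun _ : pspace R => P).
Proof.
have [p|np] := pselect P; first by apply: gen_sigma_ext ps_borelT; split.
by apply: gen_sigma_ext (gen_sigma_compl ps_borelT) => x; split=> [[]|/np].
Qed.

(** The counterpart of [measurable_fun] for the sigma-algebra [ps_borel], which is not that of a
    [measurableType]. *)
Definition psm d (S : measurableType d) (f : pspace R -> S) : Prop :=
  forall B : set S, measurable B -> ps_borel (fun p => B (f p)).

Lemma psm_ext d (S : measurableType d) (f g : pspace R -> S) :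
  (forall p, f p = g p) -> psm f -> psm g.
Proof.
by move=> fg mf B mB; apply: gen_sigma_ext (mf B mB) => p; rewrite fg; split.
Qed.

Lemma psm_gen d (S : measurableType d) (G : set (set S)) (f : pspace R -> S) :
  @measurable d S = <<s G>> ->
  (forall A, G A -> ps_borel (fun p => A (f p))) -> psm f.
Proof.
move=> SG Gf; suff : <<s G>> `<=` [set B | ps_borel (fun p => B (f p))].
  by rewrite -SG => + B mB => /(_ _ mB).
apply: smallest_sub => [|A GA]; last exact: Gf.
split.
- exact: ps_borel_cst.
- move=> A bA; apply: gen_sigma_ext (gen_sigma_compl bA) => p.
  by split=> [nA|[]//]; split.
- move=> F bF; apply: gen_sigma_ext (gen_sigma_bigcup bF) => p.
  by split=> [[n Fn]|[n _ Fn]]; exists n.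
Qed.

Lemma psm_comp d d' (S : measurableType d) (S' : measurableType d')
    (f : pspace R -> S) (h : S -> S') :
  measurable_fun setT h -> psm f -> psm (fun p => h (f p)).
Proof.
move=> mh mf B mB; apply: gen_sigma_ext (mf (h @^-1` B) _) => [p|]; first by split.
by rewrite -[X in measurable X]setTI; exact: mh.
Qed.

Lemma psm_pair d d' (S : measurableType d) (S' : measurableType d')
    (f : pspace R -> S) (g : pspace R -> S') :
  psm f -> psm g -> psm (fun p => (f p, g p)).
Proof.
move=> mf mg; apply: (psm_gen (measurable_prod_measurableType S S')).
move=> _ [A mA [B mB <-]].
by apply: gen_sigma_ext (gen_sigmaI (mf A mA) (mg B mB)) => p; split.
Qed.

Lemma psm_comp2 d1 d2 d3 (S1 : measurableType d1) (S2 : measurableType d2)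
    (S3 : measurableType d3) (f : pspace R -> S1) (g : pspace R -> S2)
    (h : S1 -> S2 -> S3) :
  measurable_fun setT (fun z : S1 * S2 => h z.1 z.2) -> psm f -> psm g ->
  psm (fun p => h (f p) (g p)).
Proof. by move=> mh mf mg; exact: (psm_comp mh (psm_pair mf mg)). Qed.

Lemma psm_add (f g : pspace R -> \bar R) :
  psm f -> psm g -> psm (fun p => f p + g p)%E.
Proof.
apply: (psm_comp2 (h := fun x y : \bar R => x + y)%E).
by apply: emeasurable_funD; [exact: measurable_fst|exact: measurable_snd].
Qed.

Lemma psm_sub (f g : pspace R -> \bar R) :
  psm f -> psm g -> psm (fun p => f p - g p)%E.
Proof.
apply: (psm_comp2 (h := fun x y : \bar R => x - y)%E).
by apply: emeasurable_funB; [exact: measurable_fst|exact: measurable_snd].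
Qed.

Lemma psm_cst d (S : measurableType d) (c : S) : psm (fun=> c).
Proof. by move=> B mB; exact: ps_borel_cst. Qed.

Lemma psm_ereal (f : pspace R -> \bar R) :
  (forall r : R, ps_borel (fun p => r%:E < f p)%E) -> psm f.
Proof.
move=> mf; apply: (psm_gen (ErealGenOInfty.measurableE R)).
move=> _ [r ->]; apply: gen_sigma_ext (mf r) => p.
by rewrite /= in_itv/= andbT; split.
Qed.

(** Dynkin's lemma for finite kernels: complements use that the total mass is finite, and a
    countable disjoint union is a supremum of partial sums. *)
Lemma psm_kernel (X : Type) (mu : pspace R -> set (rfamily R X) -> \bar R) :
  (forall p, exists m : {measure set (rfamily R X) -> \bar R},
     (m setT < +oo)%E /\ forall B, measurable B -> mu p B = m B) ->
  (forall C, finite_cylinders C -> psm (fun p => mu p C)) ->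
  forall B, measurable B -> psm (fun p => mu p B).
Proof.
move=> mm mC B mB; have mT : psm (fun p => mu p setT).
  by apply: mC; exists [::] => //; apply/seteqP; split=> // f _ z [].
rewrite measurable_rfamilyE in mB; move: B mB.
apply: (dynkin_induction (G := @finite_cylinders R X)).
- exact: measurable_rfamilyE.
- exact: finite_cylindersI.
- exact: mT.
- exact: mC.
- move=> S mS IH.
  apply: (@psm_ext _ _ (fun p => mu p setT - mu p S)%E).
    move=> p; have [m [mfin mE]] := mm p; rewrite !mE//; last exact: measurableC.
    rewrite -setTD measureD// ?setTI//.
  exact: psm_sub.
- move=> F mF tF IH; apply: psm_ereal => r.
  pose S n p := (\sum_(0 <= k < n) mu p (F k))%E.
  have mS n : psm (S n).
    elim: n => [|n IHn].
      by apply: psm_ext (psm_cst 0%E) => p; rewrite /S big_nil.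
    apply: (@psm_ext _ _ (fun p => S n p + mu p (F n))%E).
      by move=> p; rewrite /S big_nat_recr.
    exact: psm_add.
  apply: (@gen_sigma_ext _ _ (fun p => exists n, r%:E < S n p)%E); last first.
    apply: gen_sigma_bigcup => n.
    apply: gen_sigma_ext (mS n `]r%:E, +oo[%classic _) => [p|].
      by rewrite /= in_itv/= andbT; split.
    exact: emeasurable_itv.
  move=> p; have [m [mfin mE]] := mm p.
  have -> : mu p (\bigcup_k F k) = (\sum_(k <oo) mu p (F k))%E.
    have mU : measurable (\bigcup_k F k) by exact: bigcupT_measurable.
    rewrite mE// measure_semi_bigcup//.
    by apply: eq_eseriesr => k _; rewrite mE.
  have mu0 k : (0 <= mu p (F k))%E by rewrite mE.
  split=> [[n rS]|rS].
    by rewrite (lt_le_trans rS)//; apply: nneseries_lim_ge.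
  apply: contrapT => H; move: rS; apply/negP; rewrite -leNgt.
  apply: lime_le; first exact: is_cvg_nneseries.
  apply: nearW => n; rewrite leNgt; apply/negP => rS; apply: H.
  by exists n.
Qed.

End PsMeasurable.

Section Small.
Context (R : realType).

(** [P e] holds for all sufficiently small positive [e]; the point is stability under finite
    conjunctions, see [small_all]. *)
Definition small (P : R -> Prop) : Prop :=
  exists2 e0, 0 < e0 & forall e, 0 < e -> e <= e0 -> P e.

Lemma smallI P Q : small P -> small Q -> small (fun e => P e /\ Q e).
Proof.
move=> [e e0 eP] [f f0 fQ]; exists (Num.min e f); first by rewrite lt_min e0.
by move=> g g0; rewrite le_min => /andP[ge gf]; split; [exact: eP|exact: fQ].
Qed.

Lemma small_all (T : choiceType) (A : set T) (P : T -> R -> Prop) :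
  finite_set A -> (forall a, A a -> small (P a)) ->
  small (fun e => forall a, A a -> P a e).
Proof.
move=> /finite_seqP[s ->] sP.
have : small (fun e => forall a, a \in s -> P a e).
  elim: s sP => [|a s IH] sP; first by exists 1.
  have sPs b : [set` s] b -> small (P b).
    by move=> /= bs; apply: sP; rewrite /= inE bs orbT.
  have := smallI (sP a (mem_head _ _)) (IH sPs).
  move=> [e e0 H]; exists e => // f f0 fe b; have [Pa Ps] := H f f0 fe.
  by rewrite inE => /orP[/eqP->//|]; exact: Ps.
by move=> [e e0 H]; exists e.
Qed.

Lemma small_le (c : R) : 0 < c -> small (fun e => e <= c).
Proof. by move=> c0; exists c. Qed.

Lemma small_inv (L : R) : small (fun e => L <= e^-1).
Proof.
exists (`|L| + 1)^-1; first by rewrite invr_gt0 ltr_wpDl.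
move=> e e0 eL; rewrite (le_trans (ler_norm _))// (@le_trans _ _ (`|L| + 1)) ?lerDl//.
by rewrite -[leLHS]invrK lef_pV2 ?posrE// invr_gt0 ltr_wpDl.
Qed.

Lemma small_exists P : small P -> exists2 e, 0 < e & P e.
Proof. by move=> [e e0 eP]; exists e => //; exact: eP. Qed.

End Small.

Lemma finite_set_fun n (T : choiceType) (A : set T) : finite_set A ->
  finite_set [set y : 'I_n -> T | forall i, A (y i)].
Proof.
move=> /finite_fsetP[F ->].
have : finite_set ((fun (f : {ffun 'I_n -> F}) (i : 'I_n) => val (f i)) @` setT).
  by apply: finite_image; exact: finite_finset.
apply: sub_finite_set => y /= yF; exists [ffun i => [` yF i]%fset] => //.
by apply/funext => i; rewrite ffunE.
Qed.

Lemma le_esum_image (R : realType) (T T' : choiceType) (A : set T) (B : set T')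
    (g : T -> T') (a : T -> \bar R) (b : T' -> \bar R) :
  set_inj A g -> (forall x, A x -> B (g x)) ->
  (forall y, B y -> 0 <= b y)%E -> (forall x, A x -> a x <= b (g x))%E ->
  (\esum_(x in A) a x <= \esum_(y in B) b y)%E.
Proof.
move=> injg AB b0 ab; apply: (@le_trans _ _ (\esum_(x in A) b (g x))%E).
  exact: le_esum.
rewrite -esum_image// [leRHS](esumID (g @` A))//.
rewrite setIidr; last by move=> _ [x Ax <-]; exact: AB.
by rewrite leeDl// esum_ge0// => y [By _]; exact: b0.
Qed.

(** * Counting tuples of points around the root *)

Section Tuples.
Context (R : realType).

Definition dmat (D : discreteSpace R) (I : Type) (y : I -> D) :
    rfamily R (I * I) :=
  fun ij => mdist (y ij.1) (y ij.2).

(** Only open conditions, distinctness and strict inequality, are imposed, so that a tuple survives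
    a small perturbation of the space. *)
Definition tuples (L : R) (n : nat) (p : pspace R) : set ('I_n.+1 -> p) :=
  [set y | [/\ y ord0 = ps_root p, injective y &
              forall i, mdist (ps_root p) (y i) < L]].

Arguments tuples L n p _ : clear implicits.

Lemma finite_ball (D : discreteSpace R) (x : D) r :
  finite_set [set y | mdist x y < r].
Proof. by apply: sub_finite_set (ds_finite x r) => y /= /ltW. Qed.

Lemma finite_tuples L n p : finite_set (tuples L n p).
Proof.
apply: sub_finite_set (finite_set_fun _ (finite_ball (ps_root p) L)).
by move=> y [].
Qed.

Definition count_tuples L n (p : pspace R)
    (B : set (rfamily R ('I_n.+1 * 'I_n.+1))) : \bar R :=
  (\esum_(y in tuples L n p `&` dmat (I := 'I_n.+1) @^-1` B) 1)%E.

Arguments count_tuples L n p B : clear implicits.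

Lemma esum_measure d (S : measurableType d) (Y : choiceType) (A : set Y)
    (m : Y -> {measure set S -> \bar R}) :
  finite_set A -> (forall y, A y -> m y setT < +oo)%E ->
  exists m' : {measure set S -> \bar R}, (m' setT < +oo)%E /\
    forall B, measurable B -> (\esum_(y in A) m y B)%E = m' B.
Proof.
move=> finA mfin; have [->|/set0P[y0 Ay0]] := eqVneq A set0.
  by exists mzero; split=> [|B _]; rewrite ?esum_set0// ltry.
pose s : seq Y := fset_set A.
exists (msum (fun i => m (nth y0 s i)) (size s)); split=> [|B mB]; last first.
  rewrite esum_fset// fsbig_finite//= /msum -/s.
  by rewrite (big_nth y0) big_mkord.
apply: lte_sum_pinfty => i _; apply: mfin.
have : nth y0 s i \in s by rewrite mem_nth.
by rewrite in_fset_set// => /set_mem.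
Qed.

(** A correspondence is made into a map by choosing partners; it is injective on the ball once the
    distortion is below the separation of its points. *)
Lemma gh_close_tuples (p q : pspace R) (L e : R)
    (E : p -> q -> Prop) :
  gh_close (ps_root p) (ps_root q) E e -> L <= e^-1 ->
  (forall u v : p, mdist (ps_root p) u < L -> mdist (ps_root p) v < L ->
    u != v -> e <= mdist u v) ->
  exists g : p -> q, [/\ g (ps_root p) = ps_root q,
    forall u v, mdist (ps_root p) u < L -> mdist (ps_root p) v < L ->
      `|mdist u v - mdist (g u) (g v)| < e /\ (g u = g v -> u = v) &
    forall u, mdist (ps_root p) u < L -> E u (g u)].
Proof.
move=> [C [Coo Cp Cq Cd CE]] Le sep.
have Cg u : exists v, mdist (ps_root p) u < L -> C u v.
  have [uL|uL] := pselect (mdist (ps_root p) u < L); last by exists (ps_root q).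
  by have [v Cuv] := Cp u (le_trans (ltW uL) Le); exists v.
pose g u := if pselect (u = ps_root p) then ps_root q else projT1 (cid (Cg u)).
have gC u : mdist (ps_root p) u < L -> C u (g u).
  rewrite /g; case: (pselect (u = ps_root p)) => h /= uL; first by rewrite h.
  exact: (projT2 (cid (Cg u)) uL).
exists g; split=> [|u v uL vL|u uL]; first by rewrite /g; case: pselect.
  have d := Cd _ _ _ _ (gC u uL) (gC v vL); split=> // guv.
  move: d; rewrite guv mdistxx subr0 ger0_norm ?mdist_ge0//.
  by move=> uve; apply/eqP; apply: contraTT uve => /(sep _ _ uL vL); rewrite leNgt.
exact: CE (gC u uL).
Qed.

Lemma small_separation (D : discreteSpace R) (o : D) L : small (fun e : R =>
  forall u v : D, mdist o u < L -> mdist o v < L -> u != v -> e <= mdist u v).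
Proof.
have := @small_all R _ ([set u : D | mdist o u < L] `*` [set u : D | mdist o u < L])
  (fun z e => z.1 != z.2 -> e <= mdist z.1 z.2).
case.
- by apply: finite_setX; exact: finite_ball.
- move=> [u v] _ /=; have [->|uv] := eqVneq u v; first by exists 1 => // e _ _.
  have uv0 : 0 < mdist u v by rewrite mdist_gt0.
  by have [c c0 H] := small_le uv0; exists c => // e e0 /(H e e0).
- move=> e e0 H; exists e => // f f0 fe u v uL vL uv.
  exact: (H f f0 fe (u, v)).
Qed.

(** The count is lower semicontinuous: if [e] is smaller than all margins by which the finitely many
    counted tuples satisfy the strict conditions, then every [q] within [e] of [p] contains an
    injective copy of them. *)
Lemma count_tuples_open L n C : finite_cylinders C ->
  psm (fun p => count_tuples L n p C).
Proof.
move=> [s os CE]; apply: psm_ereal => r; apply: gen_sigma_gen => p rp.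
pose A := tuples L n p `&` dmat (I := 'I_n.+1) @^-1` C.
have finA : finite_set A by apply: finite_setIl; exact: finite_tuples.
have : small (fun e : R => forall y, A y ->
   (forall i, mdist (ps_root p) (y i) + e <= L) /\
   forall z, List.In z s -> forall t, `|dmat y z.1 - t| < e -> z.2 t).
  apply: small_all => // y [[y0 injy yL] Cy]; apply: smallI.
    have := @small_all R 'I_n.+1 setT (fun i e => mdist (ps_root p) (y i) + e <= L).
    case; [exact: finite_finset|move=> i _|by move=> e e0 H; exists e => // f f0 fe i; exact: H].
    have := small_le (_ : 0 < L - mdist (ps_root p) (y i)); rewrite subr_gt0 => /(_ (yL i)).
    by move=> [e e0 H]; exists e => // f f0 fe; rewrite addrC -lerBrDr; exact: H.
  move: Cy; rewrite CE /=; elim: s os {CE} => [|z s IH] os Cy; first by exists 1.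
  have [||e e0 H] := IH; [by move=> z' z's; apply: os; right|by move=> z' z's; apply: Cy; right|].
  have /nbhs_ballP[f /= f0 fz] : nbhs (dmat y z.1) z.2.
    by apply: open_nbhs_nbhs; split; [apply: os; left|apply: Cy; left].
  exists (Num.min e f); first by rewrite lt_min e0.
  move=> g g0; rewrite le_min => /andP[ge gf] z' [<- t tg|z's]; last exact: H z' z's.
  by apply: fz; rewrite /ball/= (lt_le_trans tg).
move=> /smallI /(_ (smallI (small_inv L) (small_separation (ps_root p) L))).
move=> /small_exists[e e0 [HA [Le sep]]].
exists e => // q pq; have [g [go gd _]] := gh_close_tuples pq Le sep.
apply: (lt_le_trans rp); rewrite /count_tuples -/A.
apply: (@le_esum_image _ _ _ _ _ (fun y i => g (y i))) => //.
- move=> y y' /set_mem[[y0 injy yL] _] /set_mem[[y'0 injy' y'L] _] gyy'.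
  apply/funext => i; have := congr1 (fun h => h i) gyy'.
  by have [_] := gd (y i) (y' i) (yL i) (y'L i); exact.
- move=> y Ay; have [HL Hz] := HA y Ay; case: Ay => -[y0 injy yL] Cy.
  split; first split.
  + by rewrite y0.
  + move=> i j gij; apply: injy.
    by have [_] := gd (y i) (y j) (yL i) (yL j); exact.
  + move=> i; have oL : mdist (ps_root p) (ps_root p) < L by rewrite -{2}y0.
    have [+ _] := gd (ps_root p) (y i) oL (yL i); rewrite go => d.
    rewrite (lt_le_trans _ (HL i))// -ltrBlDl.
    by move: d; rewrite distrC => /(le_lt_trans (ler_norm _)).
  + rewrite CE => z zs; apply: (Hz z zs).
    by have [+ _] := gd (y z.1.1) (y z.1.2) (yL _) (yL _).
Qed.

(** Counting, rather than asking for existence, gives a finite sum of Dirac masses in [B], to which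
    [psm_kernel] applies. *)
Lemma psm_count_tuples L n B : measurable B -> psm (fun p => count_tuples L n p B).
Proof.
move: B; apply: psm_kernel => [p|C]; last exact: count_tuples_open.
have := @esum_measure _ (rfamily R ('I_n.+1 * 'I_n.+1)) _ (tuples L n p)
  (fun y => dirac (dmat y : rfamily R _)).
case; [exact: finite_tuples|by move=> y _; rewrite [X in (X < _)%E]diracT ltry|].
move=> m [mfin mE]; exists m; split=> // B mB; rewrite -mE//.
rewrite /count_tuples esum_mkcondr; apply: eq_esum => y _.
rewrite [RHS]diracE; have -> : (y \in dmat (I := 'I_n.+1) @^-1` B) = (dmat y \in B).
  by apply/idP/idP => /set_mem ?; apply/mem_set.
by case: (_ \in B).
Qed.

End Tuples.

Arguments tuples {R} L n p _.
Arguments count_tuples {R} L n p B.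

Section Local.
Context (R : realType).

Lemma count_tuples_gt0 (L : R) n p B :
  (0 < count_tuples L n p B)%E <-> exists2 y, tuples L n p y & B (dmat y).
Proof.
split=> [|[y yT By]].
  apply: contraPP => /forall2NP H; rewrite /count_tuples.
  rewrite (_ : _ `&` _ = set0) ?esum_set0 ?ltxx//.
  by rewrite -subset0 => y [yT By]; have [] := H y.
have -> : count_tuples L n p B = (1 + \esum_(y in
    (tuples L n p `&` dmat (I := 'I_n.+1) @^-1` B) `&` ~` [set y]) 1)%E.
  rewrite /count_tuples (esumID [set y])// setI1 mem_set//.
  by rewrite esum_set1.
by rewrite (@lt_le_trans _ _ 1%E)// ?lte_fin// leeDl// esum_ge0.
Qed.

Lemma ps_borel_tuples (L : R) n B : measurable B ->
  ps_borel (fun p => exists2 y, tuples L n p y & B (dmat y)).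
Proof.
move=> mB.
have /(_ `]0%E, +oo[%classic (emeasurable_itv _)) := psm_count_tuples L mB.
apply: gen_sigma_ext; move=> p; rewrite /= in_itv/= andbT; exact: count_tuples_gt0.
Qed.

Definition enumerates (L : R) n (p : pspace R) (y : 'I_n.+1 -> p) : Prop :=
  tuples L n p y /\ forall u : p, mdist (ps_root p) u < L -> exists i, u = y i.
Arguments enumerates L n p y : clear implicits.

Lemma enumerates_exists (L : R) (p : pspace R) : 0 < L ->
  exists n y, enumerates L n p y.
Proof.
move=> L0; have /finite_seqP[s sE] := finite_ball (ps_root p) L.
pose s' := ps_root p :: rem (ps_root p) (undup s).
have us' : uniq s'.
  by rewrite /s' cons_uniq rem_uniq ?undup_uniq// mem_rem_uniqF ?undup_uniq.
have ms' u : (u \in s') = (u \in s).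
  have os : ps_root p \in undup s.
    rewrite mem_undup; have : [set` s] (ps_root p) by rewrite -sE /= mdistxx.
    by [].
  by rewrite -(perm_mem (perm_to_rem os)) mem_undup.
have sP u : (u \in s) <-> mdist (ps_root p) u < L.
  by have : [set` s] u <-> [set u | mdist (ps_root p) u < L] u by rewrite sE.
exists (size (rem (ps_root p) (undup s))), (fun i => nth (ps_root p) s' i).
split; first split.
- by [].
- move=> i j /eqP; rewrite nth_uniq// => /eqP; exact: val_inj.
- by move=> i; apply/sP; rewrite -ms' mem_nth.
- move=> u /sP; rewrite -ms' => us.
  have us2 : (index u s' < (size (rem (ps_root p) (undup s))).+1)%N.
    by rewrite -[X in (_ < X)%N]/(size s') index_mem.
  by exists (Ordinal us2); rewrite /= nth_index.
Qed.

Lemma enumerates_maximal (L : R) n (p : pspace R) y : tuples L n p y ->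
  ~ (exists y', tuples L n.+1 p y') -> enumerates L n p y.
Proof.
move=> yT noy'; split=> // u uL; apply: contrapT => nyu; apply: noy'.
case: yT => y0 injy yL.
exists (fun i => if unlift ord_max i is Some j then y j else u); split.
- by case: unliftP => [j|] /(congr1 val)//=; rewrite /bump leqNgt ltn_ord add0n;
    case: j => -[]// j0 _; rewrite -y0; congr y; exact: val_inj.
- move=> i j; case: (unliftP ord_max i) => [i'|] ->; rewrite ?liftK ?unlift_none;
  case: (unliftP ord_max j) => [j'|] ->; rewrite ?liftK ?unlift_none//.
  + by move/injy ->.
  + by move=> yu; case: nyu; exists i'.
  + by move=> yu; case: nyu; exists j'.
- by move=> i; case: unlift => [j|]; [exact: yL|].
Qed.

Lemma enumerates_unique (L : R) m n (p : pspace R) y y' :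
  enumerates L m p y -> tuples L n p y' -> (n <= m)%N.
Proof.
move=> [yT yE] [y'0 injy' y'L].
have /choice[f fE] : forall i, exists j, y' i = y j.
  by move=> i; apply: yE; exact: y'L.
have injf : injective f by move=> i j fij; apply: injy'; rewrite !fE fij.
by have := leq_card f injf; rewrite !card_ord.
Qed.

(** The main criterion of measurability. No enumeration of a ball is canonical, but the hypothesis
    says that the distance matrix of any of them determines [f]. *)
Lemma psm_local d (S : measurableType d) (L : R) (f : pspace R -> S)
    (G : forall n, rfamily R ('I_n.+1 * 'I_n.+1) -> S) : 0 < L ->
  (forall n, measurable_fun setT (G n)) ->
  (forall p n y, enumerates L n p y -> f p = G n (dmat y)) -> psm f.
Proof.
move=> L0 mG fG B mB.
(* The ball has exactly [n.+1] points: it contains a tuple of that size and none with one more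
   point. *)
apply: (@gen_sigma_ext _ _ (fun p => exists n,
    (exists2 y, tuples L n p y & (G n @^-1` B) (dmat y)) /\
    ~ (exists2 y, tuples L n.+1 p y & setT (dmat y : rfamily R _)))); last first.
  apply: gen_sigma_bigcup => n; apply: gen_sigmaI.
    by apply: ps_borel_tuples; rewrite -[X in measurable X]setTI; exact: mG.
  by apply: gen_sigma_compl; apply: ps_borel_tuples.
move=> p; split=> [[n [[y yT By] noy']]|Bf].
  rewrite (fG p n y)//; apply: enumerates_maximal => // -[y' y'T].
  by apply: noy'; exists y'.
have [n [y yE]] := enumerates_exists p L0.
exists n; split; first by exists y; [case: yE|rewrite /= -(fG p)].
by move=> [y' y'T _]; have := enumerates_unique yE y'T; rewrite ltnn.
Qed.

Lemma ps_borel_enumerable (L : R) n :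
  ps_borel (fun p => exists y, enumerates L n p y).
Proof.
apply: (@gen_sigma_ext _ _ (fun p =>
    (exists2 y, tuples L n p y & setT (dmat y : rfamily R _)) /\
    ~ (exists2 y, tuples L n.+1 p y & setT (dmat y : rfamily R _)))); last first.
  apply: gen_sigmaI; first exact: ps_borel_tuples.
  by apply: gen_sigma_compl; apply: ps_borel_tuples.
move=> p; split=> [[[y yT _] noy']|[y yE]].
  exists y; apply: enumerates_maximal => // -[y' y'T].
  by apply: noy'; exists y'.
split; first by exists y => //; case: yE.
by move=> [y' y'T _]; have := enumerates_unique yE y'T; rewrite ltnn.
Qed.

End Local.

Arguments enumerates {R} L n p y.

(** * Bits attached to the points of a discrete space *)

Section Labels.
Context (R : realType).

Lemma ds_countable (D : discreteSpace R) : countable [set: D].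
Proof.
have [[x0 _]|/forallNP H] := pselect (exists x : D, True); last first.
  have -> : [set: D] = set0 by rewrite -subset0 => x _; have := H x; exact.
  exact: countable0.
have -> : [set: D] = \bigcup_(n in [set: nat]) [set y : D | mdist x0 y <= n%:R].
  apply/seteqP; split=> // y _; exists (Num.truncn (mdist x0 y)).+1 => //=.
  by apply/ltW; case/andP: (truncn_itv (mdist_ge0 x0 y)).
apply: bigcup_countable => // n _; apply: finite_set_countable; exact: ds_finite.
Qed.

Lemma label_exists (D : discreteSpace R) : exists f : D -> nat, injective f.
Proof.
have /countable_injP[f injf] := ds_countable D.
by exists f => x y; apply: injf; exact/mem_set.
Qed.

(* Points are labelled only to index the iid bits; laws do not depend on the labels. *)
Definition label (D : discreteSpace R) : D -> nat := projT1 (cid (label_exists D)).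

Lemma label_inj (D : discreteSpace R) : injective (@label D).
Proof. exact: projT2 (cid (label_exists D)). Qed.

Definition coins (D : discreteSpace R) (w : measurableTypeR R) (t : nat) (x : D)
  : bool := bit (choice.pickle (label x, t)) w.

Lemma measurable_coins (D : discreteSpace R) t x :
  measurable_fun setT (fun w => @coins D w t x).
Proof. exact: measurable_bit. Qed.

Lemma coins_event (D : discreteSpace R) m k (y : 'I_m -> D)
    (Q : {ffun 'I_k * 'I_m -> bool} -> bool) : injective y ->
  coin (R := R) [set w | Q [ffun z : 'I_k * 'I_m => @coins D w z.1 (y z.2)]] =
  (\sum_(b : {ffun 'I_k * 'I_m -> bool}) (Q b)%:R * 2 ^- (k * m))%:E.
Proof.
move=> injy; rewrite (@coin_event R _ (fun z : 'I_k * 'I_m => choice.pickle (label (y z.2), val z.1)) Q).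
  by rewrite card_prod !card_ord.
move=> [t i] [t' i'] /= /(pcan_inj choice.pickleK) [/label_inj /injy -> tt'].
by congr pair; exact: val_inj.
Qed.

(** Bits of rank at least [k] default to [false]; they are never read by a rule of depth at most
    [k]. *)
Definition bits_of k m (b : {ffun 'I_k * 'I_m -> bool}) (t : nat) (i : 'I_m) :=
  if insub t is Some t' then b (t', i) else false.

Lemma eval_enumeration (p : discreteSpace R) m k (y : 'I_m -> p) w
    (r : rule R) i :
  injective y -> (depth r <= k)%N ->
  (forall u, mdist (y i) u <= radius r -> exists j, u = y j) ->
  eval (@mdist R p) (@coins p w) r (y i) =
  eval (fun a b => dmat y (a, b))
    (bits_of [ffun z : 'I_k * 'I_m => @coins p w z.1 (y z.2)]) r i.
Proof.
move=> injy rk H; apply/esym; apply: eval_embed => //.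
- exact: metric_triangle.
- move=> t x tr; have tk := leq_trans tr rk.
  by rewrite /bits_of insubT ffunE.
Qed.

End Labels.

(** * Equivariant processes as factors of iid bits *)

Section Factor.
Context (R : realType).

(** The mark of a point is [f_out] of the sequence of all rule values there. Countably many rules
    allow limits, hence marks that depend on the whole space. *)
Record factor := Factor {
  f_rule : nat -> rule R ;
  f_out : rfamily R nat -> R ;
  f_measurable : measurable_fun setT f_out }.

Lemma measurable_eval_coins (D : discreteSpace R) (r : rule R) (x : D) :
  measurable_fun setT (fun w => eval (@mdist R D) (@coins R D w) r x).
Proof.
apply: measurable_eval_random => [y s|t y]; first exact: ds_finite.
exact: measurable_coins.
Qed.

(** What is seen of a tuple: its mutual distances and the values of all rules at its points. *)
Definition observations n := (('I_n.+1 * 'I_n.+1) + (nat * 'I_n.+1))%type.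

Definition obs (F : factor) (p : discreteSpace R) n (y : 'I_n.+1 -> p)
    (w : measurableTypeR R) : rfamily R (observations n) :=
  fun z => match z with
  | inl ij => mdist (y ij.1) (y ij.2)
  | inr ti => eval (@mdist R p) (@coins R p w) (f_rule F ti.1) (y ti.2)
  end.

Lemma measurable_obs F (p : discreteSpace R) n (y : 'I_n.+1 -> p) :
  measurable_fun setT (obs F y).
Proof.
apply: measurable_rfamily => -[ij|ti] /=; first exact: measurable_cst.
exact: measurable_eval_coins.
Qed.

(** The expected number of rooted tuples whose observations lie in [B]: again a finite measure in
    [B], as needed for [psm_kernel]. *)
Definition obs_weight (F : factor) (L : R) n (p : pspace R)
    (B : set (rfamily R (observations n))) : \bar R :=
  (\esum_(y in tuples L n p) coin (R := R) (obs F y @^-1` B))%E.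

Arguments obs_weight F L n p B : clear implicits.

Lemma measurable_obs_preimage F (p : discreteSpace R) n (y : 'I_n.+1 -> p) B :
  measurable B -> measurable (obs F y @^-1` B).
Proof. by move=> mB; rewrite -[X in measurable X]setTI; exact: measurable_obs. Qed.

(** The observations recomputed from the distance matrix [d] of an enumerated ball and a finite
    array [b] of bits on it; [y] selects the tuple among the indices. *)
Definition virtual_obs (F : factor) k n m (y : 'I_n.+1 -> 'I_m.+1)
    (b : {ffun 'I_k * 'I_m.+1 -> bool}) (d : rfamily R ('I_m.+1 * 'I_m.+1)) :
    rfamily R (observations n) :=
  fun z => match z with
  | inl ij => d (y ij.1, y ij.2)
  | inr ti => eval (fun i j => d (i, j)) (bits_of b) (f_rule F ti.1) (y ti.2)
  end.

Lemma measurable_virtual_obs F k n m (y : 'I_n.+1 -> 'I_m.+1)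
    (b : {ffun 'I_k * 'I_m.+1 -> bool}) :
  measurable_fun setT (virtual_obs F y b).
Proof.
apply: measurable_rfamily => -[ij|ti] /=; first exact: measurable_coordinate.
exact: measurable_eval_matrix.
Qed.

Definition virtual_tuple (L : R) n m (d : rfamily R ('I_m.+1 * 'I_m.+1))
    (y : {ffun 'I_n.+1 -> 'I_m.+1}) : bool :=
  [&& y ord0 == ord0, injectiveb y & [forall i, d (ord0, y i) < L]].

Lemma measurable_virtual_tuple L n m (y : {ffun 'I_n.+1 -> 'I_m.+1}) :
  measurable_fun setT (fun d => (virtual_tuple L d y)%:R : R).
Proof.
rewrite (_ : (fun _ => _) = \1_[set d | virtual_tuple L d y]); last first.
  by apply/funext => d; rewrite indicE mem_setE.
apply: measurable_indic.
have [yy|yy] := boolP ((y ord0 == ord0) && injectiveb y); last first.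
  rewrite (_ : [set _ | _] = set0)//; rewrite -subset0 => d /=.
  by rewrite /virtual_tuple andbA (negbTE yy).
rewrite (_ : [set _ | _] = \bigcap_(i in setT) [set d : rfamily R ('I_m.+1 * 'I_m.+1) | d (ord0, y i) < L]).
  apply: fin_bigcap_measurable => [|i _]; first exact: finite_finset.
  rewrite -[X in measurable X]setTI.
  by apply: (measurable_fun_ltr (measurable_coordinate (ord0, y i)) (measurable_cst L)).
apply/seteqP; split=> d /=; rewrite /virtual_tuple andbA yy /=.
  by move=> /forallP H i _; exact: H.
by move=> H; apply/forallP => i; exact: H.
Qed.

Definition virtual_weight (F : factor) k (L : R) n (C : set (rfamily R (observations n)))
    m (d : rfamily R ('I_m.+1 * 'I_m.+1)) : R :=
  \sum_(y : {ffun 'I_n.+1 -> 'I_m.+1}) (virtual_tuple L d y)%:R *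
    \sum_(b : {ffun 'I_k * 'I_m.+1 -> bool})
      \1_(virtual_obs F y b @^-1` C) d * 2 ^- (k * m.+1).

Lemma measurable_virtual_weight F k L n C m : measurable C ->
  measurable_fun setT (@virtual_weight F k L n C m).
Proof.
move=> mC; apply: measurable_sum => y; apply: measurable_funM.
  exact: measurable_virtual_tuple.
apply: measurable_sum => b; apply: measurable_funM => //.
apply: measurable_indic; rewrite -[X in measurable X]setTI.
exact: measurable_virtual_obs.
Qed.

Lemma tuples_enumerates (L L' : R) n m (p : pspace R) (z : 'I_m.+1 -> p) :
  L <= L' -> enumerates L' m p z ->
  tuples L n p = (fun (y : {ffun 'I_n.+1 -> 'I_m.+1}) i => z (y i)) @`
    [set y | virtual_tuple L (dmat z) y].
Proof.
move=> LL' [[z0 injz zL] zE]; apply/seteqP; split=> [y [y0 injy yL]|_ [y + <-]].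
  have /choice[f fE] : forall i, exists j, y i = z j.
    by move=> i; apply: zE; rewrite (lt_le_trans (yL i)).
  exists [ffun i => f i]; last by apply/funext => i; rewrite ffunE.
  apply/and3P; split.
  - by rewrite ffunE; apply/eqP/injz; rewrite -fE y0 z0.
  - by apply/injectiveP => i j; rewrite !ffunE => fij; apply: injy; rewrite !fE fij.
  - by apply/forallP => i; rewrite ffunE /dmat/= z0 -fE.
move=> /and3P[/eqP y0 /injectiveP injy /forallP yL]; split.
- by rewrite y0.
- by move=> i j /injz /injy.
- by move=> i; have := yL i; rewrite /dmat/= z0.
Qed.

(** A finite cylinder involves finitely many rules, of radius at most [rho] and depth at most [k].
    Around points of the ball of radius [L] they only read the ball of radius [L + rho], with [k]
    bits per point. *)
Lemma obs_weight_virtual F (L rho : R) k n m (p : pspace R) z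
    (s : seq (observations n * set R)) :
  enumerates (L + rho) m p z -> 0 <= rho ->
  (forall t i U, List.In (inr (t, i), U) s ->
     (depth (f_rule F t) <= k)%N /\ radius (f_rule F t) <= rho) ->
  let C := [set f : rfamily R (observations n) |
            forall z, List.In z s -> z.2 (f z.1)] in
  obs_weight F L n p C = (virtual_weight F k L C (dmat z))%:E.
Proof.
move=> zE rho0 Hs C.
have LL' : L <= L + rho by rewrite lerDl.
rewrite /obs_weight (tuples_enumerates _ LL' zE) esum_image; last first.
  move=> y y' _ _ yy'; apply/ffunP => i.
  by case: zE => -[_ injz _] _; apply: injz; exact: (congr1 (fun h => h i) yy').
rewrite esum_fset//; last exact: finite_finset.
rewrite /virtual_weight fsbig_fintype.
rewrite -sumEFin; apply: eq_bigr => y _.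
have -> : (y \in [set y | virtual_tuple L (dmat z) y]) = virtual_tuple L (dmat z) y.
  by apply/idP/idP => [/set_mem//|yv]; exact/mem_set.
have [yv|_] := boolP (virtual_tuple L (dmat z) y); last by rewrite mul0r.
rewrite mul1r.
have inj : injective z by case: zE => -[].
pose Q (b : {ffun 'I_k * 'I_m.+1 -> bool}) := `[< C (virtual_obs F y b (dmat z)) >].
transitivity (coin (R := R) [set w | Q
   [ffun x : 'I_k * 'I_m.+1 => @coins R p w x.1 (z x.2)]]).
  congr coin; apply/seteqP; split=> w /=.
  - move=> Cw; apply/asboolP => -[c U] cs; have := Cw _ cs; rewrite /=.
    case: c cs => [ij|[t i]] cs //=; have [ht hr] := Hs _ _ _ cs.
    rewrite (eval_enumeration (k := k) _ inj)//.
    move=> u du; case: zE => -[z0 _ zL] ze; apply: ze.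
    rewrite (le_lt_trans (metric_triangle _ (z (y i)) _))// ltr_leD//.
    + case/and3P: yv => _ _ /forallP/(_ i); by rewrite /dmat/= z0.
    + exact: le_trans hr.
  - move=> /asboolP Cw -[c U] cs; have := Cw _ cs; rewrite /=.
    case: c cs => [ij|[t i]] cs //=; have [ht hr] := Hs _ _ _ cs.
    rewrite (eval_enumeration (k := k) _ inj)//.
    move=> u du; case: zE => -[z0 _ zL] ze; apply: ze.
    rewrite (le_lt_trans (metric_triangle _ (z (y i)) _))// ltr_leD//.
    + case/and3P: yv => _ _ /forallP/(_ i); by rewrite /dmat/= z0.
    + exact: le_trans hr.
rewrite coins_event//; congr EFin; apply: eq_bigr => b _.
Qed.

Lemma psm_obs_weight F (L : R) n B : 0 < L -> measurable B ->
  psm (fun p => obs_weight F L n p B).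
Proof.
move=> L0; move: B; apply: psm_kernel => [p|C fC].
  have := @esum_measure R _ (rfamily R (observations n)) _ (tuples L n p)
    (fun y => distribution (coin (R := R)) (mfun_Sub (mem_set (measurable_obs F y)))).
  case; [exact: finite_tuples|by move=> y _; exact: (le_lt_trans (probability_le1 (distribution _ _) measurableT) (ltry _))|].
  by move=> m [mfin mE]; exists m.
have mC := measurable_finite_cylinder fC.
case: fC => s os CE.
have [rho [k [rho0 Hs]]] : exists rho k, 0 <= rho /\
   (forall t i U, List.In (inr (t, i), U) s ->
     (depth (f_rule F t) <= k)%N /\ radius (f_rule F t) <= rho).
  elim: s {os CE} => [|[[ij|[t i]] U] s [rho [k [rho0 IH]]]].
  - by exists 0, 0%N.
  - by exists rho, k; split=> // t i U' [//|]; exact: IH.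
  - exists (Num.max rho (radius (f_rule F t))), (maxn k (depth (f_rule F t))).
    split; first by rewrite le_max rho0.
    move=> t' i' U' [[<- _ _]|/IH[h1 h2]].
      by rewrite leq_maxr le_max lexx orbT.
    by rewrite leq_max h1 le_max h2.
apply: (@psm_local _ _ _ (L + rho) _ (fun m d => (virtual_weight F k L C d)%:E)).
- by rewrite ltr_wpDr.
- by move=> m; apply/measurable_EFinP; exact: measurable_virtual_weight.
- by move=> p m y yE; rewrite CE; exact: (obs_weight_virtual yE).
Qed.

End Factor.

Arguments obs_weight {R} F L n p B.

Section Marks.
Context (R : realType).

Let nnmark_subproof (c : R) : Num.max c 0 \in [set x : R^o | 0 <= x].
Proof. by apply/mem_set; rewrite /= le_max lexx orbT. Qed.

Definition nnmark (c : R) : nnreal R := exist _ (Num.max c 0) (nnmark_subproof c).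

Lemma nnval_ge0 (x : nnreal R) : 0 <= nnval x.
Proof. by case: x => x x0; exact: set_mem x0. Qed.

Lemma nndistE (x y : nnreal R) : mdist x y = `|nnval y - nnval x|.
Proof. by []. Qed.

Lemma nnreal_preimage_measurable (f : R -> nnreal R) (B : set (nnreal R)) :
  (forall x y, `|nnval (f y) - nnval (f x)| <= `|x - y|) ->
  <<s open >> B -> measurable (f @^-1` B).
Proof.
move=> f1; suff : <<s open >> `<=` [set B | measurable (f @^-1` B)] by apply.
apply: smallest_sub.
  split=> [|A mA|A mA].
  - by rewrite /= preimage_set0; exact: measurable0.
  - by rewrite /= setTD preimage_setC; exact: measurableC.
  - by rewrite /= preimage_bigcup; exact: bigcupT_measurable.
move=> U oU /=; apply: open_measurable; rewrite openE => x Ufx.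
have /nbhs_ballP[e /= e0 eU] : nbhs (f x) U by exact: open_nbhs_nbhs.
apply/nbhs_ballP; exists e => //= y xy; apply: eU; rewrite ballEmdist/=.
exact: le_lt_trans (f1 x y) xy.
Qed.

Lemma nnval_measurable_sets (O : set R) : open O ->
  <<s open >> (@nnval R @^-1` O).
Proof.
move=> oO; apply: sub_sigma_algebra; rewrite openE => x Ox.
have /nbhs_ballP[e /= e0 eU] : nbhs (nnval x) O by exact: open_nbhs_nbhs.
apply/nbhs_ballP; exists e => //= y; rewrite ballEmdist/= => xy.
by apply: eU; rewrite /ball/= distrC.
Qed.

Lemma measurable_root_mark (D : discreteSpace R) (v : D) :
  measurable_fun setT (fun m : marking (nnreal R) D => nnval (m v)).
Proof.
apply: (@measurability _ _ _ _ setT _ (@RGenOpens.G R)).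
  exact: RGenOpens.measurableE.
move=> _ [U [a [b ->]] <-]; rewrite setTI.
have oab : open `]a, b[%classic by exact: interval_open.
by apply: sub_sigma_algebra; exists v; exists (@nnval R @^-1` `]a, b[%classic) => //;
  exact: nnval_measurable_sets.
Qed.

Variable F : factor R.

Definition values (D : discreteSpace R) (w : measurableTypeR R) :
    rfamily R (nat * D) :=
  fun z => eval (@mdist R D) (@coins R D w) (f_rule F z.1) z.2.

Arguments values D w _ : clear implicits.

Definition out (D : discreteSpace R) (g : rfamily R (nat * D)) :
    marking (nnreal R) D :=
  fun x => nnmark (f_out F (fun t => g (t, x))).

Definition mark (D : discreteSpace R) (w : measurableTypeR R) :
    marking (nnreal R) D :=
  @out D (values D w).

Arguments out D g _ : clear implicits.
Arguments mark D w _ : clear implicits.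

Lemma measurable_values D : measurable_fun setT (values D).
Proof. by apply: measurable_rfamily => -[t x]; exact: measurable_eval_coins. Qed.

Lemma measurable_out D : measurable_fun setT (out D).
Proof.
apply: (@measurability _ _ _ (marking (nnreal R) D) setT _
  (@cylinders R (nnreal R) D : set (set (marking (nnreal R) D)))) => //.
move=> _ [_ [v [B sB ->]] <-].
have mg : measurable_fun setT (fun g : rfamily R (nat * D) => f_out F (fun t => g (t, v))).
  apply: (measurableT_comp (f_measurable F)).
  by apply: measurable_rfamily => t; exact: measurable_coordinate.
apply: (mg measurableT (nnmark @^-1` B)).
apply: nnreal_preimage_measurable => // x y.
have h1 := ler_norm (x - y); have h2 := ler_norm (y - x).
rewrite distrC in h2.
have h3 := normr_ge0 (x - y).
by rewrite ler_norml /nnmark /nnval/=; apply/andP; split; case: (leP x 0); case: (leP y 0); lra.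
Qed.

Lemma measurable_mark D : measurable_fun setT (mark D).
Proof. exact: measurableT_comp (@measurable_out D) (@measurable_values D). Qed.

Definition law (D : discreteSpace R) : probability (marking (nnreal R) D) R :=
  distribution (coin (R := R)) (mfun_Sub (mem_set (@measurable_mark D))).

Lemma lawE (D : discreteSpace R) B : law D B = coin (R := R) (mark D @^-1` B).
Proof. by []. Qed.

End Marks.

Arguments values {R} F D w _.
Arguments out {R} F D g _.
Arguments mark {R} F D w _.

Lemma finite_enumeration (T : choiceType) (A : set T) : finite_set A ->
  exists n (y : 'I_n -> T), injective y /\ forall u, A u <-> exists j, u = y j.
Proof.
move=> /finite_seqP[s ->].
exists (size (undup s)), (tnth (in_tuple (undup s))); split.
  by apply/tuple_uniqP => /=; exact: undup_uniq.
move=> u; rewrite -[[set` s] u]/(u \in s : Prop) -mem_undup; split.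
  by move=> /(@tnthP _ _ (in_tuple (undup s)))[j ->]; exists j.
by move=> [j ->]; exact: mem_tnth.
Qed.

Section Equivariance.
Context (R : realType) (F : factor R).

(** Finite-dimensional laws depend on the space only through the distance matrix of finitely many
    points. *)
Lemma coin_values (D : discreteSpace R) n k (y : 'I_n -> D)
    (s : seq ((nat * 'I_n) * set R)) : injective y ->
  (forall z, List.In z s -> (depth (f_rule F z.1.1) <= k)%N /\
     forall u, mdist (y z.1.2) u <= radius (f_rule F z.1.1) -> exists j, u = y j) ->
  coin (R := R) [set w | forall z, List.In z s -> z.2 (values F _ w (z.1.1, y z.1.2))] =
  (\sum_(b : {ffun 'I_k * 'I_n -> bool})
    `[< forall z, List.In z s -> z.2 (eval (fun i j => dmat y (i, j)) (bits_of b)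
          (f_rule F z.1.1) z.1.2) >]%:R * 2 ^- (k * n))%:E.
Proof.
move=> injy Hs; pose Q (b : {ffun 'I_k * 'I_n -> bool}) :=
  `[< forall z, List.In z s -> z.2 (eval (fun i j => dmat y (i, j)) (bits_of b)
          (f_rule F z.1.1) z.1.2) >].
rewrite -(coins_event Q injy); congr coin; apply/seteqP.
have E w z : List.In z s -> values F _ w (z.1.1, y z.1.2) =
    eval (fun i j => dmat y (i, j))
      (bits_of [ffun z : 'I_k * 'I_n => @coins R D w z.1 (y z.2)])
      (f_rule F z.1.1) z.1.2.
  by move=> zs; have [h1 h2] := Hs z zs; rewrite /values/=; exact: eval_enumeration.
split=> w /=.
  by move=> H; apply/asboolP => z zs; rewrite -E//; exact: H.
by move=> /asboolP H z zs; rewrite E//; exact: H.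
Qed.

(** All rules of the cylinder are evaluated inside one finite set [A], and an isometry does not
    change its distance matrix. *)
Lemma coin_values_isometry (D1 D2 : discreteSpace R) (rho : D1 -> D2)
    (C : set (rfamily R (nat * D1))) :
  isometry rho -> finite_cylinders C ->
  coin (R := R) [set w | C (values F _ w)] =
  coin (R := R) [set w | C (fun z => values F _ w (z.1, rho z.2))].
Proof.
move=> [bij rd] [s os ->].
have [k Hk] : exists k, forall z, List.In z s -> (depth (f_rule F z.1.1) <= k)%N.
  elim: s {os} => [|z s [k IH]]; first by exists 0%N.
  exists (maxn k (depth (f_rule F z.1.1))) => z' [<-|/IH]; first exact: leq_maxr.
  by move=> zk; rewrite leq_max zk.
have [A [finA HA]] : exists A : set D1, finite_set A /\ forall z, List.In z s ->
    forall u, mdist z.1.2 u <= radius (f_rule F z.1.1) -> A u.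
  elim: s {os Hk} => [|z s [A [finA IH]]]; first by exists set0.
  exists (A `|` [set u | mdist z.1.2 u <= radius (f_rule F z.1.1)]).
  split; first by rewrite finite_setU; split=> //; exact: ds_finite.
  by move=> z' [<- u zu|/IH H u /H]; [right|left].
have [n [y [injy yE]]] := finite_enumeration finA.
have inj2 : injective (rho \o y) by apply: inj_comp => //; exact: bij_inj.
have [s' sE] : exists s', s = map (fun z : (nat * 'I_n) * set R => ((z.1.1, y z.1.2), z.2)) s'.
  elim: s {os Hk} HA => [|[[t x] U] s IH] HA; first by exists [::].
  have [j ->] : exists j, x = y j.
    by apply/yE; apply: (HA _ (or_introl erefl)); rewrite mdistxx radius_ge0.
  have [s' ->] := IH (fun z zs => HA z (or_intror zs)).
  by exists (((t, j), U) :: s').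
have inE' z' : List.In z' s' -> List.In ((z'.1.1, y z'.1.2), z'.2) s.
  move=> zs'; rewrite sE.
  exact: (List.in_map (fun z : (nat * 'I_n) * set R => ((z.1.1, y z.1.2), z.2))).
have E (D : discreteSpace R) (rh : D1 -> D) : [set w | forall z, List.In z s -> z.2 (values F D w (z.1.1, rh z.1.2))] =
    [set w | forall z, List.In z s' -> z.2 (values F D w (z.1.1, (rh \o y) z.1.2))].
  apply/seteqP; split=> w /= H z.
    by move=> /inE'/H.
  by rewrite sE => /List.in_map_iff[z' [<- /H]].
have -> := E D1 id; have -> := E D2 rho.
rewrite (coin_values (k := k))//; last first.
  move=> z /inE' zs; split; first exact: (Hk _ zs).
  by move=> u /(HA _ zs)/yE.
rewrite (coin_values (k := k))//; last first.
  move=> z /inE' zs; split; first exact: (Hk _ zs).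
  have [rho' K K'] := bij.
  by move=> u; rewrite -[u]K' /= rd => /(HA _ zs)/yE[j ->]; exists j.
suff -> : dmat (rho \o y) = dmat (id \o y) by [].
by apply/funext => ij; rewrite /dmat/= rd.
Qed.

(** The two laws of the rule values agree on a pi-system, hence everywhere; the marks are a
    measurable image of these values. *)
Lemma law_isometry (D1 D2 : discreteSpace R) (rho : D1 -> D2) : isometry rho ->
  forall B : set (marking (nnreal R) D1), measurable B ->
  law F D2 [set m : marking (nnreal R) D2 | B (fun u => m (rho u))] = law F D1 B.
Proof.
move=> irho B mB.
have mv : measurable_fun setT
    (fun w => (fun z => values F D2 w (z.1, rho z.2)) : rfamily R (nat * D1)).
  by apply: measurable_rfamily => -[t x]; exact: measurable_eval_coins.
pose m1 := distribution (coin (R := R)) (mfun_Sub (mem_set (@measurable_values R F D1))).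
pose m2 := distribution (coin (R := R)) (mfun_Sub (mem_set mv)).
have m12 : forall A : set (rfamily R (nat * D1)), measurable A -> m1 A = m2 A.
  move=> A mA.
  rewrite measurable_rfamilyE in mA; move: A mA.
  apply: (@g_sigma_algebra_measure_unique _ R _ (@finite_cylinders R (nat * D1))
    (fun A fA => measurable_finite_cylinder fA) (fun _ => setT)).
  - by move=> _; exists [::] => //; apply/seteqP; split=> // f _ z [].
  - by apply: bigcup_const; exists 0%N.
  - exact: finite_cylindersI.
  - move=> A fA; exact: (coin_values_isometry irho fA).
  - by move=> _; exact: (le_lt_trans (probability_le1 m1 measurableT) (ltry _)).
have mo : measurable (out F D1 @^-1` B).
  by rewrite -[X in measurable X]setTI; exact: measurable_out.
exact: esym (m12 _ mo).
Qed.

End Equivariance.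

(** * Marked spaces described by countably many rational patterns *)

Section Patterns.
Context (R : realType).

(** A radius, a number of points, a precision and a list of rational approximations of distances and
    marks. *)
Definition pattern : Type := (nat * nat * nat * seq rat)%type.

Definition near (n : nat) (e : nat) (q : seq rat)
    (h : ('I_n.+1 * 'I_n.+1) + 'I_n.+1 -> R) : Prop :=
  forall c, `|h c - ratr (nth 0 q (choice.pickle c))| < e.+1%:R^-1.

Definition sample (D : discreteSpace R) n (y : 'I_n.+1 -> D) (m : D -> nnreal R)
    (c : ('I_n.+1 * 'I_n.+1) + 'I_n.+1) : R :=
  match c with
  | inl ij => mdist (y ij.1) (y ij.2)
  | inr i => nnval (m (y i))
  end.

Definition matches (j : pattern) (p : mpspace (nnreal R)) : Prop :=
  let: (L, n, e, q) := j in
  exists y : 'I_n.+1 -> p,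
    enumerates L.+1%:R n p y /\ near e q (sample y (@mps_mark R (nnreal R) p)).

Lemma rat_approx (I : finType) (h : I -> R) (e : R) : 0 < e ->
  exists q : seq rat, forall c, `|h c - ratr (nth 0 q (choice.pickle c))| < e.
Proof.
move=> e0; have /choice[f fE] : forall c, exists r : rat, `|h c - ratr r| < e.
  move=> c; have [|r] := @rat_in_itvoo R (h c - e) (h c + e); first by lra.
  rewrite in_itv/= => /andP[r1 r2]; exists r.
  by rewrite ltr_distlC; apply/andP; split; lra.
exists (mkseq (fun i => if choice.unpickle i is Some c then f c else 0)
  (\max_(c : I) choice.pickle c).+1) => c.
by rewrite nth_mkseq ?choice.pickleK// ltnS leq_bigmax.
Qed.

Lemma near_triangle (e : nat) (x y z eps : R) : 2 / e.+1%:R <= eps ->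
  `|x - z| < e.+1%:R^-1 -> `|y - z| < e.+1%:R^-1 -> `|x - y| < eps.
Proof.
move=> He xz yz; rewrite (lt_le_trans _ He)//.
have -> : x - y = (x - z) - (y - z) by ring.
by rewrite (le_lt_trans (ler_normB _ _))// mulr_natl mulr2n ltrD.
Qed.

(** Every open set is a union of pattern events, hence a countable one: this plays the role of
    separability of the space of marked spaces. *)
Lemma mps_open_matches (U : mpspace (nnreal R) -> Prop) p : mps_open U -> U p ->
  exists j, matches j p /\ forall q, matches j q -> U q.
Proof.
move=> oU Up; have [eps eps0 HU] := oU p Up.
(* The enumerated ball must contain the one of radius 1/[eps]. Two spaces matching the same pattern
   differ by less than twice its precision, whence 2 / [e.+1] <= [eps] below. *)
pose L := (Num.truncn eps^-1).+1.
have L0 : 0 < L.+1%:R :> R by [].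
have [n [y yE]] := enumerates_exists p L0.
pose e := Num.truncn (2 / eps).
have He : 2 / e.+1%:R <= eps.
  rewrite ler_pdivrMr// -ler_pdivrMl// mulrC; apply/ltW.
  by rewrite real_truncnS_gt// num_real.
have [q qE] := @rat_approx _ (sample y (@mps_mark R (nnreal R) p)) e.+1%:R^-1 ltac:(by rewrite invr_gt0).
exists (L, n, e, q); split; first by exists y.
move=> p' [y' [y'E q'E]]; apply: HU.
have LE : eps^-1 < L.+1%:R.
  rewrite (lt_le_trans (real_truncnS_gt _)) ?num_real// ler_nat//.
exists (fun u v => exists i, u = y i /\ v = y' i); split.
- by exists ord0; case: yE => -[-> _ _] _; case: y'E => -[-> _ _] _.
- move=> u /le_lt_trans/(_ LE) uL; case: yE => _ /(_ u uL)[i ->].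
  by exists (y' i), i.
- move=> v /le_lt_trans/(_ LE) vL; case: y'E => _ /(_ v vL)[i ->].
  by exists (y i), i.
- move=> u v u' v' [i [-> ->]] [i' [-> ->]].
  exact: (near_triangle He (qE (inl (i, i'))) (q'E (inl (i, i')))).
- move=> u v [i [-> ->]]; rewrite nndistE distrC.
  exact: (near_triangle He (qE (inr i)) (q'E (inr i))).
Qed.

Definition kappa (p : mpspace (nnreal R)) : rfamily R pattern :=
  fun j => `[< matches j p >]%:R.

(** Borel sets of marked spaces factor through the countable family [kappa], so an ordinary
    measurable space replaces the inductively generated sigma-algebra. *)
Lemma mps_borel_kappa A : mps_borel A ->
  exists B : set (rfamily R pattern), measurable B /\ forall p, A p <-> B (kappa p).
Proof.
elim=> {A} [U oU|A _ [B [mB AB]]|F _ IH|A A' AA' _ [B [mB AB]]].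
- exists (\bigcup_(j in [set j | forall q, matches j q -> U q])
    [set f : rfamily R pattern | f j = 1]); split.
    rewrite bigcup_mkcond; apply: countable_bigcupT_measurable => [|j].
      exact: countableP.
    case: ifP => // _.
    have -> : [set f : rfamily R pattern | f j = 1] = (fun f : rfamily R pattern => f j) @^-1` [set 1] by [].
    by rewrite -[X in measurable X]setTI; apply: measurable_coordinate.
  move=> p; split=> [Up|[j /= jU]].
    have [j [jp jU]] := mps_open_matches oU Up.
    by exists j => //=; rewrite /kappa asboolT.
  rewrite /kappa; case: asboolP => [/jU//|_ /eqP].
  by rewrite eq_sym oner_eq0.
- exists (~` B); split; first exact: measurableC.
  by move=> p; split=> nA; [move/AB|move=> /AB].
- have /choice[B HB] := IH; exists (\bigcup_n B n); split.
    by apply: bigcupT_measurable => n; have [] := HB n.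
  move=> p; split=> [[n]|[n _]].
    by have [_ ->] := HB n; exists n.
  by have [_ <-] := HB n; exists n.
- by exists B; split=> // p; rewrite -AB; split=> /AA'.
Qed.

Variable F : factor R.

Definition mspace (p : pspace R) (w : measurableTypeR R) : mpspace (nnreal R) :=
  @MPSpace R (nnreal R) p (mark F p w).

Definition obs_sample n m (y : 'I_n.+1 -> 'I_m.+1) (f : rfamily R (observations m))
    (c : ('I_n.+1 * 'I_n.+1) + 'I_n.+1) : R :=
  match c with
  | inl ij => f (inl (y ij.1, y ij.2))
  | inr i => Num.max (f_out F (fun t => f (inr (t, y i)))) 0
  end.

(** The event [matches j] read off the observations of an enumeration of a ball at least as large as
    that of the pattern. *)
Definition obs_matches (j : pattern) m (f : rfamily R (observations m)) : Prop :=
  let: (L, n, e, q) := j in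
  exists y : {ffun 'I_n.+1 -> 'I_m.+1},
    [/\ y ord0 = ord0, injective y, forall i, f (inl (ord0, y i)) < L.+1%:R,
        forall i', f (inl (ord0, i')) < L.+1%:R -> exists i, i' = y i &
        near e q (obs_sample y f)].

Lemma measurable_obs_coordinate m (c : observations m) (r : R) :
  measurable [set f : rfamily R (observations m) | f c < r].
Proof.
rewrite -[X in measurable X]setTI.
by apply: (measurable_fun_ltr (measurable_coordinate c) (measurable_cst r)).
Qed.

Lemma measurable_forall_fin (I : finType) d (S : measurableType d) (A : I -> set S) :
  (forall i, measurable (A i)) -> measurable [set f | forall i, A i f].
Proof.
move=> mA; rewrite (_ : [set _ | _] = \bigcap_(i in setT) A i).
  by apply: fin_bigcap_measurable => //; exact: finite_finset.
by apply/seteqP; split=> f /= H i; [move=> _; exact: H|exact: H].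
Qed.

Lemma measurable_obs_matches j m :
  measurable [set f : rfamily R (observations m) | obs_matches j f].
Proof.
case: j => -[[L n] e] q.
rewrite (_ : [set _ | _] = \bigcup_(y in [set y : {ffun 'I_n.+1 -> 'I_m.+1} | y ord0 = ord0 /\ injective y])
  ([set f | forall i, f (inl (ord0, y i)) < L.+1%:R] `&`
   [set f | forall i', ([set f : rfamily R (observations m) | ~ f (inl (ord0, i')) < L.+1%:R] `|`
       [set f | exists i, i' = y i]) f] `&`
   [set f | near e q (obs_sample y f)])); last first.
  apply/seteqP; split=> f /=.
    move=> [y [y0 injy yL ycov ynear]]; exists y => //; split=> //; split=> // i'.
    have [fL|fL] := pselect (f (inl (ord0, i')) < L.+1%:R); last by left.
    by right; exact: ycov.
  move=> [y [y0 injy] [[yL ycov] ynear]]; exists y; split=> // i' fL.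
  by have [|] := ycov i'.
apply: fin_bigcup_measurable => [|y _]; first exact: finite_finset.
apply: measurableI; first apply: measurableI.
- by apply: measurable_forall_fin => i; exact: measurable_obs_coordinate.
- apply: measurable_forall_fin => i'; apply: measurableU.
    by apply: measurableC; exact: measurable_obs_coordinate.
  have [H|H] := pselect (exists i, i' = y i).
    by rewrite (_ : [set _ | _] = setT)//; apply/seteqP; split.
  by rewrite (_ : [set _ | _] = set0)//; apply/seteqP; split.
- apply: measurable_forall_fin => c.
  have ms : measurable_fun setT (fun f : rfamily R (observations m) => obs_sample y f c).
    case: c => [ij|i] /=; first exact: measurable_coordinate.
    apply: measurable_maxr => //.
    apply: (measurableT_comp (f_measurable F)).
    by apply: measurable_rfamily => t; exact: measurable_coordinate.
  rewrite -[X in measurable X]setTI.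
  apply: (measurable_fun_ltr (f := fun f : rfamily R (observations m) =>
    `|obs_sample y f c - ratr (nth 0 q (choice.pickle c))|)) => //.
  by apply: measurableT_comp => //; apply: measurable_funB.
Qed.

Lemma matches_obs (j : pattern) (L : R) m (p : pspace R) z w :
  enumerates L m p z -> j.1.1.1.+1%:R <= L ->
  matches j (mspace p w) <-> obs_matches j (obs F z w).
Proof.
case: j => -[[l n] e] q /= zE lL.
have E (y : {ffun 'I_n.+1 -> 'I_m.+1}) c :
    sample (fun i => z (y i)) (mark F p w) c = obs_sample y (obs F z w) c.
  by case: c.
have := zE; case => -[z0 injz zL] zcov.
split=> [[y [[yT ycov] ynear]]|[y [y0 injy yL ycov ynear]]].
  have : tuples l.+1%:R n p y := yT.
  rewrite (tuples_enumerates _ lL zE) => -[y' /and3P[/eqP y0 /injectiveP injy /forallP yL] yy'].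
  exists y'; split=> //.
  - move=> i' /=; rewrite z0 => /ycov[i]; rewrite -yy' => /injz ->; by exists i.
  - by move=> c; rewrite -E yy'; exact: ynear.
exists (fun i => z (y i)); split; last by move=> c; rewrite E; exact: ynear.
split.
  rewrite (tuples_enumerates _ lL zE); exists y => //; apply/and3P; split.
  - exact/eqP.
  - exact/injectiveP.
  - by apply/forallP => i; exact: yL.
move=> u uL; have [i' ui'] := zcov u (lt_le_trans uL lL).
have [|i ii'] := ycov i'; first by rewrite /= z0 -ui'.
by exists i; rewrite ui' ii'.
Qed.

End Patterns.

Section Process.
Context (R : realType) (F : factor R).

Lemma tuples_enumerate (L : R) m (p : pspace R) z y :
  enumerates L m p z -> tuples L m p y -> enumerates L m p y.
Proof.
move=> zE yT; apply: enumerates_maximal => // -[y' y'T].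
by have := enumerates_unique zE y'T; rewrite ltnn.
Qed.

Lemma matches_preimage j (L : R) m (p : pspace R) z :
  enumerates L m p z -> j.1.1.1.+1%:R <= L ->
  [set w | matches j (mspace F p w)] =
  obs F z @^-1` [set f | obs_matches F j f].
Proof. by move=> zE jL; apply/seteqP; split=> w /= /(matches_obs F _ zE jL). Qed.

Lemma measurable_kappa (p : pspace R) :
  measurable_fun setT (fun w => kappa (mspace F p w)).
Proof.
apply: measurable_rfamily => j.
have [m [z zE]] := @enumerates_exists R j.1.1.1.+1%:R p (ltr0Sn R _).
rewrite (_ : (fun _ => _) = \1_[set w | matches j (mspace F p w)]).
  apply: measurable_indic; rewrite (matches_preimage zE)//.
  by apply: measurable_obs_preimage; exact: measurable_obs_matches.
by apply/funext => w; rewrite indicE /kappa; congr (nat_of_bool _)%:R.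
Qed.

Definition obs_kappa m (f : rfamily R (observations m)) : rfamily R pattern :=
  fun j => `[< obs_matches F j f >]%:R.

Lemma measurable_obs_kappa m : measurable_fun setT (@obs_kappa m).
Proof.
apply: measurable_rfamily => j.
rewrite (_ : (fun _ => _) = \1_[set f | obs_matches F j f]).
  by apply: measurable_indic; exact: measurable_obs_matches.
by apply/funext => w; rewrite indicE /obs_kappa; congr (nat_of_bool _)%:R.
Qed.

Lemma esum_cst (T : choiceType) (A : set T) (c : \bar R) : finite_set A ->
  (0 <= c)%E -> (\esum_(y in A) c = c * \esum_(y in A) 1)%E.
Proof.
move=> finA c0; rewrite !esum_fset// !fsbig_finite// ge0_sume_distrr//.
by apply: eq_bigr => y _; rewrite mule1.
Qed.

(** A cylinder depends on finitely many patterns, hence on the observations of any enumeration of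
    one large ball. The probability is the same for each enumeration, so it is the ratio of the two
    measurable quantities [obs_weight F L m p (Psi m)] and [obs_weight F L m p setT]. *)
Lemma psm_kappa B : measurable B ->
  psm (fun p => coin (R := R) [set w | B (kappa (mspace F p w))]).
Proof.
move: B; apply: psm_kernel => [p|C fC].
  pose m := distribution (coin (R := R)) (mfun_Sub (mem_set (measurable_kappa p))).
  by exists m; split; first exact: (le_lt_trans (probability_le1 m measurableT) (ltry _)).
have mC := measurable_finite_cylinder fC.
case: fC => s os CE.
have [l Hl] : exists l, forall z, List.In z s -> (z.1.1.1.1.+1 <= l)%N.
  elim: s {os CE} => [|z s [l IH]]; first by exists 0%N.
  exists (maxn z.1.1.1.1.+1 l) => z' [<-|/IH]; first exact: leq_maxl.
  by move=> z'l; rewrite leq_max z'l orbT.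
pose L : R := l.+1%:R.
have L0 : 0 < L by [].
have HL z : List.In z s -> z.1.1.1.1.+1%:R <= L.
  by move=> /Hl zl; rewrite ler_nat; exact: leq_trans zl _.
pose Psi m : set (rfamily R (observations m)) := @obs_kappa m @^-1` C.
have mPsi m : measurable (Psi m).
  by rewrite -[X in measurable X]setTI; exact: measurable_obs_kappa.
have key p m z : enumerates L m p z ->
    coin (R := R) (obs F z @^-1` Psi m) = coin (R := R) [set w | C (kappa (mspace F p w))].
  move=> zE; congr coin.
  have E u w : List.In u s -> obs_kappa (obs F z w) u.1 = kappa (mspace F p w) u.1.
    move=> us; rewrite /obs_kappa /kappa; congr (nat_of_bool _)%:R.
    by apply/asboolP/asboolP => /(matches_obs F w zE (HL u us)).
  rewrite /Psi CE; apply/seteqP; split=> w /= H u us; have := H u us.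
    by rewrite E.
  by rewrite -E.
apply: psm_ereal => r.
(* The comparison of the ratio with [r] is written without division. If the ball has [m.+1] points,
   every rooted tuple of that size enumerates it. *)
apply: (@gen_sigma_ext _ _ (fun p => exists m, (exists y, enumerates L m p y) /\
   (0 < obs_weight F L m p (Psi m) - r%:E * obs_weight F L m p setT)%E)); last first.
  apply: gen_sigma_bigcup => m; apply: gen_sigmaI; first exact: ps_borel_enumerable.
  have mw := psm_sub (psm_obs_weight F L0 (mPsi m))
    (psm_comp (measurable_funeM r%:E (@measurable_id _ (\bar R) setT)) (psm_obs_weight F L0 (@measurableT _ (rfamily R (observations m))))).
  have := mw `]0%E, +oo[%classic (emeasurable_itv _).
  by apply: gen_sigma_ext => p; rewrite /= in_itv/= andbT.
move=> p.
have wE m z : enumerates L m p z ->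
    [/\ obs_weight F L m p (Psi m) = (coin (R := R) [set w | C (kappa (mspace F p w))] *
          obs_weight F L m p setT)%E, (0 < obs_weight F L m p setT)%E &
        (obs_weight F L m p setT \is a fin_num)].
  move=> zE; have E1 : obs_weight F L m p setT = (\esum_(y in tuples L m p) 1)%E.
    by apply: eq_esum => y _; rewrite preimage_setT [LHS]probability_setT.
  have finT := finite_tuples L m p.
  split.
  - rewrite E1 -esum_cst//; apply: eq_esum => y yT.
    exact: (key _ _ _ (tuples_enumerate zE yT)).
  - rewrite E1 (@lt_le_trans _ _ 1%E)// ?lte_fin//.
    apply: esum_ge; exists [set z]; last by rewrite fsbig_set1.
    by split=> // _ ->; case: zE.
  - by rewrite E1 esum_fset// fsbig_finite//; apply/sum_fin_numP => y _ _.
split=> [[m [[z zE]]]|rC].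
  have [-> w0 wfin] := wE m z zE.
  by rewrite sube_gt0 lte_pmul2r.
have [m [z zE]] := enumerates_exists p L0.
exists m; split; first by exists z.
have [-> w0 wfin] := wE m z zE.
by rewrite sube_gt0 lte_pmul2r.
Qed.

Lemma law_measurable (A : mpspace (nnreal R) -> Prop) : mps_borel A ->
  forall B : set (\bar R), measurable B ->
  ps_borel (fun p : pspace R => B (law F p [set m | A (@MPSpace R (nnreal R) p m)])).
Proof.
move=> /mps_borel_kappa[K [mK AK]] B mB.
apply: gen_sigma_ext (psm_kappa mK mB) => p.
rewrite lawE; have -> // : [set w | K (kappa (mspace F p w))] =
  mark F p @^-1` [set m | A (@MPSpace R (nnreal R) p m)].
by apply/seteqP; split=> w /AK.
Qed.

Definition fiid : eqprocess (nnreal R) :=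
  EqProcess (@law_isometry R F) law_measurable.

End Process.

Lemma seq_max (R : realType) (T : eqType) (f : T -> R) x s :
  exists2 y, y \in x :: s & forall u, u \in x :: s -> f u <= f y.
Proof.
elim: s x => [|a s IH] x.
  by exists x; rewrite ?mem_head// => u; rewrite inE => /eqP ->.
have [y ys ymax] := IH a; have [xy|yx] := leP (f x) (f y).
  exists y; first by rewrite inE ys orbT.
  by move=> u; rewrite inE => /orP[/eqP->//|/ymax].
exists x; first exact: mem_head.
by move=> u; rewrite inE => /orP[/eqP->//|/ymax /le_trans]; apply; exact: ltW.
Qed.

Section LawProperties.
Context (R : realType) (F : factor R).

Lemma measurable_forall_ds (D : discreteSpace R) d (S : measurableType d)
    (A : D -> set S) :
  (forall x, measurable (A x)) -> measurable [set f | forall x, A x f].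
Proof.
move=> mA; rewrite (_ : [set _ | _] = ~` \bigcup_x ~` A x).
  apply: measurableC; apply: countable_bigcupT_measurable => [|x].
    exact: ds_countable.
  exact: measurableC.
rewrite setC_bigcup; apply/seteqP; split=> f /= H x; last by have := H x I; rewrite setCK.
by move=> _; rewrite setCK; exact: H.
Qed.

(** The property of interest need not be visibly measurable: it suffices to find a measurable
    sufficient condition that holds for all outcomes. *)
Lemma ae_law (D : discreteSpace R) (Q Q' : set (marking (nnreal R) D)) :
  measurable Q' -> (forall w, Q' (mark F D w)) -> Q' `<=` Q ->
  {ae law F D, forall m, Q m}.
Proof.
move=> mQ' wQ' Q'Q; exists (~` Q'); split; first exact: measurableC.
  rewrite lawE (_ : _ @^-1` _ = set0) ?measure0//.
  by rewrite -subset0 => w /=; apply; exact: wQ'.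
by move=> m /= nQ /Q'Q.
Qed.

Lemma integral_law (D : discreteSpace R) (f : marking (nnreal R) D -> \bar R) :
  measurable_fun setT f -> (forall m, 0 <= f m)%E ->
  (\int[law F D]_m f m = \int[coin (R := R)]_w f (mark F D w))%E.
Proof.
move=> mf f0; by rewrite /law /distribution/= ge0_integral_pushforward.
Qed.

Lemma measurable_mark_sum (D : discreteSpace R) (v : D) r :
  measurable_fun setT (fun m : marking (nnreal R) D =>
    \sum_(u \in [set u | mdist v u <= r]) nnval (m u)).
Proof.
have -> : (fun m : marking (nnreal R) D => \sum_(u \in [set u | mdist v u <= r]) nnval (m u)) =
    (fun m : marking (nnreal R) D => \sum_(u <- fset_set [set u | mdist v u <= r]) nnval (m u)).
  by apply/funext => m; rewrite (fsbig_finite _ _ (ds_finite v r)).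
by apply: measurable_sum => u; exact: measurable_root_mark.
Qed.

Lemma weight_cball (p : pspace R) (m : p -> nnreal R) (v : p) r : r != 0 ->
  @weight R (@MPSpace R (nnreal R) p m) (cball v r) =
  (\sum_(u \in [set u | mdist v u <= r]) nnval (m u))%:E.
Proof.
move=> r0; rewrite /weight /cball (negbTE r0) esum_fset; last 2 first.
- exact: ds_finite.
- by move=> u _; rewrite lee_fin; exact: nnval_ge0.
by rewrite !(fsbig_finite _ _ (ds_finite v r)) sumEFin.
Qed.

(** Reduces the uncountably many constraints on [r] to the radii 1 and [mdist v y], of which there
    are countably many. *)
Lemma ball_radius_attained (D : discreteSpace R) (v : D) (r : R) : 1 <= r ->
  exists2 y, Num.max 1 (mdist v y) <= r &
    [set u | mdist v u <= r] = [set u | mdist v u <= Num.max 1 (mdist v y)].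
Proof.
move=> r1; have /finite_seqP[s sE] := ds_finite v r.
have sP u : (u \in s) <-> mdist v u <= r.
  by have : [set` s] u <-> [set u | mdist v u <= r] u by rewrite sE.
have vs : v \in s by apply/sP; rewrite mdistxx (le_trans _ r1).
have [y] := seq_max (mdist v) v s.
have -> : (y \in v :: s) = (y \in s) by rewrite inE; case: eqP => // ->.
move=> ys ymax0; have ymax u : u \in s -> mdist v u <= mdist v y.
  by move=> us; apply: ymax0; rewrite inE us orbT.
have yr : Num.max 1 (mdist v y) <= r by rewrite ge_max r1; exact/sP.
exists y => //; apply/seteqP; split=> u /= ur; last exact: le_trans yr.
by rewrite le_max ymax ?orbT//; exact/sP.
Qed.

Lemma weight_ae (p : pspace R) (a : R) : 0 <= a ->
  (forall w (v : p) r, 1 <= r ->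
    \sum_(u \in [set u | mdist v u <= r]) nnval (mark F p w u) <= r `^ a) ->
  {ae law F p, forall m, forall (v : p) (r : R), 1 <= r ->
     (@weight R (@MPSpace R (nnreal R) p m) (cball v r) <= (r `^ a)%:E)%E}.
Proof.
move=> a0 H; apply: (@ae_law _ _ [set m : marking (nnreal R) p | forall v : p, forall y : p,
   \sum_(u \in [set u | mdist v u <= Num.max 1 (mdist v y)]) nnval (m u) <=
   (Num.max 1 (mdist v y)) `^ a]).
- apply: (@measurable_forall_ds p _ _ (fun v => [set m : marking (nnreal R) p | forall y : p,
   \sum_(u \in [set u | mdist v u <= Num.max 1 (mdist v y)]) nnval (m u) <=
   (Num.max 1 (mdist v y)) `^ a])) => v.
  apply: (@measurable_forall_ds p _ _ (fun y => [set m : marking (nnreal R) p |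
   \sum_(u \in [set u | mdist v u <= Num.max 1 (mdist v y)]) nnval (m u) <=
   (Num.max 1 (mdist v y)) `^ a])) => y.
  rewrite -[X in measurable X]setTI.
  by apply: (measurable_fun_ler (measurable_mark_sum v _) (measurable_cst _)).
- by move=> w v y; apply: H; rewrite le_max lexx.
- move=> m /= Hm v r r1; rewrite weight_cball; last by rewrite gt_eqF// (lt_le_trans _ r1).
  have [y yr E] := ball_radius_attained v r1.
  rewrite lee_fin E (le_trans (Hm v y))// ge0_ler_powR// nnegrE ?le_max ?ler01//.
  exact: le_trans r1.
Qed.

Lemma covers_ae (p : pspace R) :
  (forall w (y : p), exists v, nnval (mark F p w v) != 0 /\ mdist v y <= nnval (mark F p w v)) ->
  {ae law F p, forall m, covers (@MPSpace R (nnreal R) p m)}.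
Proof.
move=> H; apply: (@ae_law _ _ [set m : marking (nnreal R) p | forall y : p,
   (\bigcup_v [set m : marking (nnreal R) p | nnval (m v) != 0 /\ mdist v y <= nnval (m v)]) m]).
- apply: (@measurable_forall_ds p _ _ (fun y => \bigcup_v [set m : marking (nnreal R) p | nnval (m v) != 0 /\ mdist v y <= nnval (m v)])) => y.
  apply: countable_bigcupT_measurable => [|v]; first exact: ds_countable.
  rewrite (_ : [set m | _] = ~` [set m : marking (nnreal R) p | nnval (m v) == 0] `&`
     [set m : marking (nnreal R) p | mdist v y <= nnval (m v)]); last first.
    by apply/seteqP; split=> m /= [/negP ? ?]; split=> //; exact/negP.
  apply: measurableI; first apply: measurableC.
    rewrite -[X in measurable X]setTI.
    by apply: (measurable_fun_eqr (measurable_root_mark v) (measurable_cst _)).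
  rewrite -[X in measurable X]setTI.
  by apply: (measurable_fun_ler (measurable_cst _) (measurable_root_mark v)).
- by move=> w y; have [v [v0 vy]] := H w y; exists v.
- move=> m /= Hm; apply/seteqP; split=> // y _.
  by have [v _ [/negbTE v0 vy]] := Hm y; exists v => //; rewrite /cball v0.
Qed.

Lemma radii_ae (p : pspace R) :
  (forall w (v : p), nnval (mark F p w v) = 0 \/ 1 <= nnval (mark F p w v)) ->
  {ae law F p, forall m, radii_ge1 (@MPSpace R (nnreal R) p m)}.
Proof.
move=> H; apply: (@ae_law _ _ [set m : marking (nnreal R) p | forall v : p,
   ([set m : marking (nnreal R) p | nnval (m v) == 0] `|`
    [set m : marking (nnreal R) p | 1 <= nnval (m v)]) m]).
- apply: (@measurable_forall_ds p _ _ (fun v => [set m : marking (nnreal R) p | nnval (m v) == 0] `|`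
    [set m : marking (nnreal R) p | 1 <= nnval (m v)])) => v; apply: measurableU.
    rewrite -[X in measurable X]setTI.
    by apply: (measurable_fun_eqr (measurable_root_mark v) (measurable_cst _)).
  rewrite -[X in measurable X]setTI.
  by apply: (measurable_fun_ler (measurable_cst _) (measurable_root_mark v)).
- by move=> w v; case: (H w v) => h; [left; rewrite /= h|right].
- by move=> m /= Hm v; case: (Hm v) => [/eqP|]; [left|right].
Qed.

End LawProperties.

(** * Pointed spaces sampled from a configuration *)

Section EuclidTopology.
Context (R : realType) (k : nat).

Lemma euclid_dist_le_sum (x y : euclid R k) :
  euclid_dist x y <= \sum_(i < k) `|x ord0 i - y ord0 i|.
Proof.
have S0 : 0 <= \sum_(i < k) `|x ord0 i - y ord0 i| by apply: sumr_ge0.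
rewrite -(ler_pXn2r (ltn0Sn 1)) ?nnegrE ?sqrtr_ge0// sqr_sqrtr; last first.
  by apply: sumr_ge0 => i _; exact: sqr_ge0.
rewrite expr2 big_distrl/=; apply: ler_sum => i _.
rewrite -real_normK ?num_real// expr2 ler_wpM2l//.
by rewrite (bigD1 i)//= lerDl sumr_ge0.
Qed.

Lemma coord_le_euclid_dist (x y : euclid R k) i :
  `|x ord0 i - y ord0 i| <= euclid_dist x y.
Proof.
rewrite -(ler_pXn2r (ltn0Sn 1)) ?nnegrE ?sqrtr_ge0// sqr_sqrtr; last first.
  by apply: sumr_ge0 => j _; exact: sqr_ge0.
rewrite real_normK ?num_real// (bigD1 i)//= lerDl.
by apply: sumr_ge0 => j _; exact: sqr_ge0.
Qed.

Lemma mdist_euclid (x y : euclid R k) : mdist x y = euclid_dist x y.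
Proof. by []. Qed.

Definition rational_point (c : 'rV[rat]_k) : euclid R k := map_mx ratr c.

Lemma rational_point_dense (x : euclid R k) e : 0 < e ->
  exists c, mdist (rational_point c) x < e.
Proof.
move=> e0; have e1 : 0 < e / k.+1%:R by rewrite divr_gt0.
have /choice[f fE] : forall i, exists r : rat, `|ratr r - x ord0 i| < e / k.+1%:R.
  move=> i; have [|r] := @rat_in_itvoo R (x ord0 i - e / k.+1%:R) (x ord0 i + e / k.+1%:R).
    by rewrite ltrD2l gt0_cp.
  rewrite in_itv/= => /andP[r1 r2]; exists r.
  by rewrite ltr_distl r1.
exists (\row_i f i); rewrite mdist_euclid (le_lt_trans (euclid_dist_le_sum _ _))//.
apply: (@le_lt_trans _ _ (\sum_(i < k) e / k.+1%:R)).
  by apply: ler_sum => i _; rewrite !mxE; exact: ltW.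
by rewrite sumr_const card_ord -[X in X < _]mulr_natl mulrA ltr_pdivrMr// mulrC ltr_pM2l// ltr_nat.
Qed.

Lemma open_mball (X : metricType R) (c : X) e : open [set y | mdist c y < e].
Proof.
rewrite openE => y /= cy; apply/nbhs_ballP; exists (e - mdist c y) => /=.
  by rewrite subr_gt0.
move=> z; rewrite ballEmdist/= => yz.
by rewrite (le_lt_trans (metric_triangle _ y _))// addrC -ltrBrDr.
Qed.

Lemma measurable_mball (c : euclid R k) e :
  measurable ([set y | mdist c y < e] : set (borel_euclid R k)).
Proof. apply: sub_sigma_algebra; exact: (@open_mball (euclid R k)). Qed.

Lemma measurable_hit (B : set (borel_euclid R k)) : measurable B ->
  measurable [set phi : lfset R k | exists z : euclid R k, sval phi z /\ B z].
Proof.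
move=> mB; rewrite (_ : [set _ | _] =
    ~` [set phi : lfset R k | ((sval phi `&` B) #= `I_0)%card]).
  by apply: measurableC; apply: sub_sigma_algebra; exists B, 0%N.
apply/seteqP; split=> phi /=; rewrite II0 card_eq0.
  by move=> [z [pz Bz]] /eqP/seteqP[/(_ z) + _]; exact.
by move=> /negP/set0P[z [pz Bz]]; exists z.
Qed.

End EuclidTopology.

Section Configurations.
Context (R : realType) (k : nat).

Local Notation RT := (lfset R k * borel_euclid R k)%type.

Definition hits (c : 'rV[rat]_k) (m : nat) : set RT :=
  [set z | exists t : euclid R k, sval z.1 t /\ mdist (rational_point R c) t < m.+1%:R^-1].

Definition lies (c : 'rV[rat]_k) (m : nat) : set RT :=
  [set z | mdist (rational_point R c) (z.2 : euclid R k) < m.+1%:R^-1].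

Lemma measurable_hits c m : measurable (hits c m).
Proof.
have := @measurable_fst _ _ (lfset R k) (borel_euclid R k) measurableT _ (measurable_hit (measurable_mball (rational_point R c) m.+1%:R^-1)).
by rewrite setTI.
Qed.

Lemma measurable_lies c m : measurable (lies c m).
Proof.
have := @measurable_snd _ _ (lfset R k) (borel_euclid R k) measurableT _ (measurable_mball (rational_point R c) m.+1%:R^-1).
by rewrite setTI.
Qed.

Definition occupied : set RT := [set z | sval z.1 (z.2 : euclid R k)].

Lemma locally_finite_isolated (A : set (euclid R k)) x : locally_finite A ->
  exists2 e : R, 0 < e & forall t, A t -> mdist x t < e -> t = x.
Proof.
move=> lfA; have /small_all H := lfA x 1.
have [|e e0 He] := H R (fun t e => t != x -> e <= mdist x t).
  move=> t _; have [->|tx] := eqVneq t x; first by exists 1.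
  exists (mdist x t); first by rewrite mdist_gt0 eq_sym.
  by [].
exists (Num.min e 1); first by rewrite lt_min e0 ltr01.
move=> t At; rewrite lt_min => /andP[te t1]; apply/eqP; apply: contraTT te => tx.
by rewrite -leNgt; apply: He => //; split=> //; exact: ltW.
Qed.

(** A locally finite set contains [x] as soon as it has points arbitrarily close to [x]; this is
    expressed with rational balls. *)
Lemma occupiedE : occupied = \bigcap_m \bigcup_c (lies c m `&` hits c m).
Proof.
apply/seteqP; split=> [[phi x]|[phi x]]; rewrite /occupied/=.
  move=> px m _; have [|c cx] := @rational_point_dense R k x m.+1%:R^-1.
    by rewrite invr_gt0.
  by exists c => //; split=> //; exists x.
move=> H; have [e e0 He] := locally_finite_isolated x (svalP phi).
pose m := Num.truncn (2 / e).
have He2 : 2 / m.+1%:R < e.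
  by rewrite ltr_pdivrMr// -ltr_pdivrMl// mulrC real_truncnS_gt// num_real.
have [c _ [/= cx [t [pt ct]]]] := H m I.
have <- // : t = x; apply: He => //.
rewrite (lt_trans _ He2)// (le_lt_trans (metric_triangle _ (rational_point R c) _))//.
by rewrite metric_sym mulr_natl mulr2n ltrD.
Qed.

Lemma measurable_occupied : measurable occupied.
Proof.
rewrite occupiedE; apply: bigcapT_measurable => m.
apply: countable_bigcupT_measurable => [|c]; first exact: countableP.
by apply: measurableI; [exact: measurable_lies|exact: measurable_hits].
Qed.

(** An open condition on tuples is a countable union over rational boxes, and whether a
    configuration hits a ball is a counting event. *)
Lemma measurable_open_tuples n (O : ('I_n.+1 -> euclid R k) -> Prop) :
  (forall y, O y -> exists2 e : R, 0 < e &
     forall y' : 'I_n.+1 -> euclid R k, (forall i, mdist (y i) (y' i) < e) -> O y') ->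
  measurable [set z : RT | exists y : 'I_n.+1 -> euclid R k,
    [/\ y ord0 = z.2, forall i, sval z.1 (y i) & O y]].
Proof.
move=> oO.
(* The boxes, with rational centres and common radius 1 / [cm.2.+1], that are contained in [O]. *)
pose good (cm : {ffun 'I_n.+1 -> 'rV[rat]_k} * nat) := forall y : 'I_n.+1 -> euclid R k,
  (forall i, mdist (rational_point R (cm.1 i)) (y i) < cm.2.+1%:R^-1) -> O y.
rewrite (_ : [set _ | _] = occupied `&` \bigcup_(cm in good)
   (lies (cm.1 ord0) cm.2 `&` \bigcap_(i in [set: 'I_n.+1]) hits (cm.1 i) cm.2)).
  apply: measurableI; first exact: measurable_occupied.
  rewrite bigcup_mkcond; apply: countable_bigcupT_measurable => [|cm].
    exact: countableP.
  case: ifP => // _; apply: measurableI; first exact: measurable_lies.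
  by apply: fin_bigcap_measurable => [|i _]; [exact: finite_finset|exact: measurable_hits].
apply/seteqP; split=> [[phi x] /= [y [y0 py Oy]]|[phi x] [/= px [cm gcm [cx H]]]].
  split; first by rewrite /occupied/= -y0.
  have [e e0 He] := oO y Oy.
  pose m := Num.truncn (2 / e).
  have He2 : 2 / m.+1%:R < e.
    by rewrite ltr_pdivrMr// -ltr_pdivrMl// mulrC real_truncnS_gt// num_real.
  have /choice[c cE] : forall i, exists c, mdist (rational_point R c) (y i) < m.+1%:R^-1.
    by move=> i; apply: rational_point_dense; rewrite invr_gt0.
  exists ([ffun i => c i], m).
    move=> y' /= cy'; apply: He => i; rewrite (lt_trans _ He2)//.
    rewrite (le_lt_trans (metric_triangle _ (rational_point R (c i)) _))//.
    rewrite metric_sym mulr_natl mulr2n ltrD//; have := cy' i; by rewrite ffunE.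
  split; first by rewrite /lies/= ffunE -y0.
  by move=> i _; exists (y i); rewrite /= ffunE.
have /choice[t tE] : forall i, exists t : euclid R k,
    sval phi t /\ mdist (rational_point R (cm.1 i)) t < cm.2.+1%:R^-1.
  by move=> i; exact: (H i I).
exists (fun i => if i == ord0 then x else t i); split.
- by rewrite eqxx.
- by move=> i; case: eqP => // _; have [] := tE i.
- by apply: gcm => i; case: eqP => [->//|_]; have [] := tE i.
Qed.

Definition at_point (phi : lfset R k) (x : euclid R k) (h : sval phi x) : pspace R :=
  @PSpace R (subspace_ds (svalP phi)) (exist _ x (mem_set h)).

Lemma measurable_tuple_event (L : R) n (Q : ('I_n.+1 * 'I_n.+1 -> R) -> Prop) :
  (forall f, Q f -> exists2 e : R, 0 < e &
     forall f' : 'I_n.+1 * 'I_n.+1 -> R, (forall c, `|f c - f' c| < e) -> Q f') ->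
  measurable [set z : RT | exists h : sval z.1 (z.2 : euclid R k),
    exists2 y, tuples L n (at_point h) y & Q (dmat y)].
Proof.
move=> oQ.
rewrite (_ : [set _ | _] = [set z : RT | exists y : 'I_n.+1 -> euclid R k,
    [/\ y ord0 = z.2, forall i, sval z.1 (y i) &
     [/\ forall i j, i != j -> 0 < mdist (y i) (y j),
         forall i, mdist (y ord0) (y i) < L &
         Q (fun ij => mdist (y ij.1) (y ij.2))]]]); last first.
  apply/seteqP; split=> [[phi x] [h [y [y0 injy yL] Qy]]|[phi x] [y [y0 py [injy yL Qy]]]].
    exists (fun i => val (y i)); split.
    - by rewrite y0.
    - by move=> i; exact: set_mem (valP (y i)).
    - split=> // [i j|i]; last by rewrite y0; exact: yL.
      by rewrite mdist_gt0; apply: contra_neq => /val_inj/injy.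
  simpl in *.
  have h : sval phi x by rewrite -y0.
  exists h; exists (fun i => exist _ (y i) (mem_set (py i))) => //.
  split.
  - exact: val_inj.
  - move=> i j /(congr1 val) /= yij; apply/eqP; apply: contraT => /injy.
    by rewrite yij mdistxx ltxx.
  - by move=> i; have := yL i; rewrite y0.
apply: (@measurable_open_tuples n (fun y =>
  [/\ forall i j, i != j -> 0 < mdist (y i) (y j),
         forall i, mdist (y ord0) (y i) < L &
         Q (fun ij => mdist (y ij.1) (y ij.2))])).
move=> y [injy yL Qy].
have dE (e : R) (y' : 'I_n.+1 -> euclid R k) : (forall i, mdist (y i) (y' i) < e) ->
    forall i j, `|mdist (y i) (y j) - mdist (y' i) (y' j)| < 2 * e.
  move=> yy' i j; have h1 := yy' i; have h2 := yy' j.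
  have t1 := metric_triangle (y i) (y' i) (y j).
  have t2 := metric_triangle (y' i) (y' j) (y j).
  have t3 := metric_triangle (y' i) (y i) (y' j).
  have t4 := metric_triangle (y i) (y j) (y' j).
  have s1 := metric_sym (y' i) (y i); have s2 := metric_sym (y' j) (y j).
  rewrite ltr_norml; apply/andP; split; lra.
have [eQ eQ0 HQ] := oQ _ Qy.
have : small (fun e : R => (2 * e <= eQ) /\
   forall ij : 'I_n.+1 * 'I_n.+1, [set: 'I_n.+1 * 'I_n.+1] ij ->
     (ij.1 != ij.2 -> 2 * e <= mdist (y ij.1) (y ij.2)) /\
     (2 * e <= L - mdist (y ord0) (y ij.1))).
  have sm (c : R) : 0 < c -> small (fun e => 2 * e <= c).
    by move=> c0; exists (c / 2) => [|e e0]; [rewrite divr_gt0|rewrite ler_pdivlMr// mulrC].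
  apply: smallI; first exact: sm.
  apply: small_all => [|[i j] _ /=]; first exact: finite_finset.
  apply: smallI; last by apply: sm; rewrite subr_gt0.
  have [->|ij] := eqVneq i j; first by exists 1.
  by have [e e0 He] := sm _ (injy i j ij); exists e => // f f0 fe _; exact: He.
move=> /small_exists[e e0 [eQe He]]; exists e => // y' yy'.
have d := dE e y' yy'; split.
- move=> i j ij; have [/(_ ij) h _] := He (i, j) I.
  have := d i j; rewrite ltr_norml => /andP[_]; simpl in h; lra.
- move=> i; have [_ h] := He (i, ord0) I.
  have := d ord0 i; rewrite ltr_norml => /andP[h1 _]; simpl in h; lra.
- by apply: HQ => -[i j] /=; rewrite (lt_le_trans (d i j)).
Qed.

End Configurations.

Section Sampling.
Context (R : realType) (k : nat).

Local Notation RT := (lfset R k * borel_euclid R k)%type.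

Definition atx (phi : lfset R k) (x : euclid R k) : pspace R :=
  match pselect (sval phi x) with
  | left h => at_point h
  | right _ => singleton_pspace R
  end.

Lemma at0E (phi : lfset R k) : at0 phi = atx phi 0.
Proof. by []. Qed.

Lemma atxE (phi : lfset R k) (x : euclid R k) (h : sval phi x) : atx phi x = at_point h.
Proof.
by rewrite /atx; case: pselect => // h'; rewrite (Prop_irrelevance h h').
Qed.

Lemma measurable_at_point_matches j :
  measurable [set z : RT | exists h : sval z.1 (z.2 : euclid R k),
    matches j (@MPSpace R (nnreal R) (at_point h) (fun _ => nnmark 0))].
Proof.
case: j => -[[L n] e] q.
pose Q (f : 'I_n.+1 * 'I_n.+1 -> R) : Prop :=
  near e q (fun c => if c is inl ij then f ij else 0).
rewrite (_ : [set _ | _] =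
  [set z : RT | exists h : sval z.1 (z.2 : euclid R k),
    exists2 y, tuples L.+1%:R n (at_point h) y & Q (dmat y)] `&`
  ~` [set z : RT | exists h : sval z.1 (z.2 : euclid R k),
    exists2 y, tuples L.+1%:R n.+1 (at_point h) y & True]); last first.
  apply/seteqP; split=> [[phi x] [h [y [yE yQ]]]|[phi x] [[h [y yT yQ]] noy]].
    split; first exists h, y; first by case: yE.
      move=> c; have := yQ c; case: c => [//|i] /=.
      by rewrite /nnval /= maxxx.
    move=> [h' [y' y'T _]]; move: y' y'T; rewrite (Prop_irrelevance h' h) => y' y'T.
    by have := enumerates_unique yE y'T; rewrite ltnn.
  exists h, y; split.
    by apply: enumerates_maximal => // -[y' y'T]; apply: noy; exists h, y'.
  move=> c; have := yQ c; case: c => [//|i] /=.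
  by rewrite /nnval /= maxxx.
apply: measurableI; last apply: measurableC.
  apply: measurable_tuple_event => f Qf.
  have : small (fun e' : R => forall c : 'I_n.+1 * 'I_n.+1, [set: 'I_n.+1 * 'I_n.+1] c ->
      e' <= e.+1%:R^-1 - `|f c - ratr (nth 0 q (choice.pickle (inl c : ('I_n.+1 * 'I_n.+1) + 'I_n.+1)))|).
    apply: small_all => [|c _]; first exact: finite_finset.
    apply: small_le; rewrite subr_gt0; exact: (Qf (inl c)).
  move=> /small_exists[e' e'0 He]; exists e' => // f' ff' [c|i]; last exact: (Qf (inr i)).
  have h1 := He c I; have h2 := ff' c.
  set r := ratr _ in h1 *.
  have -> : f' c - r = (f c - r) - (f c - f' c) by ring.
  by rewrite (le_lt_trans (ler_normB _ _))// addrC -ltrBrDr (lt_le_trans h2).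
by apply: (@measurable_tuple_event R k L.+1%:R n.+1 (fun=> True)) => f _; exists 1.
Qed.

(** Unmarked spaces are treated as spaces with constant mark 0, so that [mps_open_matches] again
    turns an open set into a countable union. *)
Lemma measurable_at_point A : ps_borel A ->
  measurable [set z : RT | exists h : sval z.1 (z.2 : euclid R k), A (at_point h)].
Proof.
elim=> {A} [U oU|A _ mA|A _ mA|A B AB _ mA].
- pose U' (p : mpspace (nnreal R)) : Prop := U p.
  have oU' : mps_open U'.
    move=> p Up; have [e e0 He] := oU _ Up; exists e => // q [C [C1 C2 C3 C4 C5]].
    by apply: He; exists C.
  rewrite (_ : [set _ | _] = \bigcup_(j in [set j | forall q, matches j q -> U' q])
    [set z : RT | exists h : sval z.1 (z.2 : euclid R k),
      matches j (@MPSpace R (nnreal R) (at_point h) (fun _ => nnmark 0))]).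
    rewrite bigcup_mkcond; apply: countable_bigcupT_measurable => [|j].
      exact: countableP.
    by case: ifP => // _; exact: measurable_at_point_matches.
  apply/seteqP; split=> [[phi x] [h Uh]|[phi x] [j jU [h hj]]].
    have [j [jm jU]] := mps_open_matches oU'
      (Uh : U' (@MPSpace R (nnreal R) (at_point h) (fun _ => nnmark 0))).
    by exists j => //; exists h.
  by exists h; exact: (jU _ hj).
- rewrite (_ : [set _ | _] = @occupied R k `\`
    [set z : RT | exists h : sval z.1 (z.2 : euclid R k), A (at_point h)]).
    by apply: measurableD => //; exact: measurable_occupied.
  apply/seteqP; split=> [[phi x] [h nA]|[phi x] [h nA]].
    by split=> // -[h' Ah']; apply: nA; rewrite (Prop_irrelevance h h').
  by exists h => Ah; apply: nA; exists h.
- rewrite (_ : [set _ | _] = \bigcup_n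
    [set z : RT | exists h : sval z.1 (z.2 : euclid R k), A n (at_point h)]).
    exact: bigcupT_measurable.
  apply/seteqP; split=> [[phi x] [h [n Ah]]|[phi x] [n _ [h Ah]]].
    by exists n => //; exists h.
  by exists h, n.
- rewrite (_ : [set _ | _] =
    [set z : RT | exists h : sval z.1 (z.2 : euclid R k), A (at_point h)])//.
  by apply/seteqP; split=> [[phi x] [h /AB]|[phi x] [h /AB]]; exists h.
Qed.

Lemma measurable_atx d (S : measurableType d) (f : pspace R -> S) : psm f ->
  measurable_fun setT (fun z : RT => f (atx z.1 z.2)).
Proof.
move=> mf _ B mB; rewrite setTI.
rewrite (_ : _ @^-1` _ =
  [set z : RT | exists h : sval z.1 (z.2 : euclid R k), B (f (at_point h))] `|`
  (~` @occupied R k `&` [set z | B (f (singleton_pspace R))])).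
  apply: measurableU; first exact: (measurable_at_point (mf B mB)).
  apply: measurableI; first by apply: measurableC; exact: measurable_occupied.
  have [Bf|Bf] := pselect (B (f (singleton_pspace R))).
    by rewrite (_ : [set _ | _] = setT)//; apply/seteqP; split.
  by rewrite (_ : [set _ | _] = set0)//; apply/seteqP; split.
apply/seteqP; split=> [[phi x]|[phi x]] /=; rewrite /occupied/=.
  have [h|h] := pselect (sval phi x).
    by rewrite (atxE h) => Bh; left; exists h.
  by rewrite /atx; case: pselect => // _ ?; right.
move=> [[h Bh]|[h Bh]]; first by rewrite (atxE h).
by rewrite /atx; case: pselect.
Qed.

Lemma measurable_at0 d d' (T : measurableType d) (S : measurableType d')
    (Phi : T -> lfset R k) (f : pspace R -> S) :
  measurable_fun setT Phi -> psm f -> measurable_fun setT (fun w => f (at0 (Phi w))).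
Proof.
move=> mPhi mf; rewrite (_ : (fun _ => _) =
  (fun z : RT => f (atx z.1 z.2)) \o (fun w => (Phi w, 0 : borel_euclid R k)))//.
apply: measurableT_comp; first exact: measurable_atx.
exact: measurable_fun_pair.
Qed.

End Sampling.

(** * Packing in Euclidean space *)

Section Packing.
Context (R : realType) (k : nat).
Implicit Types x y : 'rV[R]_k.

Definition enorm x : R := euclid_dist (x : euclid R k) 0.

Lemma euclid_dist_sub (x y : euclid R k) : euclid_dist x y = enorm (x - y).
Proof.
rewrite /enorm /euclid_dist; congr Num.sqrt; apply: eq_bigr => i _.
by rewrite !mxE subr0.
Qed.

Lemma enormZ (a : R) x : 0 <= a -> enorm (a *: x) = a * enorm x.
Proof.
move=> a0; rewrite /enorm /euclid_dist.
rewrite -[a in RHS]ger0_norm// -sqrtr_sqr -sqrtrM ?sqr_ge0// mulr_sumr.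
by congr Num.sqrt; apply: eq_bigr => i _; rewrite !mxE !subr0 exprMn.
Qed.

Lemma enormD x y : enorm (x + y) <= enorm x + enorm y.
Proof.
have := @euclid_dist_triangle R k 0 x (- y).
by rewrite !euclid_dist_sub !opprK subr0 add0r.
Qed.

Lemma enormN x : enorm (- x) = enorm x.
Proof. by have := @euclid_dist_sym R k 0 x; rewrite !euclid_dist_sub sub0r subr0. Qed.

Lemma coord_le_enorm x i : `|x ord0 i| <= enorm x.
Proof. by have := @coord_le_euclid_dist R k x 0 i; rewrite mxE subr0. Qed.

Lemma enorm_le_sum x : enorm x <= \sum_(i < k) `|x ord0 i|.
Proof.
rewrite (le_trans (euclid_dist_le_sum _ _))//; apply: ler_sum => i _.
by rewrite mxE subr0.
Qed.

(** Pigeonhole on a cubic grid: two points in the same cell would be closer than [sigma]. *)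
Lemma separated_family_card (W : finType) (X : W -> 'rV[R]_k) (rho sigma : R) :
  0 <= rho -> 0 < sigma -> sigma <= 1 -> (forall w, enorm (X w) <= rho) ->
  (forall w w', w != w' -> sigma <= enorm (X w - X w')) ->
  #|W|%:R <= ((2 * rho * k.+1%:R + 1) / sigma) ^+ k.
Proof.
move=> rho0 s0 s1 Xrho sep.
(* The inverse mesh of the grid. With [k.+1] instead of [k], the sum of the [k] coordinate gaps is
   strictly below [sigma], also when [k] is 0. *)
pose c : R := k.+1%:R / sigma.
have c0 : 0 < c by rewrite divr_gt0.
pose M := (Num.truncn (2 * rho * c)).+1.
have pos w i : 0 <= (X w ord0 i + rho) * c.
  apply: mulr_ge0; last exact: ltW.
  have := le_trans (coord_le_enorm (X w) i) (Xrho w).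
  by rewrite ler_norml => /andP[]; lra.
have lt w i : (Num.truncn ((X w ord0 i + rho) * c) < M)%N.
  rewrite ltnS le_truncn// ler_pM2r//.
  have := le_trans (coord_le_enorm (X w) i) (Xrho w).
  by rewrite ler_norml => /andP[]; lra.
pose f w : {ffun 'I_k -> 'I_M} := [ffun i => Ordinal (lt w i)].
have injf : injective f.
  move=> w w' ff; apply/eqP; apply: contraT => /sep; rewrite leNgt => /negP[].
  rewrite (le_lt_trans (enorm_le_sum _))//.
  apply: (@le_lt_trans _ _ (\sum_(i < k) sigma / k.+1%:R)); last first.
    by rewrite sumr_const card_ord -[X in X < _]mulr_natl mulrA ltr_pdivrMr// mulrC ltr_pM2l// ltr_nat.
  apply: ler_sum => i _; rewrite !mxE.
  have /(congr1 (fun h : {ffun 'I_k -> 'I_M} => val (h i))) := ff; rewrite !ffunE /= => E.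
  have /andP[a1 a2] := truncn_itv (pos w i).
  have /andP[b1 b2] := truncn_itv (pos w' i).
  rewrite E in a1 a2; rewrite -invf_div -/c.
  have {}c0' := c0; rewrite -(ler_pM2r c0) mulVf ?gt_eqF//.
  rewrite -[c in _ * c]gtr0_norm// -normrM mulrBl ler_norml.
  move: a1 a2 b1 b2; rewrite !mulrDl -!natr1; lra.
have := leq_card f injf; rewrite card_ffun !card_ord => cW.
apply: (@le_trans _ _ ((M ^ k)%N%:R)); first by rewrite ler_nat.
rewrite natrX lerXn2r// ?nnegrE//.
  by rewrite divr_ge0 ?(ltW s0)// addr_ge0// !mulr_ge0.
rewrite /M -[X in X <= _]natr1 [X in _ <= X]mulrDl mul1r; apply: lerD.
  have h : 0 <= 2 * rho * c by apply: mulr_ge0; [exact: mulr_ge0|exact: ltW].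
  by have /andP[+ _] := truncn_itv h; rewrite /c mulrA.
by rewrite invf_ge1.
Qed.

(** If m > q, Bernoulli's inequality makes (m / q)^j grow at least linearly in j, exceeding the
    constant [C]. *)
Lemma power_bound (q C m : R) : 0 < q -> 0 <= m -> (forall j, m ^+ j <= C * q ^+ j) -> m <= q.
Proof.
move=> q0 m0 H; rewrite leNgt; apply/negP => qm.
pose d := m / q - 1.
have d0 : 0 < d by rewrite subr_gt0 ltr_pdivlMr// mul1r.
have B j : 1 + j%:R * d <= C.
  apply: (@le_trans _ _ ((m / q) ^+ j)).
    rewrite (_ : m / q = 1 + d); last by rewrite /d addrC subrK.
    elim: j => [|j IH]; first by rewrite mul0r addr0 expr0.
    rewrite exprS (@le_trans _ _ ((1 + d) * (1 + j%:R * d)))//; last first.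
      by rewrite ler_wpM2l//; lra.
    have := mulr_ge0 (ler0n R j) (ltW d0); rewrite -natr1.
    have := sqr_ge0 d; nra.
  by rewrite expr_div_n ler_pdivrMr ?exprn_gt0.
have := B (Num.truncn (C / d)).+1.
have : C / d < (Num.truncn (C / d)).+1%:R by rewrite real_truncnS_gt// num_real.
rewrite ltr_pdivrMr//; lra.
Qed.

(* In place of volumes: words of length j over the m points, the i-th letter being
   scaled by t ^ i, give m ^ j points that are t ^ j apart, and a crude count of those
   suffices as j tends to infinity. *)
Lemma packing_bound m (s : 'I_m -> euclid R k) (u : euclid R k) (r : R) :
  0 < r -> (forall i, mdist u (s i) <= r) ->
  (forall i j, i != j -> 1 <= mdist (s i) (s j)) ->
  m%:R <= (2 * r + 1) ^+ k.
Proof.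
move=> r0 sr sep.
pose t : R := (2 * r + 1)^-1.
have t0 : 0 < t by rewrite invr_gt0; lra.
have tE : t * (2 * r + 1) = 1 by rewrite mulVf// gt_eqF//; lra.
have t1 : t <= 1 by rewrite invf_le1; lra.
pose v i : 'rV[R]_k := s i - u.
have vr i : enorm (v i) <= r by rewrite -euclid_dist_sub euclid_dist_sym; exact: sr.
have vsep i j : i != j -> 1 <= enorm (v i - v j).
  by move=> /sep; rewrite mdist_euclid euclid_dist_sub /v opprB addrA subrK.
(* This is the geometric sum of r t^i for i < j, because r / (1 - t) = r + 1/2. The choice of t
   gives 1 - 2 t [rho j] = t^j, the separation left between words with different first letters. *)
pose rho j : R := (r + 1 / 2) * (1 - t ^+ j).
have tj j : 0 < t ^+ j <= 1 by rewrite exprn_gt0//= exprn_ile1// ltW.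
have iter j : exists (W : finType) (X : W -> 'rV[R]_k),
    [/\ #|W| = (m ^ j)%N, forall w, enorm (X w) <= rho j &
        forall w w', w != w' -> t ^+ j <= enorm (X w - X w')].
  elim: j => [|j [W [X [cW Xr Xs]]]].
    exists unit, (fun=> 0); split.
    - by rewrite card_unit expn0.
    - by move=> _; rewrite /rho expr0 subrr mulr0 /enorm euclid_distxx.
    - by move=> [] [].
  exists ('I_m * W)%type, (fun z => v z.1 + t *: X z.2); split.
  - by rewrite card_prod card_ord cW expnS.
  - move=> z; rewrite (le_trans (enormD _ _))// (enormZ _ (ltW t0)).
    have h1 := vr z.1; have h2 : t * enorm (X z.2) <= t * rho j by rewrite ler_pM2l.
    have E : t * (r + 1 / 2) = 1 / 2 by lra.
    have E1 : t * rho j = 1 / 2 * (1 - t ^+ j) by rewrite /rho mulrA E.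
    have E2 : (r + 1 / 2) * (t * t ^+ j) = 1 / 2 * t ^+ j by rewrite mulrA [_ * t]mulrC E.
    have E3 : rho j.+1 = r + 1 / 2 - (r + 1 / 2) * (t * t ^+ j).
      by rewrite /rho exprS mulrBr mulr1.
    rewrite E1 in h2; rewrite E3 E2; lra.
  - move=> [a w] [b w'] /=; have [<- {b}|ab _] := eqVneq a b.
      rewrite xpair_eqE eqxx/= => /Xs ww'.
      rewrite opprD addrACA subrr add0r -scalerBr (enormZ _ (ltW t0)) exprS.
      by rewrite ler_pM2l.
    have h1 := vsep a b ab.
    have h2 : enorm (v a - v b) <=
        enorm (v a + t *: X w - (v b + t *: X w')) + t * (enorm (X w) + enorm (X w')).
      have -> : v a - v b = (v a + t *: X w - (v b + t *: X w')) + (t *: X w' - t *: X w).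
        apply/rowP => i; rewrite !mxE; ring.
      rewrite (le_trans (enormD _ _))// lerD2l -scalerBr (enormZ _ (ltW t0)) ler_pM2l//.
      by rewrite (le_trans (enormD _ _))// enormN addrC.
    have h3 : t * (enorm (X w) + enorm (X w')) <= t * (2 * rho j).
      by rewrite ler_pM2l// mulr_natl mulr2n lerD.
    have h4 : t * (2 * rho j) = 1 - t ^+ j.
      have -> : t * (2 * rho j) = t * (2 * r + 1) * (1 - t ^+ j) by rewrite /rho; field.
      by rewrite tE mul1r.
    have h5 : t ^+ j.+1 <= t ^+ j.
      by rewrite exprS ler_piMl//; case/andP: (tj j) => /ltW.
    lra.
apply: (@power_bound _ ((2 * (r + 1 / 2) * k.+1%:R + 1) ^+ k)) => //.
  by rewrite exprn_gt0//; lra.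
move=> j; have [W [X [cW Xr Xs]]] := iter j.
have /andP[tj0 tj1] := tj j.
rewrite -natrX -cW.
apply: (le_trans (separated_family_card (rho := r + 1 / 2) _ tj0 tj1 _ Xs)).
- lra.
- move=> w; rewrite (le_trans (Xr w))// /rho ler_piMr//; lra.
- by rewrite exprMn -exprVn /t invrK -exprM mulnC exprM.
Qed.

End Packing.

(** * Random greedy selection of disjoint balls *)

Section Arithmetic.
Context (R : realType).

Definition rule_add (r1 r2 : rule R) : rule R :=
  @ROp R (fun a b => a + b) (measurable_funD (@measurable_fst _ _ R R) (@measurable_snd _ _ R R)) r1 r2.

Definition rule_mul (r1 r2 : rule R) : rule R :=
  @ROp R (fun a b => a * b) (measurable_funM (@measurable_fst _ _ R R) (@measurable_snd _ _ R R)) r1 r2.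

Let measurable_eq :
  measurable_fun [set: R * R] (fun z : R * R => (z.1 == z.2)%:R : R).
Proof.
rewrite (_ : (fun _ => _) = \1_[set z : R * R | z.1 == z.2]).
  apply: measurable_indic; rewrite -[X in measurable X]setTI.
  by apply: (measurable_fun_eqr (@measurable_fst _ _ R R) (@measurable_snd _ _ R R)).
by apply/funext => z; rewrite indicE mem_setE.
Qed.

Let measurable_le :
  measurable_fun [set: R * R] (fun z : R * R => (z.1 <= z.2)%R%:R : R).
Proof.
rewrite (_ : (fun _ => _) = \1_[set z : R * R | z.1 <= z.2]).
  apply: measurable_indic; rewrite -[X in measurable X]setTI.
  by apply: (measurable_fun_ler (@measurable_fst _ _ R R) (@measurable_snd _ _ R R)).
by apply/funext => z; rewrite indicE mem_setE.
Qed.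

Definition rule_eq (r1 r2 : rule R) : rule R :=
  @ROp R (fun a b => (a == b)%:R) measurable_eq r1 r2.

Definition rule_le (r1 r2 : rule R) : rule R :=
  @ROp R (fun a b => (a <= b)%R%:R) measurable_le r1 r2.

Let measurable_inv :
  measurable_fun [set: R * R] (fun z : R * R => z.1 `^ (-1)).
Proof. exact: (measurableT_comp (measurable_powR (-1)) (@measurable_fst _ _ R R)). Qed.

(** The power with exponent -1 is measurable and agrees with the inverse on nonnegative reals. *)
Definition rule_inv (r : rule R) : rule R :=
  @ROp R (fun a _ => a `^ (-1)) measurable_inv r r.

End Arithmetic.

Section FiniteSums.
Context (R : realType) (D : discreteSpace R).
Implicit Types (F : D -> R) (x : D) (rho : R).

Definition nbsum rho x F : R := \sum_(y \in [set y | mdist x y <= rho]) F y.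

Lemma nbsumE rho x F :
  nbsum rho x F = \sum_(y <- fset_set [set y | mdist x y <= rho]) F y.
Proof. by rewrite /nbsum (fsbig_finite _ _ (ds_finite x rho)). Qed.

Lemma in_nb rho x y : (y \in fset_set [set y | mdist x y <= rho]) = (mdist x y <= rho).
Proof.
rewrite in_fset_set; last exact: ds_finite.
by apply/idP/idP => [/set_mem|xy]; last exact/mem_set.
Qed.

Lemma ler_nbsum rho x F G : (forall y, mdist x y <= rho -> F y <= G y) ->
  nbsum rho x F <= nbsum rho x G.
Proof.
move=> FG; rewrite !nbsumE big_seq [leRHS]big_seq; apply: ler_sum => y.
by rewrite in_nb => /FG.
Qed.

Lemma nbsum_ge0 rho x F : (forall y, mdist x y <= rho -> 0 <= F y) -> 0 <= nbsum rho x F.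
Proof.
move=> F0; rewrite nbsumE big_seq; apply: sumr_ge0 => y.
by rewrite in_nb => /F0.
Qed.

Lemma nbsum_eq0 rho x F : (forall y, mdist x y <= rho -> 0 <= F y) ->
  nbsum rho x F = 0 <-> forall y, mdist x y <= rho -> F y = 0.
Proof.
move=> F0; rewrite nbsumE big_seq; split=> [/eqP|H]; last first.
  by rewrite big1// => y; rewrite in_nb => /H.
rewrite psumr_eq0; last by move=> y; rewrite in_nb => /F0.
move=> /allP H y xy; have := H y; rewrite !in_nb xy => /(_ isT) /=.
by move/eqP.
Qed.

Lemma nbsumD1 rho x F y : mdist x y <= rho ->
  nbsum rho x F = F y + nbsum rho x (fun z => (z != y)%:R * F z).
Proof.
move=> xy; rewrite !nbsumE [LHS](bigD1_seq y) ?fset_uniq ?in_nb//=; congr (_ + _).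
by rewrite big_mkcond; apply: eq_bigr => z _; case: (z != y); rewrite ?mul1r ?mul0r.
Qed.

Lemma ler_nbsum1 rho x F y : (forall y, mdist x y <= rho -> 0 <= F y) ->
  mdist x y <= rho -> F y <= nbsum rho x F.
Proof.
move=> F0 xy; rewrite (nbsumD1 _ xy) lerDl; apply: nbsum_ge0 => z xz.
by rewrite mulr_ge0// F0.
Qed.

Lemma nbsum_le_radius rho rho' x F : (forall y, 0 <= F y) -> rho <= rho' ->
  nbsum rho x F <= nbsum rho' x F.
Proof.
move=> F0 rr; rewrite !nbsumE.
rewrite (perm_big [seq y <- fset_set [set y | mdist x y <= rho'] | mdist x y <= rho]) /=.
  rewrite big_filter big_mkcond; apply: ler_sum => y _.
  by case: ifP.
apply: uniq_perm; rewrite ?filter_uniq ?fset_uniq// => y.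
rewrite mem_filter !in_nb; case: (boolP (mdist x y <= rho)) => //= h.
by rewrite (le_trans h).
Qed.

Lemma nbsum_isolated rho x (B : D -> bool) : 0 <= rho -> B x ->
  nbsum rho x (fun y => (B y)%:R) = 1 <->
  forall y, mdist x y <= rho -> B y -> y = x.
Proof.
move=> rho0 Bx; have xx : mdist x x <= rho by rewrite mdistxx.
rewrite (nbsumD1 _ xx) Bx; split=> [/eqP|H].
  rewrite -subr_eq0 addrAC subrr add0r => /eqP.
  move/nbsum_eq0 => H y xy By; apply/eqP; apply: contraT => yx.
  have /eqP := H (fun y _ => mulr_ge0 (ler0n _ _) (ler0n _ _)) y xy.
  by rewrite yx By mulr1 oner_eq0.
have -> : nbsum rho x (fun z => (z != x)%:R * (B z)%:R) = 0; last by rewrite addr0.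
apply/nbsum_eq0 => [y _|y xy]; first by rewrite mulr_ge0.
case: eqVneq => [|yx]; first by rewrite mul0r.
by case By: (B y); rewrite ?mulr0//; move: yx; rewrite (H y xy By) eqxx.
Qed.

End FiniteSums.

Section Selection.
Context (R : realType) (cand : R -> rule R).

(* One round of Luby's algorithm at radius [rho]: a candidate joins if its bit is the
   only one in its neighbourhood and its ball misses the balls chosen before.  The
   state of a point is the radius of its chosen ball, 0 if there is none; the head
   of the list is the last round. *)
Definition conflicts (rho : R) (l : seq R) (s : rule R) : rule R :=
  foldr (fun c r => rule_add (RSum (rho + c) (rule_eq s (RConst c))) r) (RConst 0) l.

Definition joins (rho : R) (l : seq R) (s : rule R) : rule R :=
  rule_mul (rule_eq (cand rho) (RConst 1))
    (rule_mul (RBit R (size l))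
      (rule_mul (rule_eq (RSum (2 * rho) (RBit R (size l))) (RConst 1))
                (rule_eq (conflicts rho l s) (RConst 0)))).

Fixpoint select (l : seq R) : rule R :=
  if l is rho :: l' then
    let s := select l' in
    rule_add s (rule_mul (rule_eq s (RConst 0)) (rule_mul (RConst rho) (joins rho l' s)))
  else RConst 0.

Arguments select : simpl never.

(** The indicator that a point lies in none of the selected balls enlarged by [kappa], obtained by
    comparing a sum of counts with 0. *)
Definition uncovered (kappa : R) (l : seq R) : rule R :=
  rule_eq (foldr (fun c r =>
    rule_add (RSum (kappa * c) (rule_eq (select l) (RConst c))) r) (RConst 0) l)
   (RConst 0).

Variables (D : discreteSpace R) (b : nat -> D -> bool).

Local Notation ev := (eval (@mdist R D) b).

Lemma natr_eq0b (B : bool) : (B%:R == 0 :> R) = ~~ B.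
Proof. by rewrite pnatr_eq0; case: B. Qed.

Lemma eval_nbsums (f : R -> R) (l : seq R) (s : rule R) x :
  ev (foldr (fun c r => rule_add (RSum (f c) (rule_eq s (RConst c))) r) (RConst 0) l) x = 0
  <-> forall c, c \in l -> forall u, mdist x u <= f c -> ev s u <> c.
Proof.
elim: l => [|c l IH] //=.
have h0 (a : R) : 0 <= nbsum (f a) x (fun y => (ev s y == a)%:R).
  by apply: nbsum_ge0 => y _.
have h1 : 0 <= ev (foldr (fun c r => rule_add (RSum (f c) (rule_eq s (RConst c))) r) (RConst 0) l) x.
  elim: l {IH} => //= a l IH; apply: addr_ge0 => //; exact: h0.
split=> [/eqP|H].
  rewrite paddr_eq0//; last exact: (h0 c).
  move=> /andP[/eqP h /eqP h'] a; rewrite inE => /orP[/eqP ->|al] u xu; last first.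
    by move: xu; apply: (iffLR IH).
  move=> /eqP; have /nbsum_eq0 := h => /(_ (fun _ _ => ler0n _ _)) /(_ u xu) /eqP.
  by rewrite natr_eq0b => /negP.
rewrite (iffRL IH) ?addr0; last by move=> a al; apply: H; rewrite inE al orbT.
rewrite -/(nbsum (f c) x (fun y => (ev s y == c)%:R)).
apply/nbsum_eq0 => // u xu; have := H c (mem_head _ _) u xu.
by case: eqP.
Qed.

Lemma eval_joins rho l s x : 0 < rho ->
  ev (joins rho l s) x = [&& ev (cand rho) x == 1, b (size l) x,
    `[< forall y, mdist x y <= 2 * rho -> b (size l) y -> y = x >] &
    `[< forall c, c \in l -> forall u, mdist x u <= rho + c -> ev s u <> c >] ]%:R.
Proof.
move=> rho0 /=.
have -> : (ev (conflicts rho l s) x == 0) =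
    `[< forall c, c \in l -> forall u, mdist x u <= rho + c -> ev s u <> c >].
  have [i1 i2] := eval_nbsums (fun c => rho + c) l s x.
  by apply/eqP/asboolP => [/i1|/i2].
rewrite -/(nbsum (2 * rho) x (fun y => (b (size l) y)%:R)).
case bx: (b (size l) x); last by rewrite mul0r mulr0 /= andbF.
have -> : (nbsum (2 * rho) x (fun y => (b (size l) y)%:R) == 1) =
    `[< forall y, mdist x y <= 2 * rho -> b (size l) y -> y = x >].
  have h0 : 0 <= 2 * rho by rewrite mulr_ge0// ltW.
  have [i1 i2] := nbsum_isolated h0 bx.
  by apply/eqP/asboolP => [/i1|/i2].
by rewrite mul1r -!natrM !mulnb.
Qed.

Lemma select_cons rho l x : 0 < rho ->
  ev (select (rho :: l)) x =
    if ev (select l) x == 0 then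
      if ev (joins rho l (select l)) x == 0 then 0 else rho
    else ev (select l) x.
Proof.
move=> rho0; set s := select l; set j := joins _ _ _.
have -> : ev (select (rho :: l)) x =
  ev s x + (ev s x == 0)%:R * (rho * ev j x) by [].
case: eqP => [->|_]; last by rewrite mul0r addr0.
rewrite add0r mul1r eval_joins//.
by case: [&& _, _, _ & _]; rewrite ?mulr0 ?mulr1 ?eqxx// oner_eq0.
Qed.

Lemma joinsP rho l x : 0 < rho -> ev (joins rho l (select l)) x != 0 ->
  [/\ ev (cand rho) x = 1, b (size l) x,
     forall y, mdist x y <= 2 * rho -> b (size l) y -> y = x &
     forall c, c \in l -> forall u, mdist x u <= rho + c -> ev (select l) u <> c].
Proof.
move=> rho0; rewrite eval_joins// natr_eq0b negbK.
by move=> /and4P[/eqP ? ? /asboolP ? /asboolP ?].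
Qed.

Lemma selectP l x : all (> 0) l -> ev (select l) x != 0 ->
  ev (select l) x \in l /\ ev (cand (ev (select l) x)) x = 1.
Proof.
elim: l => [|rho l IH]; first by rewrite /select/= eqxx.
move=> /andP[rho0 l0]; rewrite select_cons//.
have [s0|s0 _] := eqVneq (ev (select l) x) 0; last first.
  by have [h1 h2] := IH l0 s0; rewrite inE h1 orbT.
case: (eqVneq (ev (joins rho l (select l)) x) 0) => [_|j0 _]; first by rewrite eqxx.
by have [] := joinsP rho0 j0; rewrite mem_head.
Qed.

Lemma select_ge0 l x : all (> 0) l -> 0 <= ev (select l) x.
Proof.
move=> l0; have [->//|s0] := eqVneq (ev (select l) x) 0.
by have [/(allP l0)/ltW] := selectP l0 s0.
Qed.

(** Two centres chosen in the same round are kept apart because a bit is isolated up to distance 2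
    [rho]; centres from different rounds, by the check of [conflicts] in the later one. *)
Lemma select_separated l u v : all (> 0) l ->
  ev (select l) u != 0 -> ev (select l) v != 0 -> u <> v ->
  ev (select l) u + ev (select l) v < mdist u v.
Proof.
elim: l u v => [|rho l IH] u v; first by move=> _ /eqP.
move=> /andP[rho0 l0]; rewrite !select_cons//.
have far x y : ev (select l) x != 0 -> ev (joins rho l (select l)) y != 0 ->
    rho + ev (select l) x < mdist y x.
  move=> sx /(joinsP rho0)[_ _ _ H]; rewrite ltNge; apply/negP => yx.
  exact: (H _ (selectP l0 sx).1 _ yx).
have [su|su] := eqVneq (ev (select l) u) 0; have [sv|sv] := eqVneq (ev (select l) v) 0.
- case: (eqVneq (ev (joins rho l (select l)) u) 0) => [_|ju _]; first by rewrite eqxx.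
  case: (eqVneq (ev (joins rho l (select l)) v) 0) => [_|jv _ uv]; first by rewrite eqxx.
  have [_ _ Hu _] := joinsP rho0 ju; have [_ bv _ _] := joinsP rho0 jv.
  rewrite ltNge; apply/negP => h; apply: uv; apply: esym; apply: Hu => //.
  by rewrite mulr_natl mulr2n.
- case: (eqVneq (ev (joins rho l (select l)) u) 0) => [_|ju _ _ _]; first by rewrite eqxx.
  exact: far.
- move=> _; case: (eqVneq (ev (joins rho l (select l)) v) 0) => [_|jv _ _]; first by rewrite eqxx.
  by rewrite addrC metric_sym; exact: far.
- exact: IH.
Qed.

Lemma select_cat l' l x : all (> 0) (l' ++ l) -> ev (select l) x != 0 ->
  ev (select (l' ++ l)) x = ev (select l) x.
Proof.
elim: l' => // rho l' IH /andP[rho0 l0] s0.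
by rewrite -[LHS]/(ev (select (rho :: l' ++ l)) x) select_cons// IH// (negbTE s0).
Qed.

(** A candidate with an isolated bit fails to join only if it already has a ball or its ball meets
    an earlier one. Rounds in [l'] come later and never change a nonzero state, by [select_cat]. *)
Lemma select_complete l' rho l x : all (> 0) (l' ++ rho :: l) ->
  ev (cand rho) x = 1 -> b (size l) x ->
  (forall y, mdist x y <= 2 * rho -> b (size l) y -> y = x) ->
  exists u, [/\ ev (select (l' ++ rho :: l)) u \in rho :: l,
    ev (select (l' ++ rho :: l)) u != 0 &
    mdist x u <= rho + ev (select (l' ++ rho :: l)) u].
Proof.
move=> l0 cx bx iso.
have /andP[_ /= /andP[rho0 l0']] : all (> 0) l' && all (> 0) (rho :: l).
  by rewrite -all_cat.
have l0'' : all (> 0) (rho :: l) by rewrite /= rho0.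
suff [u [u0 xu]] : exists u, ev (select (rho :: l)) u != 0 /\
    mdist x u <= rho + ev (select (rho :: l)) u.
  exists u; rewrite select_cat//; split => //.
  exact: (selectP l0'' u0).1.
have [s0|s0] := eqVneq (ev (select (rho :: l)) x) 0; last first.
  exists x; split=> //; rewrite mdistxx; apply: addr_ge0 (ltW rho0) _.
  exact: select_ge0.
have [u [u0 xu]] : exists u, ev (select l) u != 0 /\ mdist x u <= rho + ev (select l) u.
  move: s0; rewrite select_cons//; case: eqVneq => [sl|/eqP //].
  case: (eqVneq (ev (joins rho l (select l)) x) 0) => [j0 _|_ rho00]; last by rewrite rho00 ltxx in rho0.
  move/eqP: j0; rewrite eval_joins// natr_eq0b cx eqxx bx/=.
  have -> /= : `[< forall y, mdist x y <= 2 * rho -> b (size l) y -> y = x >].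
    exact/asboolP.
  move=> /asboolPn /existsNP[c] /not_implyP[cl] /existsNP[u] /not_implyP[xu /contrapT E].
  by exists u; rewrite E; split=> //; rewrite gt_eqF//; exact: (allP l0').
have E := select_cat (l' := [:: rho]) l0'' u0.
by exists u; rewrite -cat1s E.
Qed.

Lemma eval_uncovered kappa l x :
  ev (uncovered kappa l) x = `[< forall c, c \in l -> forall u,
     mdist x u <= kappa * c -> ev (select l) u <> c >]%:R.
Proof.
rewrite [LHS]/=; congr (nat_of_bool _)%:R.
have [i1 i2] := eval_nbsums (fun c => kappa * c) l (select l) x.
by apply/eqP/asboolP => [/i1|/i2].
Qed.

End Selection.

Section Isolation.
Context (R : realType).

Lemma natr_forall (I : finType) (c : I -> bool) :
  [forall i, c i]%:R = \prod_i (c i)%:R :> R.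
Proof.
case: forallP => [H|/existsNP[i /negP ci]]; first by rewrite big1// => i _; rewrite H.
by rewrite (bigD1 i)//= (negbTE ci) mul0r.
Qed.

(** The bits form [J] independent rows, each equal to the word [e] with probability 2^-m; the sum
    over arrays factorizes over rows. *)
Lemma coin_no_word (J m : nat) (idx : 'I_J * 'I_m -> nat) (e : {ffun 'I_m -> bool}) :
  injective idx ->
  coin (R := R) [set w | forall t, exists i, bit (idx (t, i)) w != e i] =
  ((1 - 2 ^- m) ^+ J)%:E.
Proof.
move=> inj.
pose row (b : {ffun 'I_J * 'I_m -> bool}) : {ffun 'I_J -> {ffun 'I_m -> bool}} :=
  [ffun t => [ffun i => b (t, i)]].
pose flat (f : {ffun 'I_J -> {ffun 'I_m -> bool}}) : {ffun 'I_J * 'I_m -> bool} :=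
  [ffun z => f z.1 z.2].
pose Q (b : {ffun 'I_J * 'I_m -> bool}) := [forall t, row b t != e].
rewrite (_ : [set _ | _] = [set w | Q [ffun k => bit (idx k) w]]); last first.
  apply/seteqP; split=> w /=.
    move=> H; apply/forallP => t; have [i] := H t; apply: contra => /eqP <-.
    by rewrite !ffunE.
  move=> /forallP H t; apply: contrapT => nH.
  have {nH} nH i : bit (idx (t, i)) w = e i.
    by apply/eqP; apply: contrapT => /negP h; apply: nH; exists i.
  by have := H t; apply/negP; rewrite negbK; apply/eqP/ffunP => i; rewrite !ffunE nH.
rewrite coin_event//; congr EFin.
rewrite card_prod !card_ord.
transitivity (\sum_(f : {ffun 'I_J -> {ffun 'I_m -> bool}})
    \prod_(t < J) ((f t != e)%:R * 2 ^- m) : R).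
  rewrite (reindex flat)/=; last first.
    exists row => [f _|b _].
      by apply/ffunP => t; apply/ffunP => i; rewrite !ffunE.
    by apply/ffunP => -[t i]; rewrite !ffunE.
  apply: eq_bigr => f _; rewrite /Q natr_forall big_split/=; congr (_ * _).
    apply: eq_bigr => t _; congr (nat_of_bool (_ != _))%:R.
    by apply/ffunP => i; rewrite !ffunE.
  by rewrite prodr_const card_ord exprVn -exprM mulnC.
rewrite -(bigA_distr_bigA (fun (_ : 'I_J) (g : {ffun 'I_m -> bool}) => (g != e)%:R * 2 ^- m)).
rewrite prodr_const card_ord; congr (_ ^+ _).
rewrite -mulr_suml; have -> : \sum_(g : {ffun 'I_m -> bool}) (g != e)%:R = 2 ^+ m - 1 :> R.
  apply/eqP; rewrite -subr_eq opprK; apply/eqP.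
  have <- : \sum_(g : {ffun 'I_m -> bool}) 1 = 2 ^+ m :> R.
    by rewrite sumr_const card_ffun card_bool card_ord natrX.
  rewrite [RHS](bigD1 e)//= [in LHS](bigD1 e)//= eqxx add0r addrC; congr (_ + _).
  by apply: eq_bigr => g ->.
by rewrite mulrBl mulfV ?mul1r// expf_neq0.
Qed.

(** Isolation of the bit of [v] means that the bits in its ball spell the word that is true at [v]
    only. The rate [q] depends on the size of this ball but not on the rounds considered. *)
Lemma coin_no_isolation (D : discreteSpace R) (v : D) rho : 0 <= rho ->
  exists2 q : R, 0 <= q < 1 & forall t0 J, exists A,
  [/\ measurable A, coin (R := R) A = (q ^+ J)%:E &
    [set w | forall t, (t < J)%N -> ~ (@coins R D w (t0 + t) v /\
     forall y, mdist v y <= rho -> @coins R D w (t0 + t) y -> y = v)] `<=` A].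
Proof.
move=> rho0; have [m [y [injy yE]]] := finite_enumeration (ds_finite v rho).
have [i0 vE] : exists i, v = y i by apply/yE => /=; rewrite mdistxx.
exists (1 - 2 ^- m).
  have h : 0 < ((2 : R) ^+ m)^-1 <= 1.
    by rewrite invr_gt0 exprn_gt0//= invf_le1 ?exprn_gt0// exprn_ege1// ler1n.
  by case/andP: h => h1 h2; rewrite subr_ge0 h2 ltrBlDr ltrDl.
move=> t0 J.
pose idx (z : 'I_J * 'I_m) := choice.pickle (label (y z.2), (t0 + val z.1)%N).
have inj : injective idx.
  move=> [t i] [t' i'] /= /(pcan_inj choice.pickleK) [/label_inj /injy -> /addnI tt'].
  by congr pair; exact: val_inj.
exists [set w | forall t : 'I_J, exists i, bit (idx (t, i)) w != [ffun i => i == i0] i].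
split; last 2 first.
- exact: coin_no_word.
- move=> w /= H t; apply: contrapT => nH; apply: (H t (ltn_ord t)).
  have {}nH i : bit (idx (t, i)) w = (i == i0).
    by apply/eqP; apply: contrapT => /negP h; apply: nH; exists i; rewrite ffunE.
  split; first by rewrite vE /coins -[bit _ _]/(bit (idx (t, i0)) w) nH eqxx.
  move=> u /yE[i ->]; rewrite /coins -[bit _ _]/(bit (idx (t, i)) w) nH => /eqP ->.
  by rewrite vE.
rewrite (_ : [set _ | _] = \bigcap_t \bigcup_i
    (bit (idx (t, i)) @^-1` [set ~~ [ffun i => i == i0] i])).
  apply: fin_bigcap_measurable => [|t _]; first exact: finite_finset.
  apply: fin_bigcup_measurable => [|i _]; first exact: finite_finset.
  by rewrite -[X in measurable X]setTI; exact: measurable_bit.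
apply/seteqP; split=> w /= H t => [_|].
  have [i Hi] := H t; exists i => //=; move: Hi.
  by case: (bit _ w); case: (_ i).
have [i _ /= Hi] := H t I; exists i; rewrite Hi; by case: (_ i).
Qed.

End Isolation.

Section Uncovered.
Context (R : realType).

Lemma measurable_eval_eq (D : discreteSpace R) (r : rule R) (x : D) (c : R) :
  measurable [set w | eval (@mdist R D) (@coins R D w) r x = c].
Proof.
rewrite (_ : [set _ | _] = [set w | eval (@mdist R D) (@coins R D w) r x == c]).
  rewrite -[X in measurable X]setTI.
  by apply: (measurable_fun_eqr (measurable_eval_coins r x) (measurable_cst _)).
by apply/seteqP; split=> w /= /eqP.
Qed.

(** Vitali's argument. If [v] has an isolated bit in one of the [J] rounds at radius [rho], its ball
    meets a chosen ball of radius c >= [rho], centred at some u; then u is within (kappa - 2) rho +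
    rho + c <= kappa c of [x]. *)
Lemma coin_uncovered (D : discreteSpace R) (x v : D) (rho kappa : R) :
  0 < rho -> 1 <= kappa -> mdist x v <= (kappa - 2) * rho ->
  exists2 q : R, 0 <= q < 1 & forall (cand : R -> rule R) l1 l2 J,
    all (> 0) (l1 ++ nseq J rho ++ l2) -> {in l2, forall c, rho <= c} ->
    (forall b, eval (@mdist R D) b (cand rho) v = 1) ->
    (coin (R := R) [set w | eval (@mdist R D) (@coins R D w)
      (uncovered cand kappa (l1 ++ nseq J rho ++ l2)) x = 1%R] <= (q ^+ J)%:E)%E.
Proof.
move=> rho0 k1 xv.
have [q q01 Hq] := @coin_no_isolation R D v (2 * rho) (mulr_ge0 (ler0n _ _) (ltW rho0)).
exists q => // cand l1 l2 J l0 l2rho cv.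
have [A [mA <- sA]] := Hq (size l2) J.
apply: le_measure.
- by apply/mem_set; exact: measurable_eval_eq.
- exact/mem_set.
- move=> w H; have unc : eval (@mdist R D) (@coins R D w) (uncovered cand kappa _) x = 1 := H.
  move: unc; rewrite eval_uncovered => unc; apply: sA => /= => t tJ [bv iso].
  (* The head of the list is the last round, so the round using bit [size l2 + t] is preceded by
     [l2] and by [t] rounds at [rho]. *)
  have lE : l1 ++ nseq J rho ++ l2 = (l1 ++ nseq (J - t.+1) rho) ++ rho :: (nseq t rho ++ l2).
    rewrite -catA; congr (_ ++ _); rewrite -cat_cons catA; congr (_ ++ _).
    by rewrite -[rho :: nseq t rho]/(nseq t.+1 rho) -nseqD subnK.
  have sz : size (nseq t rho ++ l2) = (size l2 + t)%N.
    by rewrite size_cat size_nseq addnC.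
  have [u [ul u0 vu]] := @select_complete R cand D (@coins R D w)
    (l1 ++ nseq (J - t.+1) rho) rho (nseq t rho ++ l2) v
    (eq_ind _ (fun l => all (> 0) l) l0 _ lE) (cv _)
    (eq_ind _ (fun n => coins w n v) bv _ (esym sz))
    (eq_ind _ (fun n => forall y, mdist v y <= 2 * rho -> coins w n y -> y = v) iso _ (esym sz)).
  move: unc; rewrite lE; set s := select _ _ in ul u0 vu *; case: asboolP => [unc _|_ /eqP]; last by rewrite eq_sym oner_eq0.
  move: ul u0 vu; set c := eval _ _ _ u => ul u0 vu.
  apply: (unc c _ u _ erefl); first by rewrite mem_cat ul orbT.
  have rc : rho <= c.
    by move: ul; rewrite inE mem_cat => /or3P[/eqP->//|/nseqP[->]//|/l2rho].
  rewrite (le_trans (metric_triangle _ v _))//.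
  rewrite (le_trans (lerD xv vu))//.
  have k1' : 0 <= kappa - 1 by rewrite subr_ge0.
  have := ler_wpM2l k1' rc.
  lra.
Qed.

End Uncovered.

(** * The covering given by the selected balls *)

Section Chances.
Context (R : realType).

Lemma psm_eval (r : rule R) :
  psm (fun p => eval (@mdist R p) (fun _ _ => false) r (ps_root p) : measurableTypeR R).
Proof.
apply: (@psm_local _ _ _ (radius r + 1)
  (fun p => eval (@mdist R p) (fun _ _ => false) r (ps_root p) : measurableTypeR R)
  (fun n d => eval (fun i j => d (i, j)) (fun _ _ => false) r ord0)).
- by rewrite ltr_wpDl ?radius_ge0.
- by move=> n; exact: measurable_eval_matrix.
- move=> p n y [[y0 yi yL] yE]; rewrite -y0; apply/esym.
  apply: eval_embed => //; first exact: metric_triangle.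
  by move=> u; rewrite y0 => ur; apply: yE; rewrite (le_lt_trans ur)// ltrDl.
Qed.

Definition chance (r : rule R) (c : R) (p : pspace R) : \bar R :=
  coin (R := R) [set w | eval (@mdist R p) (@coins R p w) r (ps_root p) = c].

Lemma chance_ge0 r c p : (0 <= chance r c p)%E.
Proof. exact: measure_ge0. Qed.

Lemma chance_le1 r c p : (chance r c p <= 1)%E.
Proof. by apply: probability_le1; exact: measurable_eval_eq. Qed.

Lemma psm_chance r c : psm (chance r c).
Proof.
pose G n (d : rfamily R ('I_n.+1 * 'I_n.+1)) : \bar R :=
  (\sum_(b : {ffun 'I_(depth r) * 'I_n.+1 -> bool})
    \1_[set d : rfamily R ('I_n.+1 * 'I_n.+1) |
        eval (fun i j => d (i, j)) (bits_of b) r ord0 == c] d *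
     2 ^- (depth r * n.+1))%:E.
apply: (@psm_local _ _ _ (radius r + 1) (chance r c) G).
- by rewrite ltr_wpDl ?radius_ge0.
- move=> n; apply/measurable_EFinP; apply: measurable_sum => b.
  apply: measurable_funM => //; apply: measurable_indic.
  rewrite -[X in measurable X]setTI.
  exact: (measurable_fun_eqr (measurable_eval_matrix _ _ _) (measurable_cst _)).
- move=> p n y [[y0 yi yL] yE].
  pose Q (b : {ffun 'I_(depth r) * 'I_n.+1 -> bool}) :=
    eval (fun i j => dmat y (i, j)) (bits_of b) r ord0 == c.
  transitivity (coin (R := R) [set w |
     Q [ffun z : 'I_(depth r) * 'I_n.+1 => @coins R p w z.1 (y z.2)]]).
    rewrite /chance; congr coin; apply/seteqP.
    have E w : eval (@mdist R p) (@coins R p w) r (ps_root p) =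
        eval (fun i j => dmat y (i, j))
          (bits_of [ffun z : 'I_(depth r) * 'I_n.+1 => @coins R p w z.1 (y z.2)]) r ord0.
      rewrite -y0; apply: eval_enumeration => //.
      by move=> u; rewrite y0 => ur; apply: yE; rewrite (le_lt_trans ur)// ltrDl.
    by split=> w /=; rewrite E /Q => /eqP.
  rewrite coins_event// /G; congr EFin; apply: eq_bigr => b _.
  rewrite indicE /Q; congr (_ * _); congr (nat_of_bool _)%:R.
  by apply/idP/idP => [h|/set_mem//]; exact/mem_set.
Qed.

Definition single (r : rule R) : factor R :=
  @Factor R (fun=> r) (fun g => g 0%N) (measurable_coordinate 0%N).

Lemma single_mark (r : rule R) (D : discreteSpace R) w (x : D) :
  nnval (mark (single r) D w x) = Num.max (eval (@mdist R D) (@coins R D w) r x) 0.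
Proof. by []. Qed.

End Chances.

Arguments chance {R} r c p.

Section Covering.
Context (R : realType) (cand : R -> rule R) (kappa : R) (l : seq R).
Hypotheses (l0 : all (> 0) l) (l1 : all (fun c => 1 <= kappa * c) l) (k1 : 1 <= kappa).

(** Points that remain uncovered get a ball of radius 1 around themselves, so that the covering
    property holds for every outcome and not just with high probability. *)
Definition cover_rule : rule R :=
  let s := select cand l in
  rule_add (rule_mul (RConst kappa) s)
    (rule_mul (rule_eq s (RConst 0)) (uncovered cand kappa l)).

Let k0 : 0 < kappa. Proof. exact: lt_le_trans k1. Qed.

Lemma cover_ruleE (D : discreteSpace R) b (x : D) :
  let s := eval (@mdist R D) b (select cand l) x in
  eval (@mdist R D) b cover_rule x =
  if s != 0 then kappa * s
  else (eval (@mdist R D) b (uncovered cand kappa l) x == 1)%:R.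
Proof.
move=> s; have -> : eval (@mdist R D) b cover_rule x =
  kappa * s + (s == 0)%:R * eval (@mdist R D) b (uncovered cand kappa l) x by [].
rewrite eval_uncovered.
case: eqVneq => [->|s0] /=; last by rewrite mul0r addr0.
by rewrite mulr0 add0r mul1r; case: asboolP; rewrite ?eqxx// [0 == 1]eq_sym oner_eq0.
Qed.

Lemma cover_radius (D : discreteSpace R) b (x : D) :
  eval (@mdist R D) b cover_rule x = 0 \/ 1 <= eval (@mdist R D) b cover_rule x.
Proof.
rewrite cover_ruleE; case: eqVneq => [_|s0] /=.
  by case: (_ == _); [right|left].
by right; exact: (allP l1 _ (selectP l0 s0).1).
Qed.

Lemma cover_ge0 (D : discreteSpace R) b (x : D) : 0 <= eval (@mdist R D) b cover_rule x.
Proof. by have [->|/(le_trans ler01)] := cover_radius b x. Qed.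

Lemma cover_covers (D : discreteSpace R) b (y : D) : exists v,
  eval (@mdist R D) b cover_rule v != 0 /\ mdist v y <= eval (@mdist R D) b cover_rule v.
Proof.
have [E|E] := eqVneq (eval (@mdist R D) b cover_rule y) 0; last first.
  by exists y; rewrite mdistxx cover_ge0.
move: E; rewrite cover_ruleE.
case: eqVneq => [_|s0 /=]; last first.
  move/eqP; rewrite mulf_eq0 (gt_eqF k0)/= => /eqP s0'.
  by rewrite s0' eqxx in s0.
rewrite eval_uncovered; case: asboolP => [_|+ _].
  by rewrite /= eqxx => /eqP; rewrite oner_eq0.
move=> /existsNP[c] /not_implyP[cl] /existsNP[u] /not_implyP[yu /contrapT uc].
have c0 : 0 < c := allP l0 _ cl.
exists u; rewrite cover_ruleE uc (gt_eqF c0)/= mulf_neq0 ?gt_eqF//.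
by rewrite metric_sym.
Qed.

Lemma pow0_cover (D : discreteSpace R) b (x : D) (a : R) :
  (pow0 (eval (@mdist R D) b cover_rule x) a =
  \sum_(c <- undup l) (kappa * c) `^ a * (eval (@mdist R D) b (select cand l) x == c)%:R
  + (eval (@mdist R D) b (rule_mul (rule_eq (select cand l) (RConst 0)) (uncovered cand kappa l)) x == 1)%:R)%R.
Proof.
rewrite cover_ruleE.
have -> : eval (@mdist R D) b (rule_mul (rule_eq (select cand l) (RConst 0)) (uncovered cand kappa l)) x
  = (eval (@mdist R D) b (select cand l) x == 0)%:R * eval (@mdist R D) b (uncovered cand kappa l) x by [].
case: eqVneq => [->|s0]; last first.
  rewrite mul0r [0 == 1]eq_sym oner_eq0 addr0.
  have [sl _] := selectP l0 s0; set s := eval _ _ _ _ in s0 sl *.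
  rewrite (bigD1_seq s) ?mem_undup ?undup_uniq//= eqxx mulr1 big1 ?addr0.
    by rewrite /pow0 gt_eqF// mulr_gt0//; exact: (allP l0).
  by move=> c cs; rewrite eq_sym (negbTE cs) mulr0.
rewrite big_seq big1 ?add0r.
  by rewrite mul1r eval_uncovered /pow0; case: asboolP => _ /=; rewrite ?eqxx ?oner_eq0 ?powR1// [0 == 1]eq_sym oner_eq0/= eqxx.
move=> c; rewrite mem_undup => /(allP l0) c0.
by rewrite lt_eqF// mulr0.
Qed.

Lemma measurable_pow0 (a : R) : measurable_fun setT (fun x : R => pow0 x a).
Proof.
rewrite (_ : (fun _ => _) = (fun x : R => (1 - \1_[set 0 : R] x) * x `^ a)).
  apply: measurable_funM; last exact: measurable_powR.
  by apply: measurable_funB => //; apply: measurable_indic; exact: measurable_set1.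
apply/funext => x; rewrite /pow0 indicE.
case: eqVneq => [->|x0]; first by rewrite mem_set// subrr mul0r.
by rewrite memNset ?subr0 ?mul1r//=; exact/eqP.
Qed.

(** The conditional mean cost given the space. A radius occurs in [l] once per round, hence [undup];
    uncovered points cost 1. *)
Definition cover_cost (a : R) (p : pspace R) : \bar R :=
  (\sum_(c <- undup l) ((kappa * c) `^ a)%:E * chance (select cand l) c p
  + chance (rule_mul (rule_eq (select cand l) (RConst 0)) (uncovered cand kappa l)) 1%R p)%E.

Lemma integral_chances (r1 r2 : rule R) (s : seq R) (f : R -> R) (p : pspace R) :
  (forall c, 0 <= f c) ->
  (\int[coin (R := R)]_w
    (\sum_(c <- s) f c * (eval (@mdist R p) (@coins R p w) r1 (ps_root p) == c)%:R
     + (eval (@mdist R p) (@coins R p w) r2 (ps_root p) == 1)%:R)%R%:E =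
   \sum_(c <- s) (f c)%:E * chance r1 c p + chance r2 1%R p)%E.
Proof.
move=> f0.
have mE r c : measurable_fun setT (fun w : measurableTypeR R =>
    (eval (@mdist R p) (@coins R p w) r (ps_root p) == c)%:R%:E : \bar R).
  apply/measurable_EFinP.
  rewrite (_ : (fun _ => _) = \1_[set w | eval (@mdist R p) (@coins R p w) r (ps_root p) = c]).
    by apply: measurable_indic; exact: (@measurable_eval_eq R p r (ps_root p) c).
  apply/funext => w; rewrite indicE; congr (nat_of_bool _)%:R.
  by apply/eqP/idP => [?|/set_mem//]; exact/mem_set.
have iE r c : (\int[coin (R := R)]_w
    (eval (@mdist R p) (@coins R p w) r (ps_root p) == c)%:R%:E = chance r c p)%E.
  have mE' : measurable [set w | eval (@mdist R p) (@coins R p w) r (ps_root p) = c].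
    exact: measurable_eval_eq.
  have := integral_indic (coin (R := R)) measurableT mE'.
  rewrite setIT => iE'; apply: etrans iE'.
  apply: eq_integral => w _; rewrite indicE; congr (nat_of_bool _)%:R%:E.
  by apply/eqP/idP => [?|/set_mem//]; exact/mem_set.
have mE2 c : measurable_fun setT (fun w : measurableTypeR R =>
    (f c * (eval (@mdist R p) (@coins R p w) r1 (ps_root p) == c)%:R)%:E : \bar R).
  by under eq_fun do rewrite EFinM; exact: measurable_funeM.
under eq_integral do rewrite EFinD -sumEFin.
rewrite ge0_integralD//=; last 2 first.
- by move=> w _; apply: sume_ge0 => c; rewrite lee_fin mulr_ge0.
- exact: emeasurable_sum.
rewrite iE ge0_integral_sum//=; last first.
- by move=> c w _; rewrite lee_fin mulr_ge0.
congr (_ + _)%E; apply: eq_bigr => c _.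
under eq_integral do rewrite EFinM.
rewrite ge0_integralZl_EFin//= ?iE//; exact: mE.
Qed.

Lemma mean_cover (a : R) (p : pspace R) :
  (\int[fiid (single cover_rule) p]_m
     (pow0 (root_mark (@MPSpace R (nnreal R) p m)) a)%:E = cover_cost a p)%E.
Proof.
rewrite [LHS](@integral_law _ _ p (fun m => (pow0 (nnval (m (ps_root p))) a)%:E)); last 2 first.
- apply/measurable_EFinP.
  exact: (measurableT_comp (measurable_pow0 a) (measurable_root_mark (ps_root p))).
- by move=> m; rewrite lee_fin /pow0; case: ifP => // _; exact: powR_ge0.
rewrite /cover_cost -integral_chances; last by move=> c; exact: powR_ge0.
apply: eq_integral => w _.
by rewrite single_mark (elimT max_idPl (cover_ge0 _ _)) pow0_cover.
Qed.

Lemma psm_ball_cost (a : R) : psm (fun p =>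
  \sum_(c <- undup l) ((kappa * c) `^ a)%:E * chance (select cand l) c p)%E.
Proof.
elim: (undup l) => [|c s IH].
  by apply: (psm_ext (f := fun=> 0%E)) (@psm_cst _ _ (\bar R) 0%E) => p; rewrite big_nil.
apply: (psm_ext (f := fun p => ((kappa * c) `^ a)%:E * chance (select cand l) c p +
  \sum_(c <- s) ((kappa * c) `^ a)%:E * chance (select cand l) c p)%E).
  by move=> p; rewrite big_cons.
apply: psm_add => //.
exact: (psm_comp (measurable_funeM ((kappa * c) `^ a)%:E (@measurable_id _ (\bar R) setT))
  (psm_chance (select cand l) c)).
Qed.

Lemma bad_le_uncovered (p : pspace R) :
  (chance (rule_mul (rule_eq (select cand l) (RConst 0)) (uncovered cand kappa l)) 1%R p
   <= chance (uncovered cand kappa l) 1%R p)%E.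
Proof.
apply: le_measure.
- by apply/mem_set; exact: measurable_eval_eq.
- by apply/mem_set; exact: measurable_eval_eq.
move=> w; rewrite /mkset.
have -> : eval (@mdist R p) (@coins R p w)
    (rule_mul (rule_eq (select cand l) (RConst 0)) (uncovered cand kappa l)) (ps_root p) =
  (eval (@mdist R p) (@coins R p w) (select cand l) (ps_root p) == 0)%:R *
    eval (@mdist R p) (@coins R p w) (uncovered cand kappa l) (ps_root p) by [].
by case: (_ == 0); rewrite ?mul1r// mul0r => /eqP; rewrite eq_sym oner_eq0.
Qed.

Lemma content_le_cost d (T : measurableType d) (P : probability T R)
    (X : T -> pspace R) (a : R) :
  (hausdorff_content1 P X a <= \int[P]_x cover_cost a (X x))%E.
Proof.
apply: ereal_inf_lbound; exists (fiid (single cover_rule)); split.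
- apply: aeW => x; apply: covers_ae => w y.
  have [v [v0 vy]] := cover_covers (@coins R (X x) w) y.
  by exists v; rewrite single_mark (elimT max_idPl (cover_ge0 _ _)).
- apply: aeW => x; apply: radii_ae => w v.
  by rewrite single_mark (elimT max_idPl (cover_ge0 _ _)); exact: cover_radius.
- by apply: eq_integral => x _; rewrite mean_cover.
Qed.

End Covering.

(** Neither function is assumed measurable: a simple function below [f] is set to 0 on a null set to
    become one below [g]. This applies directly to iterated integrals and to sums over
    configurations. *)
Lemma ae_le_integral d (T : measurableType d) (R : realType)
    (P : {measure set T -> \bar R}) (f g : T -> \bar R) :
  (forall x, 0 <= f x)%E -> (forall x, 0 <= g x)%E ->
  {ae P, forall x, (f x <= g x)%E} -> (\int[P]_x f x <= \int[P]_x g x)%E.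
Proof.
move=> f0 g0 [N [mN N0 sN]].
rewrite ge0_integralTE// [leRHS]ge0_integralTE//; apply: ge_ereal_sup => _ [h /= hf <-].
have mNC := measurableC mN.
pose h' := mul_nnsfun h (indic_nnsfun R mNC).
have h'E x : h' x = h x * \1_(~` N) x by [].
suff -> : sintegral P h = sintegral P h'.
  apply: ereal_sup_ubound; exists h' => //= x; rewrite [X in X%:E](h'E x) indicE.
  have [xN|xN] := pselect (N x).
    by rewrite memNset ?mulr0//; apply.
  rewrite mem_set// mulr1 (le_trans (hf x))//.
  by apply: contrapT => H; apply: xN; exact: sN.
rewrite -!integralT_nnsfun; apply: ge0_ae_eq_integral => //.
- by apply/measurable_EFinP.
- by apply/measurable_EFinP.
- by move=> x _; rewrite lee_fin.
- by move=> x _; rewrite lee_fin.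
exists N; split=> // x /=; apply: contra_notP => xN _.
by rewrite [X in _ = X%:E](h'E x) indicE mem_set// mulr1.
Qed.

(** * Mass transport *)

Section Transport.
Context (R : realType) (k : nat).

Local Notation RTT := (lfset R k * borel_euclid R k * borel_euclid R k)%type.

(** Borel sets are invariant under pointed isometries; apply this to the preimage of the singleton
    of [f p]. *)
Lemma psm_isometry (f : pspace R -> \bar R) (p q : pspace R) (rho : p -> q) :
  psm f -> isometry rho -> rho (ps_root p) = ps_root q -> f p = f q.
Proof.
move=> mf irho rhoo.
have /(_ (emeasurable_set1 (f p))) b := mf [set f p].
by have [+ _] := ps_borel_isometry b irho rhoo; move=> /(_ erefl).
Qed.

Lemma measurable_euclid_coord (i : 'I_k) :
  measurable_fun setT (fun x : borel_euclid R k => (x : euclid R k) ord0 i).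
Proof.
apply: (@measurability _ _ _ _ setT _ (@RGenOpens.G R)).
  exact: RGenOpens.measurableE.
move=> _ [U [a [b ->]] <-]; rewrite setTI; apply: sub_sigma_algebra.
have oab : open `]a, b[%classic by exact: interval_open.
rewrite openE => x /= xab.
have /nbhs_ballP[e /= e0 eU] : nbhs ((x : euclid R k) ord0 i) `]a, b[%classic by exact: open_nbhs_nbhs.
apply/nbhs_ballP; exists e => //= y; rewrite ballEmdist/= => xy.
by apply: eU; rewrite /ball/=; exact: le_lt_trans (coord_le_euclid_dist _ _ i) xy.
Qed.

Lemma measurable_euclid_dist :
  measurable_fun setT (fun z : borel_euclid R k * borel_euclid R k =>
    mdist (z.1 : euclid R k) z.2).
Proof.
apply: (measurableT_comp (continuous_measurable_fun (@sqrt_continuous R))).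
apply: measurable_sum => i; apply: measurable_funX; apply: measurable_funB.
  exact: (measurableT_comp (measurable_euclid_coord i)).
exact: (measurableT_comp (measurable_euclid_coord i)).
Qed.

Lemma atx_translate (phi psi : lfset R k) (t x : euclid R k) (f : pspace R -> \bar R) :
  psm f -> sval psi = [set (z : euclid R k) + t | z in sval phi] ->
  f (atx psi (x + t)) = f (atx phi x).
Proof.
move=> mf E.
have shift y : sval psi (y + t) <-> sval phi y.
  rewrite E; split=> [[z pz /addIr <-]//|py]; by exists y.
have [h|h] := pselect (sval phi x); last first.
  by rewrite /atx; case: pselect => [/shift//|_]; case: pselect.
have h' : sval psi (x + t) by exact/shift.
rewrite (atxE h) (atxE h'); apply/esym.
have to_psi (z : sval phi) : val z + t \in sval psi.
  by apply/mem_set/shift; exact: set_mem (valP z).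
have of_psi (z : sval psi) : val z - t \in sval phi.
  by apply/mem_set/shift; rewrite subrK; exact: set_mem (valP z).
pose rho (z : at_point h) : at_point h' := exist _ (val z + t) (to_psi z).
apply: (@psm_isometry _ _ _ rho mf); last exact: val_inj.
split.
  exists (fun z : at_point h' => exist _ (val z - t) (of_psi z) : at_point h) => z.
    by apply: val_inj => /=; rewrite addrK.
  by apply: val_inj => /=; rewrite subrK.
move=> u v; rewrite /rho /mdist/= /euclid_dist; congr Num.sqrt.
by apply: eq_bigr => i _; rewrite !mxE opprD addrACA subrr addr0.
Qed.

Definition reroot (p : pspace R) (y : p) : pspace R := @PSpace R p y.

(** For each radius [c], a point x sends the mass [pi c] at x times [w] at y to every y within [c].
    [A] is at most the mass sent by the root, [B] at least the mass it receives. *)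
Lemma mass_transport d (T : measurableType d) (P : probability T R)
    (Phi : T -> lfset R k) (s : seq R) (pi : R -> pspace R -> \bar R)
    (w A B : pspace R -> \bar R) :
  point_stationary P Phi ->
  (forall c, psm (pi c)) -> psm w ->
  (forall c p, 0 <= pi c p)%E -> (forall p, 0 <= w p)%E ->
  (forall p, 0 <= A p)%E -> (forall p, 0 <= B p)%E ->
  (forall p : pspace R, A p <= \esum_(y in [set: p]) \sum_(c <- s)
     (mdist (ps_root p) y <= c)%R%:R%:E * (pi c p * w (reroot y)))%E ->
  (forall p : pspace R, \esum_(y in [set: p]) \sum_(c <- s)
     (mdist y (ps_root p) <= c)%R%:R%:E * (pi c (reroot y) * w p) <= B p)%E ->
  (\int[P]_x A (at0 (Phi x)) <= \int[P]_x B (at0 (Phi x)))%E.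
Proof.
move=> [mPhi Phi0 mtp] mpi mw pi0 w0 A0 B0 HA HB.
pose S c : set RTT := [set z | [/\ sval z.1.1 (z.1.2 : euclid R k),
  sval z.1.1 (z.2 : euclid R k) & mdist (z.1.2 : euclid R k) z.2 <= c]].
pose g (z : RTT) : \bar R := (\sum_(c <- s)
  (\1_(S c) z)%:E * (pi c (atx z.1.1 z.1.2) * w (atx z.1.1 z.2)))%E.
have mS c : measurable (S c).
  rewrite (_ : S c = ((fun z : RTT => (z.1.1, z.1.2)) @^-1` @occupied R k) `&`
    ((fun z : RTT => (z.1.1, z.2)) @^-1` @occupied R k) `&`
    [set z : RTT | mdist (z.1.2 : euclid R k) z.2 <= c]).
    have m1 : measurable_fun setT (fun z : RTT => (z.1.1, z.1.2)).
      by apply: measurable_fun_pair; apply: measurableT_comp.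
    have m2 : measurable_fun setT (fun z : RTT => (z.1.1, z.2)).
      by apply: measurable_fun_pair => //; apply: measurableT_comp.
    have m3 : measurable_fun setT (fun z : RTT => mdist (z.1.2 : euclid R k) z.2).
      have m12 : measurable_fun setT (fun z : RTT => (z.1.2, z.2)).
        by apply: measurable_fun_pair => //; apply: measurableT_comp.
      exact: (measurableT_comp measurable_euclid_dist m12).
    apply: measurableI; first apply: measurableI.
    - by rewrite -[X in measurable X]setTI; apply: m1 => //; exact: measurable_occupied.
    - by rewrite -[X in measurable X]setTI; apply: m2 => //; exact: measurable_occupied.
    - rewrite -[X in measurable X]setTI.
      exact: (measurable_fun_ler m3 (measurable_cst c)).
  by apply/seteqP; split=> z /= [] // [].
have mg : measurable_fun setT g.
  apply: emeasurable_sum => c; apply: emeasurable_funM.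
    by apply/measurable_EFinP; exact: measurable_indic.
  apply: emeasurable_funM.
    exact: (measurableT_comp (measurable_atx (mpi c)) (@measurable_fst _ _ _ (borel_euclid R k))).
  have m2 : measurable_fun setT (fun z : RTT => (z.1.1, z.2)).
    by apply: measurable_fun_pair => //; apply: measurableT_comp.
  exact: (measurableT_comp (measurable_atx mw) m2).
have g0 z : (0 <= g z)%E.
  apply: sume_ge0 => c _; apply: mule_ge0; first by rewrite lee_fin.
  exact: mule_ge0.
have tg : translation_invariant g.
  move=> phi psi t x y E; apply: eq_bigr => c _ /=.
  rewrite (atx_translate x (mpi c) E) (atx_translate y mw E); congr (_%:E * _)%E.
  have shift z : sval psi (z + t) <-> sval phi z.
    rewrite E; split=> [[z' pz /addIr <-]//|py]; by exists z.
  have dE : mdist (x + t) (y + t) = mdist x y.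
    rewrite !mdist_euclid /euclid_dist; congr Num.sqrt.
    by apply: eq_bigr => i _; rewrite !mxE opprD addrACA subrr addr0.
  rewrite !indicE; congr (nat_of_bool _)%:R.
  apply/idP/idP => /set_mem[/= h1 h2 h3]; apply/mem_set; split=> /=.
  - exact/shift.
  - exact/shift.
  - by rewrite -dE.
  - exact/shift.
  - exact/shift.
  - by rewrite dE.
have esumE (phi : lfset R k) (F : euclid R k -> \bar R) :
  (\esum_(x in sval phi) F x = \esum_(x in [set: sval phi]) F (val x))%E.
  have E : val @` [set: sval phi] = sval phi.
    apply/seteqP; split=> [_ [x _ <-]|x px]; first exact: set_mem (valP x).
    by exists (exist _ x (mem_set px)).
  transitivity (\esum_(x in val @` [set: sval phi]) F x)%E; first by rewrite E.
  by rewrite esum_image// => a b _ _; exact: val_inj.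
have SE (phi : lfset R k) (x y : euclid R k) c (h : sval phi x) : sval phi y ->
    (\1_(S c) (phi, x, y) = (mdist x y <= c)%R%:R :> R).
  move=> h'; rewrite indicE; congr (nat_of_bool _)%:R.
  by apply/idP/idP => [/set_mem[]//|xy]; exact/mem_set.
have rE (phi : lfset R k) (x : euclid R k) (h : sval phi x) (y : at_point h) : atx phi (val y) = reroot y.
  have h' : sval phi (val y) by exact: set_mem (valP y).
  by rewrite (atxE h') /at_point /reroot; congr PSpace; exact: val_inj.
apply: (@le_trans _ _ (\int[P]_w \esum_(x in sval (Phi w)) g (Phi w, 0%R : euclid R k, x))%E).
  apply: ae_le_integral => // [x|]; first by apply: esum_ge0.
  apply: filterS Phi0 => x h; rewrite at0E (atxE h).
  apply: (le_trans (HA _)); rewrite esumE.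
  rewrite le_eqVlt; apply/orP; left; apply/eqP; apply: eq_esum => y _.
  apply: eq_bigr => c _ /=.
  by rewrite (atxE h) (rE _ _ h) SE//; exact: set_mem (valP y).
rewrite mtp//; apply: ae_le_integral => // [x|]; first by apply: esum_ge0.
apply: filterS Phi0 => x h; rewrite at0E (atxE h).
apply: le_trans (HB _); rewrite esumE.
rewrite le_eqVlt; apply/orP; left; apply/eqP; apply: eq_esum => y _.
apply: eq_bigr => c _ /=.
by rewrite (atxE h) (rE _ _ h) SE//; exact: set_mem (valP y).
Qed.

End Transport.

Section TransportCost.
Context (R : realType).

Lemma eval_bit_free (r : rule R) (D : discreteSpace R) b b' (x : D) :
  depth r = 0%N -> eval (@mdist R D) b r x = eval (@mdist R D) b' r x.
Proof.
move=> r0; apply: (eval_embed (i := id)) => //.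
- exact: metric_triangle.
- by move=> t y; rewrite r0.
- by move=> y _; exists y.
Qed.

Variables (cand : R -> rule R) (l : seq R).
Hypothesis l0 : all (> 0) l.

(** Two selected balls that both contain [o] would have centres no further apart than the sum of
    their radii. *)
Lemma selected_balls_disjoint (D : discreteSpace R) b (o : D) (X : seq D) : uniq X ->
  \sum_(y <- X) \sum_(c <- undup l)
    (mdist y o <= c)%R%:R * (eval (@mdist R D) b (select cand l) y == c)%:R <= 1 :> R.
Proof.
move=> uX; set sel := eval _ _ _.
have [[y0 [y0X [c0 [c0l y0o s0]]]]|H] := pselect (exists y, y \in X /\
    exists c, [/\ c \in l, mdist y o <= c & sel y = c]); last first.
  rewrite big_seq big1// => y yX; rewrite big_seq big1// => c; rewrite mem_undup => cl.
  case: (leP (mdist y o) c) => yo; rewrite ?mul0r//.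
  by case: eqP => sy; rewrite ?mulr0//; exfalso; apply: H; exists y; split=> //; exists c.
have c0p : 0 < c0 := allP l0 _ c0l.
rewrite (bigD1_seq y0)//= (bigD1_seq c0) ?mem_undup ?undup_uniq//= y0o s0 eqxx mulr1.
rewrite big1 ?addr0; last by move=> c cc0; rewrite eq_sym (negbTE cc0) mulr0.
rewrite big1 ?addr0// => y yy0; rewrite big_seq big1// => c; rewrite mem_undup => cl.
case: (leP (mdist y o) c) => yo; rewrite ?mul0r//.
case: eqP => sy; rewrite ?mulr0//; exfalso.
have := @select_separated R cand D b l y y0 l0; rewrite -/sel sy s0.
have cp : 0 < c := allP l0 _ cl.
rewrite !gt_eqF// => /(_ isT isT (elimN eqP yy0)); apply/negP; rewrite -leNgt.
by rewrite (le_trans (metric_triangle _ o _))// lerD// metric_sym.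
Qed.

(** The previous bound integrated over the bits, which form a single source shared by all points of
    [p]. *)
Lemma sum_chances_le1 (p : pspace R) (X : seq p) : uniq X ->
  (\sum_(y <- X) \sum_(c <- undup l) (mdist y (ps_root p) <= c)%R%:R%:E *
     chance (select cand l) c (reroot y) <= 1)%E.
Proof.
move=> uX; pose A (y : p) c := [set w : measurableTypeR R |
  eval (@mdist R p) (@coins R p w) (select cand l) y = c].
have mA y c : measurable (A y c) by exact: measurable_eval_eq.
pose f (y : p) c (w : measurableTypeR R) : \bar R :=
  ((mdist y (ps_root p) <= c)%R%:R * \1_(A y c) w)%:E.
have mf y c : measurable_fun setT (f y c).
  by apply/measurable_EFinP; apply: measurable_funM => //; exact: measurable_indic.
have f0 y c w : (0 <= f y c w)%E by rewrite lee_fin mulr_ge0.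
have fE y c : ((mdist y (ps_root p) <= c)%R%:R%:E * chance (select cand l) c (reroot y) =
    \int[coin (R := R)]_w f y c w)%E.
  rewrite (_ : (fun w => _) = (fun w => (mdist y (ps_root p) <= c)%R%:R%:E * (\1_(A y c) w)%:E)%E).
    rewrite ge0_integralZl_EFin//; last by apply/measurable_EFinP; exact: measurable_indic.
    by rewrite integral_indic// setIT.
  by apply/funext => w; rewrite -EFinM.
have mS y : measurable_fun setT (fun w => \sum_(c <- undup l) f y c w)%E.
  exact: emeasurable_sum.
have -> : (\sum_(y <- X) \sum_(c <- undup l) (mdist y (ps_root p) <= c)%R%:R%:E *
     chance (select cand l) c (reroot y) =
   \int[coin (R := R)]_w \sum_(y <- X) \sum_(c <- undup l) f y c w)%E.
  rewrite ge0_integral_sum//; last by move=> y w _; exact: sume_ge0.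
  by apply: eq_bigr => y _; rewrite ge0_integral_sum//; apply: eq_bigr => c _; exact: fE.
have <- : (\int[coin (R := R)]_w cst 1%E w = 1)%E.
  rewrite integral_cst// mul1e; exact: probability_setT.
apply: ge0_le_integral => //.
- by move=> w _; apply: sume_ge0 => y _; exact: sume_ge0.
- exact: emeasurable_sum.
move=> w _ /=; under eq_bigr do rewrite sumEFin.
rewrite sumEFin lee_fin.
apply: le_trans (selected_balls_disjoint (@coins R p w) (ps_root p) uX).
rewrite le_eqVlt; apply/orP; left; apply/eqP.
apply: eq_bigr => y _; apply: eq_bigr => c _; congr (_ * _).
rewrite indicE; congr (nat_of_bool _)%:R.
by apply/idP/eqP => [/set_mem//|H]; exact/mem_set.
Qed.

Variables (k : nat) (kappa a C : R) (wt : rule R).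
Hypothesis C0 : 0 <= C.
Hypothesis wt0 : depth wt = 0%N.
Hypothesis wt_ge0 : forall (D : discreteSpace R) b x, 0 <= eval (@mdist R D) b wt x.
Hypothesis heavy : forall (D : discreteSpace R) b (x : D) c, c \in l ->
  eval (@mdist R D) b (cand c) x = 1 ->
  (kappa * c) `^ a <= C * nbsum c x (eval (@mdist R D) b wt).

Definition rule_value (r : rule R) (p : pspace R) : R :=
  eval (@mdist R p) (fun _ _ => false) r (ps_root p).

(** A centre of radius c, selected with probability pi, pays at most pi C w(N_c) by [heavy]; sent to
    the points of its ball, this charges a point o with C w(o) times the mean number of selected
    balls containing it, which is at most 1. *)
Lemma transport_cost d (T : measurableType d) (P : probability T R) (Phi : T -> lfset R k) :
  point_stationary P Phi ->
  (\int[P]_x cover_cost cand kappa l a (at0 (Phi x)) <=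
   \int[P]_x (C * rule_value wt (at0 (Phi x)))%:E +
   \int[P]_x chance (uncovered cand kappa l) 1%R (at0 (Phi x)))%E.
Proof.
move=> hPhi; have [mPhi _ _] := hPhi.
have rv0 p : 0 <= rule_value wt p by exact: wt_ge0.
pose A p : \bar R := (\sum_(c <- undup l) ((kappa * c) `^ a)%:E * chance (select cand l) c p)%E.
pose bad := rule_mul (rule_eq (select cand l) (RConst 0)) (uncovered cand kappa l).
have mA : psm A by exact: psm_ball_cost.
have A0 p : (0 <= A p)%E.
  by apply: sume_ge0 => c _; rewrite mule_ge0 ?chance_ge0 ?lee_fin ?powR_ge0.
rewrite ge0_integralD//; last 3 first.
- by move=> x _; exact: A0.
- exact: (measurable_at0 mPhi mA).
- exact: (measurable_at0 mPhi (psm_chance _ _)).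
apply: leeD; last first.
  apply: ge0_le_integral => //.
  - exact: (measurable_at0 mPhi (psm_chance _ _)).
  - exact: (measurable_at0 mPhi (psm_chance _ _)).
  by move=> x _; exact: bad_le_uncovered.
apply: (@mass_transport R k _ T P Phi (undup l) (fun c => chance (select cand l) c)
  (fun p => (C * rule_value wt p)%:E) A (fun p => (C * rule_value wt p)%:E)) => //.
- by move=> c; exact: psm_chance.
- apply: (psm_comp (h := fun v : measurableTypeR R => (C * v)%:E)) (psm_eval wt).
  by apply/measurable_EFinP; exact: measurable_funM.
- by move=> p; rewrite lee_fin mulr_ge0.
- by move=> p; rewrite lee_fin mulr_ge0.
- move=> p; have t0 y c : (0 <= (mdist (ps_root p) y <= c)%R%:R%:E *
      (chance (select cand l) c p * (C * rule_value wt (reroot y))%:E))%E.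
    by rewrite mule_ge0 ?lee_fin// mule_ge0 ?chance_ge0// lee_fin mulr_ge0.
  rewrite esum_sum; last by move=> y c _ _; exact: t0.
  rewrite /A big_seq [leRHS]big_seq; apply: lee_sum => c; rewrite mem_undup => cl.
  have [->|ch0] := eqVneq (chance (select cand l) c p) 0%E.
    by rewrite mule0; apply: esum_ge0 => y _; rewrite mul0e mule0.
  (* A positive chance provides one outcome in which the root is selected, hence a candidate. As
     [wt] uses no bits, the resulting lower bound on the weight of the ball holds for all
     outcomes. *)
  have [w sw] : exists w, eval (@mdist R p) (@coins R p w) (select cand l) (ps_root p) = c.
    apply: contrapT => H; move: ch0; rewrite /chance (_ : [set _ | _] = set0) ?measure0 ?eqxx//.
    by rewrite -subset0 => w sw; apply: H; exists w.
  have c0 : 0 < c := allP l0 _ cl.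
  have sw0 : eval (@mdist R p) (@coins R p w) (select cand l) (ps_root p) != 0.
    by rewrite sw gt_eqF.
  have := (selectP l0 sw0).2; rewrite sw => /(heavy cl) hc.
  have qfin : chance (select cand l) c p \is a fin_num.
    by rewrite ge0_fin_numE ?chance_ge0// (le_lt_trans (chance_le1 _ _ _)) ?ltry.
  have q0 : 0 <= fine (chance (select cand l) c p) by rewrite fine_ge0 ?chance_ge0.
  rewrite -(fineK qfin); set q := fine _ in q0 *.
  apply: esum_ge; exists [set y | mdist (ps_root p) y <= c].
    by split=> //; exact: ds_finite.
  rewrite (fsbig_finite _ _ (ds_finite _ _)).
  have E : (\sum_(y <- fset_set [set y | (mdist (ps_root p) y <= c)%R])
      (mdist (ps_root p) y <= c)%R%:R%:E * (q%:E * (C * rule_value wt (reroot y))%:E) =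
      (q * (C * nbsum c (ps_root p) (eval (@mdist R p) (@coins R p w) wt)))%:E)%E.
    rewrite nbsumE !big_distrr/= -sumEFin big_seq [RHS]big_seq; apply: eq_bigr => y.
    rewrite in_nb => ->; rewrite mul1e -EFinM; congr (_ * (_ * _))%:E.
    exact: eval_bit_free.
  rewrite E -EFinM lee_fin mulrC ler_wpM2l//.
- move=> p; apply: ge_ereal_sup => _ [X [finX _] <-].
  rewrite fsbig_finite//.
  have K0 : 0 <= C * rule_value wt p by rewrite mulr_ge0.
  apply: (@le_trans _ _ ((C * rule_value wt p)%:E * \sum_(y <- fset_set X) \sum_(c <- undup l)
    (mdist y (ps_root p) <= c)%R%:R%:E * chance (select cand l) c (reroot y))%E); last first.
    rewrite -[leRHS]mule1 lee_wpmul2l ?lee_fin//.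
    exact: (@sum_chances_le1 p (fset_set X) (fset_uniq _)).
  rewrite ge0_sume_distrr; last first.
    by move=> y _; apply: sume_ge0 => c _; rewrite mule_ge0 ?chance_ge0 ?lee_fin.
  apply: lee_sum => y _; rewrite ge0_sume_distrr; last first.
    by move=> c _; rewrite mule_ge0 ?chance_ge0 ?lee_fin.
  by apply: lee_sum => c _; rewrite muleA muleC.
Qed.

End TransportCost.

Lemma ler_sum1_seq (R : realType) (I : eqType) (s : seq I) (F : I -> R) i :
  {in s, forall j, 0 <= F j} -> i \in s -> F i <= \sum_(j <- s) F j.
Proof.
move=> F0 is_; rewrite (big_rem i)//= lerDl big_seq; apply: sumr_ge0 => j /mem_rem.
exact: F0.
Qed.

(** * Filling balls with weight *)

Section Filling.
Context (R : realType) (ls : seq R) (beta : R -> R).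

(* The slack of the ball N_c(v) is [beta c - w(N_c(v))]; each step raises w(x) by an
   amount that, shared by all points of any ball containing x, fits in its slack. *)
Definition slack (w : rule R) (c : R) : rule R :=
  rule_add (RConst (beta c)) (rule_mul (RConst (- 1)) (RSum c w)).

Definition size_over_slack (w : rule R) (c : R) : rule R :=
  rule_mul (RSum c (RConst 1)) (rule_inv (slack w c)).

(** The inverse of the sum of size over slack, over all balls containing the point, is a substitute
    for the minimum of slack over size that [RSum] can express. The first factor freezes a point as
    soon as one of its balls has no slack left. *)
Definition raise (w : rule R) : rule R :=
  rule_mul
    (foldr (fun c r => rule_mul (rule_eq
       (RSum c (rule_le (slack w c) (RConst 0))) (RConst 0)) r) (RConst 1) ls)
    (rule_inv (foldr (fun c r => rule_add (RSum c (size_over_slack w c)) r) (RConst 0) ls)).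

Fixpoint filling (j : nat) : rule R :=
  if j is j'.+1 then rule_add (filling j') (raise (filling j')) else RConst 0.

Lemma depth_filling j : depth (filling j) = 0%N.
Proof.
elim: j => //= j IH; rewrite IH.
set A := depth (foldr _ _ _); set B := depth (foldr _ _ _).
have -> : A = 0%N by rewrite /A; elim: ls => //= c s ->; rewrite IH.
have -> // : B = 0%N by rewrite /B; elim: ls => //= c s ->; rewrite IH.
Qed.

Variables (D : discreteSpace R) (b : nat -> D -> bool).
Hypothesis beta0 : forall c, c \in ls -> 0 < beta c.

Local Notation ev := (eval (@mdist R D) b).

Lemma eval_slack w c v : ev (slack w c) v = beta c - nbsum c v (ev w).
Proof. by rewrite -[LHS]/(beta c + -1 * nbsum c v (ev w)) mulN1r. Qed.

Lemma eval_size_over_slack w c v :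
  ev (size_over_slack w c) v = nbsum c v (fun _ : D => 1 : R) * (ev (slack w c) v) `^ (-1).
Proof. by []. Qed.

Lemma eval_raise w x :
  ev (raise w) x = `[< forall c, c \in ls -> forall v, mdist x v <= c -> 0 < ev (slack w c) v >]%:R
    * (\sum_(c <- ls) nbsum c x (ev (size_over_slack w c))) `^ (-1).
Proof.
rewrite [LHS]/=; congr (_ * (_ `^ _)); last first.
  by elim: ls => [|c s IH] /=; rewrite ?big_nil// big_cons IH.
elim: ls => [|c s IH] /=.
  by rewrite (asboolT _).
rewrite IH -natrM mulnb; congr (nat_of_bool _)%:R.
apply/andP/asboolP => [[/eqP h1 /asboolP h2] c'|H].
  rewrite inE => /orP[/eqP ->|]; last exact: h2.
  move=> v xv; have /nbsum_eq0 := h1 => /(_ (fun _ _ => ler0n _ _)) /(_ v xv) /eqP.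
  by rewrite pnatr_eq0 eqb0 -ltNge.
split; last by apply/asboolP => c' c's; apply: H; rewrite inE c's orbT.
apply/eqP; apply/nbsum_eq0 => // v xv.
by rewrite leNgt H ?mem_head.
Qed.

Definition within (w : rule R) := forall c, c \in ls -> forall v, nbsum c v (ev w) <= beta c.

Lemma size_ge1 c v : 0 <= c -> 1 <= nbsum c v (fun _ : D => 1 : R).
Proof.
move=> c0; apply: (@ler_nbsum1 _ _ c v (fun _ : D => 1 : R) v) => //.
by rewrite mdistxx.
Qed.

Hypothesis ls0 : all (> 0) ls.

Lemma size_over_slack_ge0 w c v : within w -> c \in ls -> 0 <= ev (size_over_slack w c) v.
Proof.
move=> ww cl; rewrite eval_size_over_slack mulr_ge0 ?powR_ge0//.
by rewrite (le_trans ler01)// size_ge1// ltW//; exact: (allP ls0).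
Qed.

Lemma raise_ge0 w x : 0 <= ev (raise w) x.
Proof. by rewrite eval_raise mulr_ge0 ?powR_ge0. Qed.

Lemma raise_le w x c v : within w -> c \in ls -> mdist x v <= c ->
  ev (raise w) x * nbsum c v (fun _ : D => 1 : R) <= ev (slack w c) v.
Proof.
move=> ww cl xv; have c0 := allP ls0 _ cl.
have s0 : 0 <= ev (slack w c) v by rewrite eval_slack subr_ge0 ww.
rewrite eval_raise; case: asboolP => [H|_]; last by rewrite !mul0r.
rewrite mul1r; have sp := H c cl v xv.
have n1 := size_ge1 v (ltW c0).
have n0 : 0 < nbsum c v (fun _ : D => 1 : R) by exact: lt_le_trans n1.
set S := \sum_(c <- ls) _.
have hS : nbsum c v (fun _ : D => 1 : R) / ev (slack w c) v <= S.
  have -> : nbsum c v (fun _ : D => 1 : R) / ev (slack w c) v = ev (size_over_slack w c) v.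
    by rewrite eval_size_over_slack powR_inv1// ltW.
  apply: (@le_trans _ _ (nbsum c x (ev (size_over_slack w c)))).
    apply: (@ler_nbsum1 _ _ c x (ev (size_over_slack w c))) => // y _.
    exact: size_over_slack_ge0.
  apply: (ler_sum1_seq (F := fun c => nbsum c x (ev (size_over_slack w c)))) => // a al.
  by apply: nbsum_ge0 => y _; exact: size_over_slack_ge0.
have S0 : 0 < S by apply: lt_le_trans hS; rewrite divr_gt0.
by rewrite powR_inv1 ?(ltW S0)// [_^-1 * _]mulrC ler_pdivrMr// [_ * S]mulrC -ler_pdivrMr.
Qed.

(** By [raise_le], each of the points of a ball takes at most its slack divided by its number of
    points. *)
Lemma within_filling j : within (filling j).
Proof.
elim: j => [|j IH] c cl v.
  by rewrite nbsumE big1// ltW// beta0.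
have c0 := allP ls0 _ cl.
rewrite nbsumE big_split/= -!nbsumE -lerBrDl -eval_slack.
have n0 : 0 < nbsum c v (fun _ : D => 1 : R) by rewrite (lt_le_trans _ (size_ge1 v (ltW c0))).
apply: (@le_trans _ _ (nbsum c v (fun=> ev (slack (filling j) c) v / nbsum c v (fun _ : D => 1 : R)))).
  apply: ler_nbsum => y vy; rewrite ler_pdivlMr//; apply: raise_le => //.
  by rewrite metric_sym.
set a := _ / _; have -> : nbsum c v (fun=> a) = nbsum c v (fun _ : D => 1 : R) * a.
  by rewrite !nbsumE big_distrl/=; apply: eq_bigr => y _; rewrite mul1r.
by rewrite /a mulrC divfK// gt_eqF.
Qed.

Lemma filling_ge0 j x : 0 <= ev (filling j) x.
Proof. by elim: j => //= j IH; rewrite addr_ge0// raise_ge0. Qed.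

Lemma filling_nondecreasing i j x : (i <= j)%N -> ev (filling i) x <= ev (filling j) x.
Proof.
elim: j => [|j IH]; first by rewrite leqn0 => /eqP ->.
rewrite leq_eqVlt => /orP[/eqP ->//|]; rewrite ltnS => /IH h.
by apply: (le_trans h); rewrite /= lerDl raise_ge0.
Qed.

Lemma filling_le j x c : c \in ls -> ev (filling j) x <= beta c.
Proof.
move=> cl; apply: le_trans (within_filling j cl x).
apply: (@ler_nbsum1 _ _ c x (ev (filling j))) => [y _|]; first exact: filling_ge0.
by rewrite mdistxx ltW//; exact: (allP ls0).
Qed.

(** If every ball containing [x] kept slack above [eta * beta c], each step would raise [x] by a
    fixed amount, against the bound [beta c] on its weight. Slacks decrease, so once small they
    remain small. *)
Lemma filling_tight (eta : R) x : 0 < eta -> ls != [::] ->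
  exists c v j0, [/\ c \in ls, mdist x v <= c &
    forall j, (j0 <= j)%N -> ev (slack (filling j) c) v <= eta * beta c].
Proof.
move=> eta0 lsN; apply: contrapT => H.
have big c v j : c \in ls -> mdist x v <= c -> eta * beta c < ev (slack (filling j) c) v.
  move=> cl xv; rewrite ltNge; apply/negP => h; apply: H.
  exists c, v, j; split=> // j' jj'; apply: le_trans h.
  rewrite !eval_slack lerD2l lerN2; apply: ler_nbsum => y _.
  exact: filling_nondecreasing.
(* An upper bound, independent of the step [j], for the sum whose inverse is the raise at [x]. *)
pose T := \sum_(c <- ls) nbsum c x (fun v => nbsum c v (fun _ : D => 1 : R) / (eta * beta c)).
have step j : T^-1 <= ev (raise (filling j)) x /\ 0 < T.
  rewrite eval_raise asboolT ?mul1r; last first.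
    move=> c cl v xv; apply: lt_trans (big c v j cl xv); rewrite mulr_gt0// beta0//.
  set S := \sum_(c <- ls) _.
  have ST : S <= T.
    rewrite /S /T big_seq [leRHS]big_seq; apply: ler_sum => c cl.
    apply: ler_nbsum => v xv; rewrite eval_size_over_slack.
    have h := big c v j cl xv.
    have e0 : 0 < eta * beta c by rewrite mulr_gt0// beta0.
    have s0 := lt_trans e0 h.
    rewrite powR_inv1 ?(ltW s0)// ler_wpM2l//.
      by rewrite (le_trans ler01)// size_ge1// ltW//; exact: (allP ls0).
    by rewrite lef_pV2// ?posrE// ltW.
  have S0 : 0 < S.
    have [c cl] : exists c, c \in ls.
      by case: ls lsN => // c s _; exists c; rewrite mem_head.
    have c0 := allP ls0 _ cl.
    have xx : mdist x x <= c by rewrite mdistxx ltW.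
    have s0 : 0 < ev (slack (filling j) c) x.
      by apply: lt_trans (big c x j cl xx); rewrite mulr_gt0// beta0.
    apply: (@lt_le_trans _ _ (nbsum c x (ev (size_over_slack (filling j) c)))).
      apply: (@lt_le_trans _ _ (ev (size_over_slack (filling j) c) x)).
        rewrite eval_size_over_slack powR_inv1 ?(ltW s0)// divr_gt0//.
        by rewrite (lt_le_trans ltr01)// size_ge1// ltW.
      apply: (@ler_nbsum1 _ _ c x (ev (size_over_slack (filling j) c))) => // y _.
      exact: size_over_slack_ge0 (within_filling j) cl.
    apply: (ler_sum1_seq (F := fun c => nbsum c x (ev (size_over_slack (filling j) c)))) => // a al.
    by apply: nbsum_ge0 => y _; exact: size_over_slack_ge0 (within_filling j) al.
  have T0 := lt_le_trans S0 ST.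
  by split=> //; rewrite powR_inv1 ?(ltW S0)// lef_pV2.
have [_ T0] := step 0%N.
have grow j : j%:R * T^-1 <= ev (filling j) x.
  elim: j => [|j IH]; first by rewrite mul0r.
  by rewrite -natr1 mulrDl mul1r /= lerD//; exact: (step j).1.
have [c cl] : exists c, c \in ls.
  by case: ls lsN => // c s _; exists c; rewrite mem_head.
pose j := (Num.truncn (beta c * T)).+1.
have := le_trans (grow j) (filling_le j x cl).
rewrite ler_pdivrMr//; apply/negP; rewrite -ltNge.
have bT : 0 <= beta c * T by rewrite mulr_ge0// ltW// beta0.
by have /andP[] := truncn_itv bT.
Qed.

End Filling.

(** The rate [q] and the threshold [n0] depend on [x], so there is no uniform estimate; dominated
    convergence gives smallness in mean. *)
Lemma dominated_small d (T : measurableType d) (R : realType) (P : probability T R)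
    (f : nat -> T -> \bar R) :
  (forall n, measurable_fun setT (f n)) -> (forall n x, 0 <= f n x <= 1)%E ->
  (forall x, exists n0 (q : R), 0 <= q < 1 /\
     forall n, (n0 <= n)%N -> (f n x <= (q ^+ n)%:E)%E) ->
  forall e : R, 0 < e -> exists n, (\int[P]_x f n x <= e%:E)%E.
Proof.
move=> mf f01 fq e e0.
have cf x : f n x @[n --> \oo] --> 0%E.
  have [n0 [q [/andP[q0 q1] Hq]]] := fq x.
  apply: (@squeeze_cvge _ _ _ _ (fun=> 0%E) _ (fun n => (q ^+ n)%:E)).
  - exists n0 => // n /= n0n; rewrite Hq//.
    by have /andP[-> _] := f01 n x.
  - exact: cvg_cst.
  - apply: cvg_EFin; first exact: nearW.
    by apply: cvg_expr; rewrite ger0_norm.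
have [] := @dominated_convergence _ T R P setT measurableT f (cst 0%E) (cst 1%E) mf.
- exact: measurable_cst.
- by apply: aeW => x _; exact: cf.
- by apply/integrableP; split=> //; under eq_integral do rewrite abse1;
    rewrite integral_cst// mul1e (le_lt_trans (probability_le1 _ measurableT)) ?ltry.
- by apply: aeW => x n _; have /andP[h1 h2] := f01 n x; rewrite gee0_abs.
move=> _ _; rewrite integral0 => /fine_cvgP[_ /cvgr0Pnorm_lt/(_ e e0)[n _ Hn]].
exists n; have fin : (\int[P]_x f n x \is a fin_num)%E.
  rewrite ge0_fin_numE; last by apply: integral_ge0 => x _; case/andP: (f01 n x).
  apply: (@le_lt_trans _ _ (\int[P]_x cst 1 x)%E).
    apply: ge0_le_integral => // [x _|x _]; first by case/andP: (f01 n x).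
    by case/andP: (f01 n x).
  by rewrite integral_cst// mul1e (le_lt_trans (probability_le1 _ measurableT)) ?ltry.
rewrite -(fineK fin) lee_fin ltW// (le_lt_trans (ler_norm _))//.
exact: (Hn n (leqnn n)).
Qed.

(** * Almost optimal weights for small exponents *)

Section Rounds.
Context (R : realType).

(** For an increasing list of radii this runs [j] rounds at the largest radius first, as the tail of
    the list is processed before its head. *)
Definition rounds (j : nat) (ls : seq R) : seq R := flatten [seq nseq j c | c <- ls].

Lemma mem_rounds j ls c : c \in rounds j ls -> c \in ls.
Proof. by move=> /flattenP[_ /mapP[a al ->]] /nseqP[->]. Qed.

Lemma all_rounds j ls (a : pred R) : all a ls -> all a (rounds j ls).
Proof. by move=> /allP H; apply/allP => c /mem_rounds; exact: H. Qed.

Lemma chance_uncovered_small (cand : nat -> R -> rule R) (ls : seq R) (kappa : R)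
    (p : pspace R) (c : R) (v : p) j0 :
  all (> 0) ls -> sorted <=%R ls -> 1 <= kappa -> c \in ls ->
  mdist (ps_root p) v <= (kappa - 2) * c ->
  (forall j b, (j0 <= j)%N -> eval (@mdist R p) b (cand j c) v = 1) ->
  exists q : R, 0 <= q < 1 /\ forall j, (j0 <= j)%N ->
    (chance (uncovered (cand j) kappa (rounds j ls)) 1%R p <= (q ^+ j)%:E)%E.
Proof.
move=> ls0 sls k1 cl pv cv.
have c0 : 0 < c := allP ls0 _ cl.
have [q q01 Hq] := coin_uncovered c0 k1 pv.
exists q; split=> // j j0j; rewrite /chance.
case/splitPr: cl ls0 sls => l1 l2 ls0 sls.
have E : rounds j (l1 ++ c :: l2) = rounds j l1 ++ nseq j c ++ rounds j l2.
  by rewrite /rounds map_cat flatten_cat.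
rewrite E; apply: Hq => //.
- by rewrite -E; exact: all_rounds.
- move=> a /mem_rounds al2.
  move: sls; rewrite (sorted_pairwise le_trans) pairwise_cat /= => /and4P[_ _ H _].
  exact: (allP H).
- by move=> b; exact: cv.
Qed.

End Rounds.

Section Subcritical.
Context (R : realType) (k : nat).

Lemma subcritical_constants (a : R) : 0 <= a -> a < k%:R ->
  exists q theta : R, [/\ 1 < q, 0 < theta, theta < 1 & (3 * q) `^ a <= 3 ^+ k * theta].
Proof.
(* Take q = 3^(de / (a + 1)) and theta = 3^(-de). Then (3q)^a <= 3^(a + de) = 3^(k - de); the
   denominator a + 1 covers a = 0. *)
move=> a0 ak; pose de := (k%:R - a) / 2.
have de0 : 0 < de by rewrite divr_gt0// subr_gt0.
have three0 : 0 < 3 :> R by [].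
have a1 : 0 < a + 1 by rewrite ltr_wpDl.
have gt1 (x : R) : 0 < x -> 1 < 3 `^ x.
  move=> x0; have := @gt0_ltr_powR R x x0 1 3.
  by rewrite powR1 !nnegrE => ->//; rewrite ltr1n.
exists (3 `^ (de / (a + 1))), (3 `^ (- de)); split.
- by apply: gt1; rewrite divr_gt0.
- exact: powR_gt0.
- by rewrite powRN invf_lt1 ?powR_gt0// gt1.
rewrite powRM ?powR_ge0// -powRrM.
rewrite -powR_mulrn// -!powRD; try by apply/implyP => _; rewrite gt_eqF.
rewrite ler_powR ?ler1n//.
have -> : k%:R = a + 2 * de by rewrite /de; field.
suff : de / (a + 1) * a <= de by lra.
by rewrite mulrAC ler_pdivrMr// ler_pM2l// lerDl.
Qed.

Lemma exp_unbounded (q M : R) : 1 < q -> exists n, M <= q ^+ n.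
Proof.
move=> q1; have bern n : 1 + n%:R * (q - 1) <= q ^+ n.
  elim: n => [|n IH]; first by rewrite mul0r addr0 expr0.
  rewrite exprS; have hq : q * (1 + n%:R * (q - 1)) <= q * q ^+ n by rewrite ler_pM2l// (lt_trans ltr01).
  apply: le_trans hq; rewrite -[X in 1 + X * _]natr1 -subr_ge0.
  have -> : q * (1 + n%:R * (q - 1)) - (1 + (n%:R + 1) * (q - 1)) = n%:R * (q - 1) ^+ 2.
    by ring.
  by rewrite mulr_ge0// sqr_ge0.
have q10 : 0 < q - 1 by rewrite subr_gt0.
exists (Num.truncn (`|M| / (q - 1))).+1; apply: le_trans (bern _).
have h : 0 <= `|M| / (q - 1) by rewrite divr_ge0// ltW.
have /andP[_] := truncn_itv h; rewrite ltr_pdivrMr// => h2.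
by rewrite (le_trans (ler_norm M))// (le_trans (ltW h2))// lerDr.
Qed.

(** The number [j] serves both as the number of filling steps and as the number of rounds per
    radius, so that one limit makes the balls almost full and the selection almost covering. *)
Lemma subcritical_rule d (T : measurableType d) (P : probability T R)
    (Phi : T -> lfset R k) (a : R) : point_stationary P Phi -> 0 <= a -> a < k%:R ->
  forall (M e : R), 0 < e -> exists wt : rule R, [/\ depth wt = 0%N,
    forall (D : discreteSpace R) b x, 0 <= eval (@mdist R D) b wt x <= 1,
    forall (D : discreteSpace R) b x r, 1 <= r <= M ->
      nbsum r x (eval (@mdist R D) b wt) <= r `^ a &
    (hausdorff_content1 P (fun x => at0 (Phi x)) a <=
      \int[P]_x ((3 ^+ k)%R * rule_value wt (at0 (Phi x)))%:E + e%:E)%E].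
Proof.
move=> hPhi a0 ak M e e0; have [mPhi _ _] := hPhi.
have [q [th [q1 th0 th1 qth]]] := subcritical_constants a0 ak.
have [I MI] := exp_unbounded M q1.
have q0 : 0 < q := lt_trans ltr01 q1.
(* The last radius q^(I+1) exceeds [M]. The capacity [beta] of a radius of the grid is the bound
   required at the preceding one, so it suits all radii in between; at c = q it is 1, which bounds
   the weights by 1. *)
pose ls := [seq q ^+ i.+1 | i <- iota 0 I.+1].
pose beta (c : R) := (c / q) `^ a.
have lsP c : reflect (exists2 i, (i < I.+1)%N & c = q ^+ i.+1) (c \in ls).
  by apply: (iffP mapP) => -[i] iI ->; exists i => //; move: iI; rewrite mem_iota.
have betaE i : beta (q ^+ i.+1) = (q ^+ i) `^ a.
  by rewrite /beta exprS mulrC mulKf// gt_eqF.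
have qge1 i : 1 <= q ^+ i by rewrite exprn_ege1// ltW.
have q_gt0 i : 0 < q ^+ i by rewrite exprn_gt0.
have ls0 : all (> 0) ls by apply/allP => c /lsP[i _ ->]; exact: q_gt0.
have beta0 c : c \in ls -> 0 < beta c.
  by move=> /lsP[i _ ->]; rewrite betaE powR_gt0.
have sls : sorted <=%R ls.
  rewrite /ls sorted_map; apply: (@sub_sorted _ ltn).
    by move=> i j ij; rewrite /= ler_eXn2l// ltnW.
  exact: iota_ltn_sorted.
have lsN : ls != [::] by [].
pose wt j := filling ls beta j.
(* Candidates are the balls filled up to the proportion [th]; tightness with [eta = 1 - th] puts
   every point in one of them eventually. *)
pose cand j c := rule_le (RConst (th * beta c)) (RSum c (wt j)).
have candE j c (D : discreteSpace R) b x : eval (@mdist R D) b (cand j c) x =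
  (th * beta c <= nbsum c x (eval (@mdist R D) b (wt j)))%R%:R by [].
have [j Hj] : exists j, (\int[P]_x chance (uncovered (cand j) 3 (rounds j ls)) 1%R (at0 (Phi x)) <= e%:E)%E.
  apply: (@dominated_small _ _ _ P (fun j x => chance (uncovered (cand j) 3 (rounds j ls)) 1%R (at0 (Phi x)))) => //.
  - by move=> n; exact: (measurable_at0 mPhi (psm_chance _ _)).
  - by move=> n x; rewrite chance_ge0 chance_le1.
  move=> x; set p := at0 (Phi x).
  have eta0 : 0 < 1 - th by rewrite subr_gt0.
  have [c [v [j0 [cl pv H]]]] := @filling_tight R ls beta p (fun _ _ => false) beta0 ls0 (1 - th) (ps_root p) eta0 lsN.
  exists j0; apply: (@chance_uncovered_small R cand ls 3 p c v j0) => //.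
  - by rewrite ler1n.
  - by rewrite (_ : 3 - 2 = 1) ?mul1r//; lra.
  move=> j b j0j; rewrite candE; suff -> : th * beta c <= nbsum c v (eval (@mdist R p) b (wt j)) by [].
  have := H j j0j; rewrite eval_slack.
  have -> : eval (@mdist R p) (fun _ _ => false) (filling ls beta j) = eval (@mdist R p) b (wt j).
    by apply/funext => y; apply: eval_bit_free; exact: depth_filling.
  lra.
exists (wt j); split.
- exact: depth_filling.
- move=> D b x; rewrite filling_ge0/=.
  have ql : q ^+ 1 \in ls by apply/lsP; exists 0%N.
  by have := @filling_le R ls beta D b beta0 ls0 j x _ ql; rewrite betaE expr0 powR1.
- move=> D b x r /andP[r1 rM].
  have [i iI /andP[ir ri]] : exists2 i, (i < I.+1)%N & q ^+ i <= r <= q ^+ i.+1.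
    have : r <= q ^+ I.+1.
      by rewrite (le_trans rM)// (le_trans MI)// ler_eXn2l.
    elim: I {MI ls lsP ls0 beta0 sls lsN wt cand candE Hj} => [|I IH] rI.
      by exists 0%N => //; rewrite expr0 r1.
    have [/IH[i iI h]|h] := leP r (q ^+ I.+1).
      by exists i => //; rewrite ltnW.
    by exists I.+1 => //; rewrite (ltW h).
  have cl : q ^+ i.+1 \in ls by apply/lsP; exists i.
  apply: (@le_trans _ _ (nbsum (q ^+ i.+1) x (eval (@mdist R D) b (wt j)))).
    by apply: nbsum_le_radius => // y; exact: filling_ge0.
  apply: le_trans (within_filling b beta0 ls0 j cl x) _.
  rewrite betaE ge0_ler_powR// nnegrE ?ltW//; exact: lt_le_trans r1.
- apply: le_trans (_ : _ <= \int[P]_x cover_cost (cand j) 3 (rounds j ls) a (at0 (Phi x)))%E _.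
    apply: content_le_cost.
    + exact: all_rounds.
    + apply: all_rounds; apply/allP => c /lsP[i _ ->].
      by have := qge1 i.+1; lra.
    + by rewrite ler1n.
  apply: le_trans (leeD2l _ Hj).
  apply: transport_cost => //.
  + exact: all_rounds.
  + exact: depth_filling.
  + by move=> D b x; exact: filling_ge0.
  move=> D b x c /mem_rounds cl; rewrite candE => h.
  have {}h : th * beta c <= nbsum c x (eval (@mdist R D) b (wt j)).
    by move: h; case: (_ <= _) => // /eqP; rewrite eq_sym oner_eq0.
  have c0 : 0 < c := allP ls0 _ cl.
  (* For a candidate, (3c)^a = (3q)^a [beta c] <= 3^k [th * beta c], which is at most 3^k times the
     weight of the ball. *)
  have -> : 3 * c = (3 * q) * (c / q) by field; rewrite gt_eqF.
  have cq0 : 0 <= c / q by rewrite divr_ge0// ltW.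
  have tq0 : 0 <= 3 * q by rewrite mulr_ge0// ltW.
  rewrite powRM//.
  apply: (@le_trans _ _ (3 ^+ k * th * beta c)); first by rewrite ler_pM2r// beta0.
  by rewrite -mulrA ler_pM2l// exprn_gt0.
Qed.

End Subcritical.

(** * Lower limits of weights *)

Section LowerLimit.
Context (R : realType).

Definition lower_limit (g : rfamily R nat) : R := fine (limn_einf (fun n => (g n)%:E)).

Lemma measurable_lower_limit : measurable_fun setT lower_limit.
Proof.
apply: measurableT_comp => //.
apply: (measurableT_comp (f := fun x : \bar R => (- x)%E)).
  exact: oppe_measurable.
apply: measurable_fun_limn_esup => n; apply: measurableT_comp; first exact: oppe_measurable.
by apply/measurable_EFinP; exact: measurable_coordinate.
Qed.

Variable u : nat -> R.
Hypothesis u01 : forall n, 0 <= u n <= 1.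

Let inf_ge N (c : R) : (forall n, (N <= n)%N -> c <= u n) ->
  (c%:E <= einfs (fun n => (u n)%:E) N)%E.
Proof. by move=> H; apply: le_ereal_inf_tmp => _ [n /= Nn <-]; rewrite lee_fin H. Qed.

Let inf_le N n : (N <= n)%N -> (einfs (fun n => (u n)%:E) N <= (u n)%:E)%E.
Proof. by move=> Nn; apply: ereal_inf_lbound; exists n. Qed.

Let limE : limn_einf (fun n => (u n)%:E) = ereal_sup (range (einfs (fun n => (u n)%:E))).
Proof. by rewrite limn_einf_lim; apply/cvg_lim => //; exact: cvg_einfs_sup. Qed.

Let lim01 : (0 <= limn_einf (fun n => (u n)%:E) <= 1)%E.
Proof.
rewrite limE; apply/andP; split.
  apply: (@le_trans _ _ (einfs (fun n => (u n)%:E) 0)); last first.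
    by apply: ereal_sup_ubound; exists 0%N.
  by apply: inf_ge => n _; case/andP: (u01 n).
apply: ge_ereal_sup => _ [n _ <-]; apply: (le_trans (inf_le (leqnn n))).
by rewrite lee_fin; case/andP: (u01 n).
Qed.

Let limK : (lower_limit u)%:E = limn_einf (fun n => (u n)%:E).
Proof.
have /andP[h0 h1] := lim01; rewrite /lower_limit fineK//.
by rewrite ge0_fin_numE// (le_lt_trans h1) ?ltry.
Qed.

Lemma lower_limit_ge0 : 0 <= lower_limit u.
Proof. by rewrite -lee_fin limK; case/andP: lim01. Qed.

Lemma lower_limit_le1 : lower_limit u <= 1.
Proof. by rewrite -lee_fin limK; case/andP: lim01. Qed.

Lemma lower_limit_ge N (c : R) : (forall n, (N <= n)%N -> c <= u n) -> c <= lower_limit u.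
Proof.
move=> H; rewrite -lee_fin limK limE; apply: (le_trans (inf_ge H)).
by apply: ereal_sup_ubound; exists N.
Qed.

Lemma lower_limit_eventually (e : R) : 0 < e ->
  exists N, forall n, (N <= n)%N -> lower_limit u <= u n + e.
Proof.
move=> e0; have : ((lower_limit u - e)%:E < limn_einf (fun n => (u n)%:E))%E.
  by rewrite -limK lte_fin ltrBlDr ltrDl.
rewrite limE => /ereal_sup_gt[_ [N _ <-] h]; exists N => n Nn.
by rewrite -lerBlDr -lee_fin (le_trans (ltW h))// inf_le.
Qed.

End LowerLimit.

(** Fatou for a finite sum: all terms are simultaneously within a small error above their lower
    limits from some index on. *)
Lemma sum_lower_limit (R : realType) (I : eqType) (s : seq I) (u : I -> nat -> R) (B : R) N :
  (forall i n, 0 <= u i n <= 1) ->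
  (forall n, (N <= n)%N -> \sum_(i <- s) u i n <= B) ->
  \sum_(i <- s) lower_limit (u i) <= B.
Proof.
move=> u01 uB; apply/ler_addgt0Pr => e e0.
have e1 : 0 < e / (size s).+1%:R by rewrite divr_gt0.
have [M HM] : exists M, forall i, i \in s -> forall n, (M <= n)%N ->
    lower_limit (u i) <= u i n + e / (size s).+1%:R.
  move: (e / _) e1 => e' e'0; elim: s {uB} => [|a s [M IH]]; first by exists 0%N.
  have [M' HM'] := lower_limit_eventually (u01 a) e'0.
  exists (maxn M M') => i; rewrite inE => /orP[/eqP -> n|iS n]; rewrite geq_max => /andP[h h'].
    exact: HM'.
  exact: IH.
apply: (@le_trans _ _ (\sum_(i <- s) (u i (maxn M N) + e / (size s).+1%:R))).
  rewrite big_seq [leRHS]big_seq; apply: ler_sum => i iS; apply: HM => //.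
  exact: leq_maxl.
rewrite big_split/= lerD ?uB ?leq_maxr// big_const_seq count_predT iter_addr addr0.
rewrite -[X in X <= _]mulr_natr mulrAC ler_pdivrMr// ler_pM2l// ler_nat.
exact: leqnSn.
Qed.

Section Midpoints.
Context (R : realType) (X : Type) (G : nat -> set X) (mid : X -> X -> X) (J : X -> R).
Hypothesis G_nonempty : forall n, exists x, G n x.
Hypothesis G_decreasing : forall m n x, (m <= n)%N -> G n x -> G m x.
Hypothesis G_mid : forall n x y, G n x -> G n y -> G n (mid x y).
Hypothesis J01 : forall n x, G n x -> 0 <= J x <= 1.

(* Almost minimizers of a uniformly convex functional over a decreasing sequence of
   convex sets form a Cauchy sequence. *)
Lemma almost_minimizers (delta : nat -> R) : (forall n, 0 < delta n) ->
  (forall n, delta n.+1 <= delta n) ->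
  exists x : nat -> X, forall n, G n (x n) /\
    2 * J (x n) + 2 * J (x n.+1) - 4 * J (mid (x n) (x n.+1)) <= 8 * delta n.
Proof.
move=> delta0 deltaS.
pose c n := inf [set J x | x in G n].
have hasinf n : has_inf [set J x | x in G n].
  split; first by have [x Gx] := G_nonempty n; exists (J x), x.
  by exists 0 => _ [x Gx <-]; case/andP: (J01 Gx).
have c_le n x : G n x -> c n <= J x.
  by move=> Gx; apply: ge_inf; [case: (hasinf n)|exists x].
have hassup : has_sup (range c).
  split; first by exists (c 0%N), 0%N.
  exists 1 => _ [n _ <-]; have [x Gx] := G_nonempty n.
  by apply: (le_trans (c_le _ _ Gx)); case/andP: (J01 Gx).
pose s := sup (range c).
have c_s n : c n <= s by apply: ub_le_sup; [case: hassup|exists n].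
have /choice[x Hx] : forall n, exists x, exists N, [/\ (n <= N)%N, s - delta n <= c N,
    G N x & J x <= s + delta n].
  move=> n; have [_ [M _ <-] hM] := sup_adherent (delta0 n) hassup.
  pose N := maxn M n.
  have cMN : c M <= c N.
    apply: lb_le_inf; first by have [x Gx] := G_nonempty N; exists (J x), x.
    move=> _ [x Gx <-]; apply: c_le; apply: G_decreasing Gx; exact: leq_maxl.
  have [_ [x Gx <-] hx] := inf_adherent (delta0 n) (hasinf N).
  exists x, N; split=> //; first exact: leq_maxr.
    by rewrite (le_trans (ltW hM)).
  by rewrite (le_trans (ltW hx))// lerD2r c_s.
exists x => n; have [N [nN cN GN JN]] := Hx n; have [N' [nN' cN' GN' JN']] := Hx n.+1.
split; first exact: G_decreasing GN.
have dS := deltaS n.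
(* Both points, hence their midpoint, lie in [G (minn N N')], where the infimum of [J] is at least
   [s - delta n]; the points themselves have [J] at most [s + delta n]. *)
have h : s - delta n <= J (mid (x n) (x n.+1)).
  have Gm : G (minn N N') (mid (x n) (x n.+1)).
    by apply: G_mid; [apply: G_decreasing GN; exact: geq_minl|
      apply: G_decreasing GN'; exact: geq_minr].
  apply: le_trans (c_le _ _ Gm); rewrite /minn; case: ifP => _ //.
  by apply: le_trans cN'; rewrite lerD2l lerN2.
lra.
Qed.

End Midpoints.

Section Expectation.
Context d (T : measurableType d) (R : realType) (P : probability T R).

Lemma bounded_integrable (f : T -> R) (B : R) : measurable_fun setT f ->
  (forall x, `|f x| <= B) -> P.-integrable setT (EFin \o f).
Proof.
move=> mf fB; apply: measurable_bounded_integrable => //.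
  by rewrite (le_lt_trans (probability_le1 _ measurableT)) ?ltry.
exists B; split; first exact: num_real.
by move=> M BM x _; exact: le_trans (fB x) (ltW BM).
Qed.

Lemma bounded_Rintegral (f : T -> R) (B : R) : measurable_fun setT f ->
  (forall x, `|f x| <= B) -> ((\int[P]_x f x)%:E = \int[P]_x (f x)%:E)%E.
Proof.
move=> mf fB; rewrite /Rintegral fineK//.
by apply: integrable_fin_num => //; exact: bounded_integrable fB.
Qed.

Lemma sum_half_powers n : \sum_(i < n) 2 ^- i = 2 - 2 * 2 ^- n :> R.
Proof.
elim: n => [|n IH]; first by rewrite big_ord0 expr0 invr1 mulr1 subrr.
rewrite big_ord_recr/= IH exprS invfM; field.
by rewrite expf_neq0.
Qed.

(** Pointwise, [f n] exceeds the lower limit by at most the sum of all later increments, whose mean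
    is at most the sum of 2^-(n+j) over j, that is 2 * 2^-n. *)
Lemma expectation_lower_limit (f : nat -> T -> R) :
  (forall n, measurable_fun setT (f n)) -> (forall n x, 0 <= f n x <= 1) ->
  (forall n, \int[P]_x `|f n x - f n.+1 x| <= 2 ^- n) ->
  forall n, \int[P]_x f n x <= \int[P]_x lower_limit (f^~ x) + 2 * 2 ^- n.
Proof.
move=> mf f01 fd n.
have mW : measurable_fun setT (fun x => lower_limit (f^~ x)).
  have mfam : measurable_fun setT (fun x => f^~ x : rfamily R nat) by exact: measurable_rfamily.
  exact: (measurableT_comp (@measurable_lower_limit R) mfam).
have W01 x : 0 <= lower_limit (f^~ x) <= 1.
  by rewrite lower_limit_ge0 ?lower_limit_le1.
have norm01 (g : T -> R) : (forall x, 0 <= g x <= 1) -> forall x, `|g x| <= 1.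
  by move=> g01 x; have /andP[h1 h2] := g01 x; rewrite ger0_norm.
pose dj j x := `|f (n + j)%N x - f (n + j).+1 x|.
have mdj j : measurable_fun setT (dj j).
  by apply: measurableT_comp => //; exact: measurable_funB.
have dj1 j x : `|dj j x| <= 1.
  rewrite normr_id; have /andP[h1 h2] := f01 (n + j)%N x.
  have /andP[h3 h4] := f01 (n + j).+1 x.
  rewrite ler_norml; apply/andP; split; lra.
have dj0 j x : 0 <= dj j x by exact: normr_ge0.
pose S x := (\sum_(j <oo) (dj j x)%:E)%E.
have S0 x : (0 <= S x)%E by apply: nneseries_ge0 => j _ _; rewrite lee_fin.
have mS : measurable_fun setT S.
  have := @ge0_emeasurable_sum _ T R setT (fun j x => (dj j x)%:E) xpredT.
  apply=> [j x _ _|j _]; first by rewrite lee_fin.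
  exact: (iffRL (measurable_EFinP _ _) (mdj j)).
rewrite -lee_fin EFinD (bounded_Rintegral (mf n) (norm01 _ (f01 n))).
rewrite (bounded_Rintegral mW (norm01 _ W01)).
apply: (@le_trans _ _ (\int[P]_x ((lower_limit (f^~ x))%:E + S x))%E).
  apply: ae_le_integral => [x|x|].
  - by rewrite lee_fin; case/andP: (f01 n x).
  - by rewrite adde_ge0// lee_fin; case/andP: (W01 x).
  apply: aeW => x; have := S0 x; case E : (S x) => [s| |] // s0; last first.
    by rewrite addey// leey.
  rewrite -EFinD lee_fin -lerBlDr.
  apply: (@lower_limit_ge _ _ (f01^~ x) n) => m nm.
  rewrite lerBlDr -lerBlDl -lee_fin -E.
  rewrite -(subnKC nm); move: (m - n)%N => j.
  apply: (@le_trans _ _ (\sum_(0 <= i < j) (dj i x)%:E)%E); last first.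
    by apply: nneseries_lim_ge => i _ _; rewrite lee_fin.
  rewrite sumEFin lee_fin big_mkord.
  elim: j => [|j IH]; first by rewrite addn0 subrr big_ord0.
  rewrite big_ord_recr/= addnS.
  have := ler_norm (f (n + j)%N x - f (n + j).+1 x); rewrite -/(dj j x).
  lra.
rewrite ge0_integralD//; last 2 first.
- by move=> x _; rewrite lee_fin; case/andP: (W01 x).
- by apply/measurable_EFinP.
apply: leeD2l.
rewrite integral_nneseries//; last 2 first.
- by move=> j; apply/measurable_EFinP.
- by move=> j x _; rewrite lee_fin.
apply: lime_le.
  by apply: is_cvg_nneseries => j _ _; apply: integral_ge0 => x _; rewrite lee_fin.
apply: nearW => m; rewrite big_mkord.
apply: (@le_trans _ _ (\sum_(i < m) (2 ^- n * 2 ^- i)%:E)%E).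
  apply: lee_sum => i _; rewrite -(bounded_Rintegral (mdj i) (dj1 i)) lee_fin.
  by rewrite -invfM -exprD; exact: fd.
rewrite sumEFin lee_fin -big_distrr/= sum_half_powers mulrC ler_wpM2r// lerBlDr lerDl.
by rewrite mulr_ge0.
Qed.

End Expectation.

Section LimitFactor.
Context (R : realType) (r : nat -> rule R).
Hypothesis r01 : forall n (D : discreteSpace R) b x, 0 <= eval (@mdist R D) b (r n) x <= 1.

Definition limit_factor : factor R := Factor r (@measurable_lower_limit R).

Lemma limit_factor_mark (D : discreteSpace R) w (x : D) :
  nnval (mark limit_factor D w x) =
  lower_limit (fun n => eval (@mdist R D) (@coins R D w) (r n) x).
Proof.
rewrite -[LHS]/(Num.max (lower_limit (fun n => eval (@mdist R D) (@coins R D w) (r n) x)) 0).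
by apply/max_idPl; apply: lower_limit_ge0 => n; exact: r01.
Qed.

Lemma limit_factor_sum (D : discreteSpace R) w (v : D) t (B : R) N :
  (forall n, (N <= n)%N -> nbsum t v (eval (@mdist R D) (@coins R D w) (r n)) <= B) ->
  \sum_(u \in [set u | mdist v u <= t]) nnval (mark limit_factor D w u) <= B.
Proof.
move=> H; rewrite (fsbig_finite _ _ (ds_finite v t)).
under eq_bigr do rewrite limit_factor_mark.
apply: (sum_lower_limit (N := N)) => [u n|n Nn]; first exact: r01.
by rewrite -nbsumE; exact: H.
Qed.

Lemma mean_limit_factor (p : pspace R) :
  (\int[fiid limit_factor p]_m (root_mark (@MPSpace R (nnreal R) p m))%:E =
   \int[coin (R := R)]_w
     (lower_limit (fun n => eval (@mdist R p) (@coins R p w) (r n) (ps_root p)))%:E)%E.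
Proof.
rewrite [LHS](@integral_law _ _ p (fun m => (nnval (m (ps_root p)))%:E)); last 2 first.
- apply/measurable_EFinP; exact: measurable_root_mark.
- by move=> m; rewrite lee_fin; exact: nnval_ge0.
by apply: eq_integral => w _; rewrite limit_factor_mark.
Qed.

End LimitFactor.

Lemma content_ge0 (R : realType) d (T : measurableType d) (P : probability T R)
    (X : T -> pspace R) (a : R) : (0 <= hausdorff_content1 P X a)%E.
Proof.
apply: le_ereal_inf_tmp => _ [Z [_ _ ->]].
apply: integral_ge0 => x _; apply: integral_ge0 => m _.
by rewrite lee_fin /pow0; case: ifP => // _; exact: powR_ge0.
Qed.

(** * Passage to the limit for small exponents *)

Section SubcriticalWeight.
Context (R : realType) (k : nat) d (T : measurableType d) (P : probability T R).
Context (Phi : T -> lfset R k) (a : R).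
Hypotheses (hPhi : point_stationary P Phi) (a0 : 0 <= a) (ak : a < k%:R).

Local Notation g r x := (rule_value r (at0 (Phi x))).
Local Notation content := (hausdorff_content1 P (fun x => at0 (Phi x)) a).

Let mPhi : measurable_fun setT Phi. Proof. by case: hPhi. Qed.

(** All four conditions are stable under midpoints and become stricter as [n] grows, as
    [almost_minimizers] requires. Depth 0 means that no bits are read. *)
Let good (n : nat) (r : rule R) : Prop := [/\ depth r = 0%N,
  forall (D : discreteSpace R) b x, 0 <= eval (@mdist R D) b r x <= 1,
  forall (D : discreteSpace R) b x t, 1 <= t <= n%:R ->
    nbsum t x (eval (@mdist R D) b r) <= t `^ a &
  fine content <= 3 ^+ k * (\int[P]_x g r x) + n.+1%:R^-1].

Let mid (r s : rule R) : rule R := rule_mul (RConst (2^-1)) (rule_add r s).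

Let mg r : measurable_fun setT (fun x => g r x : R).
Proof. exact: (measurable_at0 mPhi (psm_eval r)). Qed.

Let g01 n r : good n r -> forall x, `|g r x| <= 1.
Proof.
by move=> [_ r01 _ _] x; have /andP[h0 h1] := r01 (at0 (Phi x)) (fun _ _ => false) (ps_root _);
  rewrite ger0_norm.
Qed.

Let good_decreasing m n r : (m <= n)%N -> good n r -> good m r.
Proof.
move=> mn [r1 r2 r3 r4]; split=> //.
  move=> D b x t /andP[t1 tm]; apply: r3; rewrite t1 (le_trans tm)// ler_nat//.
apply: (le_trans r4); rewrite lerD2l lef_pV2 ?posrE// ler_nat//.
Qed.

Let content_fin : content \is a fin_num.
Proof.
have [r [r0 r01 _ H]] := subcritical_rule hPhi a0 ak 0 ltr01.
rewrite ge0_fin_numE ?content_ge0//; apply: (le_lt_trans H).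
have b x : `|3 ^+ k * g r x| <= 3 ^+ k.
  rewrite normrM ger0_norm ?exprn_ge0// ler_piMr ?exprn_ge0//.
  have /andP[h0 h1] := r01 (at0 (Phi x)) (fun _ _ => false) (ps_root _).
  by rewrite ger0_norm.
rewrite -(bounded_Rintegral P _ b) -?EFinD ?ltry//.
by apply: measurable_funM => //; exact: mg.
Qed.

Let good_nonempty n : exists r, good n r.
Proof.
have e0 : 0 < n.+1%:R^-1 :> R by [].
have [r [r0 r01 rt H]] := subcritical_rule hPhi a0 ak n%:R e0.
exists r; split=> //.
have b x : `|g r x| <= 1.
  have /andP[h0 h1] := r01 (at0 (Phi x)) (fun _ _ => false) (ps_root _).
  by rewrite ger0_norm.
have b' x : `|3 ^+ k * g r x| <= 3 ^+ k.
  by rewrite normrM ger0_norm ?exprn_ge0// ler_piMr ?exprn_ge0.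
have mr : measurable_fun setT (fun x => 3 ^+ k * g r x).
  by apply: measurable_funM => //; exact: mg.
rewrite -RintegralZl//; last by apply: bounded_integrable b; exact: mg.
by rewrite -lee_fin EFinD fineK// (bounded_Rintegral P mr b').
Qed.

Let midE r s x : g (mid r s) x = 2^-1 * (g r x + g s x). Proof. by []. Qed.

Let integrable_g n r : good n r -> P.-integrable setT (EFin \o (fun x => g r x)).
Proof. by move=> gr; apply: bounded_integrable (g01 gr); exact: mg. Qed.

Let good_mid n r s : good n r -> good n s -> good n (mid r s).
Proof.
move=> gr gs; have [r1 r2 r3 r4] := gr; have [s1 s2 s3 s4] := gs.
have E (D : discreteSpace R) b x : eval (@mdist R D) b (mid r s) x =
    2^-1 * (eval (@mdist R D) b r x + eval (@mdist R D) b s x) by [].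
split.
- by rewrite /= r1 s1.
- move=> D b x; rewrite E; have /andP[h1 h2] := r2 D b x; have /andP[h3 h4] := s2 D b x.
  by apply/andP; split; lra.
- move=> D b x t tn; have h1 := r3 D b x t tn; have h2 := s3 D b x t tn.
  have -> : nbsum t x (eval (@mdist R D) b (mid r s)) =
      2^-1 * (nbsum t x (eval (@mdist R D) b r) + nbsum t x (eval (@mdist R D) b s)).
    by rewrite !nbsumE -big_split big_distrr.
  lra.
- have -> : \int[P]_x g (mid r s) x = 2^-1 * (\int[P]_x g r x + \int[P]_x g s x).
    under eq_Rintegral do rewrite midE.
    rewrite RintegralZl//; last first.
      have ir := integrable_g gr; have is_ := integrable_g gs.
      exact: (integrableD measurableT ir is_).
    by rewrite RintegralD//; [exact: integrable_g gr|exact: integrable_g gs].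
  move: r4 s4; move: (\int[P]_x _) (\int[P]_x _) (3 ^+ k) n.+1%:R^-1 => X Y K i h1 h2.
  have -> : K * (2^-1 * (Y + X)) = (K * Y + K * X) / 2 by field.
  lra.
Qed.

Let J (r : rule R) : R := \int[P]_x (g r x ^+ 2).

Let sq_integrable n r : good n r -> P.-integrable setT (EFin \o (fun x => g r x ^+ 2)).
Proof.
move=> gr; apply: (@bounded_integrable _ _ _ _ _ 1).
  by apply: measurable_funX; exact: mg.
by move=> x; rewrite normrX expr_le1//; exact: g01 gr x.
Qed.

Let J01 n r : good n r -> 0 <= J r <= 1.
Proof.
move=> gr; apply/andP; split; first by apply: Rintegral_ge0 => x _; exact: sqr_ge0.
have <- : \int[P]_x cst 1 x = 1 :> R.
  rewrite Rintegral_cst// mul1r; exact: (congr1 fine (probability_setT P)).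
apply: le_Rintegral => //.
- exact: sq_integrable gr.
- by apply: (@bounded_integrable _ _ _ _ _ 1) => // x; rewrite normr1.
by move=> x _; rewrite -[X in X <= _]ger0_norm ?sqr_ge0// normrX expr_le1//; exact: g01 gr x.
Qed.

(** The uniform convexity that turns near-optimality of the midpoint into a bound on the distance in
    L^2. *)
Let parallelogram n r s : good n r -> good n s ->
  \int[P]_x ((g r x - g s x) ^+ 2) = 2 * J r + 2 * J s - 4 * J (mid r s).
Proof.
move=> gr gs; have gm := good_mid gr gs.
have ir := sq_integrable gr; have is_ := sq_integrable gs; have im := sq_integrable gm.
have scale (c : R) (f : T -> R) : P.-integrable setT (EFin \o f) ->
    P.-integrable setT (EFin \o (fun x => c * f x)).
  by move=> fi; have := integrableZl measurableT c fi; apply.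
rewrite -!RintegralZl// -RintegralD//; try exact: scale.
rewrite -RintegralB//; try exact: scale; last first.
  exact: (integrableD measurableT (scale 2 _ ir) (scale 2 _ is_)).
by apply: eq_Rintegral => x _; rewrite midE; field.
Qed.

Lemma subcritical_weight : exists r : nat -> rule R,
  [/\ forall n, depth (r n) = 0%N,
    forall n (D : discreteSpace R) b x, 0 <= eval (@mdist R D) b (r n) x <= 1,
    forall (D : discreteSpace R) b x t, 1 <= t -> exists N, forall n, (N <= n)%N ->
      nbsum t x (eval (@mdist R D) b (r n)) <= t `^ a &
    (content <= (3 ^+ k)%:E * \int[P]_x (lower_limit (fun n => g (r n) x))%:E)%E].
Proof.
(* With this delta, 8 [delta n] is 4^-n: squared L^2 distances of consecutive weights are at most
   4^-n, hence mean distances at most 2^-n, which is summable. *)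
have delta0 n : 0 < (8 * 4 ^+ n)^-1 :> R by rewrite invr_gt0 mulr_gt0// exprn_gt0.
have deltaS n : (8 * 4 ^+ n.+1)^-1 <= (8 * 4 ^+ n)^-1 :> R.
  by rewrite lef_pV2 ?posrE ?mulr_gt0 ?exprn_gt0// ler_pM2l// ler_eXn2l ?ltr1n.
have [r Hr] := almost_minimizers good_nonempty good_decreasing good_mid J01 delta0 deltaS.
have gr n : good n (r n) by have [] := Hr n.
have close n : \int[P]_x ((g (r n) x - g (r n.+1) x) ^+ 2) <= 4 ^- n.
  have [_] := Hr n; rewrite -(parallelogram (gr n) (good_decreasing (leqnSn n) (gr n.+1))).
  by rewrite invfM mulVKf.
exists r; split.
- by move=> n; case: (gr n).
- by move=> n; case: (gr n).
- move=> D b x t t1; exists (Num.truncn t).+1 => n tn; have [_ _ H _] := gr n; apply: H.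
  rewrite t1/=; have /andP[_ h] := truncn_itv (le_trans ler01 t1).
  by rewrite (le_trans (ltW h))// ler_nat.
have r01 n x : 0 <= g (r n) x <= 1.
  by have [_ H _ _] := gr n; exact: H.
have b1 n x : `|g (r n) x| <= 1 by exact: g01 (gr n) x.
have dist n : \int[P]_x `|g (r n) x - g (r n.+1) x| <= 2 ^- n.
  have md : measurable_fun setT (fun x => g (r n) x - g (r n.+1) x).
    by apply: measurable_funB; exact: mg.
  have d1 x : `|g (r n) x - g (r n.+1) x| <= 1.
    have /andP[h1 h2] := r01 n x; have /andP[h3 h4] := r01 n.+1 x.
    by rewrite ler_norml; apply/andP; split; lra.
  have p0 : 0 < 2 ^+ n :> R by rewrite exprn_gt0.
  have i2 : P.-integrable setT (EFin \o (fun x => (g (r n) x - g (r n.+1) x) ^+ 2)).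
    apply: (@bounded_integrable _ _ _ _ _ 1); first exact: measurable_funX.
    by move=> x; rewrite normrX expr_le1.
  have i1 : P.-integrable setT (EFin \o (fun x => `|g (r n) x - g (r n.+1) x|)).
    apply: (@bounded_integrable _ _ _ _ _ 1); first exact: measurableT_comp.
    by move=> x; rewrite normr_id.
  have ic (c : R) : P.-integrable setT (EFin \o (fun _ : T => c)).
    by apply: (@bounded_integrable _ _ _ _ _ `|c|).
  (* AM-GM: 2|t| <= 2^n t^2 + 2^-n *)
  apply: (@le_trans _ _ (\int[P]_x (2 ^+ n / 2 * (g (r n) x - g (r n.+1) x) ^+ 2 + 2 ^- n / 2))).
    apply: le_Rintegral => //.
      have iz := integrableZl measurableT (2 ^+ n / 2) i2.
      exact: (integrableD measurableT iz (ic (2 ^- n / 2))).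
    move=> x _; set t := g _ _ - g _ _.
    have := sqr_ge0 (2 ^+ n * `|t| - 1); rewrite sqrrB exprMn real_normK ?num_real// => h.
    rewrite -(ler_pM2l p0) -subr_ge0.
    have -> : 2 ^+ n * (2 ^+ n / 2 * t ^+ 2 + 2 ^- n / 2) - 2 ^+ n * `|t| =
      ((2 ^+ n) ^+ 2 * t ^+ 2 - 2 ^+ n * `|t| * 1 *+ 2 + 1 ^+ 2) / 2.
      by field; rewrite gt_eqF.
    by rewrite divr_ge0.
  rewrite RintegralD//; last exact: (integrableZl measurableT (2 ^+ n / 2) i2).
  rewrite RintegralZl// Rintegral_cst//.
  rewrite [fine _](congr1 fine (probability_setT P) : _ = 1) mulr1.
  have h : 2 ^+ n / 2 * (\int[P]_x ((g (r n) x - g (r n.+1) x) ^+ 2)) <= 2 ^+ n / 2 * 4 ^- n.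
    by rewrite ler_pM2l ?divr_gt0.
  have E : 2 ^+ n / 2 * 4 ^- n = 2 ^- n / 2 :> R.
    have -> : 4 = 2 * 2 :> R by rewrite -natrM.
    by rewrite exprMn; field; rewrite gt_eqF.
  lra.
have mL : measurable_fun setT (fun x => lower_limit (fun n => g (r n) x)).
  have mfam : measurable_fun setT (fun x => (fun n => g (r n) x) : rfamily R nat).
    by apply: measurable_rfamily => n; exact: mg.
  exact: (measurableT_comp (@measurable_lower_limit R) mfam).
have L1 x : `|lower_limit (fun n => g (r n) x)| <= 1.
  by rewrite ger0_norm ?lower_limit_le1 ?lower_limit_ge0.
rewrite -(bounded_Rintegral P mL L1) -EFinM -(fineK content_fin) lee_fin.
apply/ler_addgt0Pr => e e0.
have H n := expectation_lower_limit (P := P) (f := fun n x => g (r n) x) (fun n => mg (r n)) r01 dist n.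
have [n Hn] : exists n, 3 ^+ k * (2 * 2 ^- n) + n.+1%:R^-1 <= e.
  (* Since 2^-n <= 1 / (n + 1), the total error is at most K / (n + 1). *)
  pose K : R := 3 ^+ k * 2 + 1.
  have K0 : 0 < K by rewrite ltr_wpDl// mulr_ge0// exprn_ge0.
  exists (Num.truncn (K / e)); set n := Num.truncn _.
  have h : 2 ^- n <= n.+1%:R^-1 :> R.
    by rewrite lef_pV2 ?posrE ?exprn_gt0// -natrX ler_nat ltn_expl.
  have h' : K * n.+1%:R^-1 <= e.
    rewrite ler_pdivrMr// mulrC -ler_pdivrMr// ltW//.
    have Ke : 0 <= K / e by rewrite divr_ge0// ltW.
    by have /andP[] := truncn_itv Ke.
  apply: le_trans h'.
  have -> : K * n.+1%:R^-1 = 3 ^+ k * (2 * n.+1%:R^-1) + n.+1%:R^-1 by rewrite /K; ring.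
  by rewrite lerD2r ler_pM2l ?exprn_gt0// ler_pM2l.
have [_ _ _ h1] := gr n.
have h2 : 3 ^+ k * (\int[P]_x g (r n) x) <= 3 ^+ k *
   (\int[P]_x lower_limit (fun n => g (r n) x) + 2 * 2 ^- n).
  by rewrite ler_pM2l ?exprn_gt0//; exact: H.
rewrite mulrDr in h2.
by rewrite (le_trans h1)// (le_trans (lerD h2 (lexx _)))// -addrA lerD2l.
Qed.

End SubcriticalWeight.

Lemma undup_nseq (T : eqType) n (x : T) : undup (nseq n.+1 x) = [:: x].
Proof.
elim: n => // n IH; rewrite -[RHS]IH.
have -> : undup (nseq n.+2 x) =
  if x \in nseq n.+1 x then undup (nseq n.+1 x) else x :: undup (nseq n.+1 x) by [].
by rewrite mem_head.
Qed.

(** * The case of large exponents *)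

Section Supercritical.
Context (R : realType) (k : nat) d (T : measurableType d) (P : probability T R).
Context (Phi : T -> lfset R k) (a : R).
Hypotheses (hPhi : point_stationary P Phi) (ka : k%:R <= a).

Local Notation content := (hausdorff_content1 P (fun x => at0 (Phi x)) a).

Let mPhi : measurable_fun setT Phi. Proof. by case: hPhi. Qed.

(** Disjoint balls of radius 1/2 have centres more than 1 apart, and the enlargement by 2 gives
    balls of radius 1. Every point is a candidate, so unlimited rounds would produce a maximal
    separated set. *)
Let c0 : R := 2^-1.
Let l j : seq R := rounds j [:: c0].
Let cand (c : R) : rule R := RConst 1.

Let c0_gt0 : 0 < c0. Proof. by rewrite invr_gt0. Qed.

Let mem_l j c : c \in l j -> c = c0.
Proof. by move=> /mem_rounds; rewrite inE => /eqP. Qed.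

Let l0 j : all (> 0) (l j).
Proof. by apply/allP => c /mem_l ->. Qed.

Let sel j := select cand (l j).

Definition chosen_rule (j : nat) : rule R :=
  rule_mul (RConst (3 ^- k)) (rule_eq (rule_eq (sel j) (RConst 0)) (RConst 0)).

Let chosenE j (D : discreteSpace R) b x : eval (@mdist R D) b (chosen_rule j) x =
  3 ^- k * (eval (@mdist R D) b (sel j) x != 0)%:R.
Proof.
rewrite -[LHS]/(3 ^- k * ((eval (@mdist R D) b (sel j) x == 0)%:R == 0)%:R).
by rewrite natr_eq0b.
Qed.

Let V0 : 0 < 3 ^- k :> R. Proof. by rewrite invr_gt0 exprn_gt0. Qed.

Lemma chosen01 j (D : discreteSpace R) b x :
  0 <= eval (@mdist R D) b (chosen_rule j) x <= 1.
Proof.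
rewrite chosenE; have V1 : 3 ^- k <= 1 :> R.
  by rewrite invf_le1 ?exprn_gt0// exprn_ege1// ler1n.
by case: (_ != 0); rewrite ?mulr1 ?mulr0 ?lexx ?ler01 ?V1 ?ltW.
Qed.

(** Further rounds only add centres; so the lower limit dominates the weight after any number of
    rounds. *)
Lemma chosen_nondecreasing j n (D : discreteSpace R) b x : (j <= n)%N ->
  eval (@mdist R D) b (chosen_rule j) x <= eval (@mdist R D) b (chosen_rule n) x.
Proof.
move=> jn; rewrite !chosenE ler_pM2l//.
have [_|s0] := eqVneq (eval (@mdist R D) b (sel j) x) 0; first by [].
have E : l n = nseq (n - j) c0 ++ l j.
  by rewrite /l /rounds/= !cats0 -nseqD subnK.
by rewrite /sel E select_cat ?s0// -E.
Qed.

(** At most (2t + 1)^k <= (3t)^k chosen points lie in a ball of radius t >= 1; the factor 3^-k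
    leaves t^k <= t^a. *)
Lemma chosen_packing (phi : lfset R k) b (x : subspace_ds (svalP phi)) t j : 1 <= t ->
  nbsum t x (eval (@mdist R (subspace_ds (svalP phi))) b (chosen_rule j)) <= t `^ a.
Proof.
move=> t1; have t0 : 0 < t := lt_le_trans ltr01 t1.
set D := subspace_ds (svalP phi).
pose s := [seq y <- fset_set [set y : D | mdist x y <= t] |
  eval (@mdist R D) b (sel j) y != 0].
have -> : nbsum t x (eval (@mdist R D) b (chosen_rule j)) = 3 ^- k * (size s)%:R.
  rewrite nbsumE; under eq_bigr do rewrite chosenE.
  rewrite -big_distrr/= /s size_filter -sum1_count natr_sum [in RHS]big_mkcond/=.
  by congr (_ * _); apply: eq_bigr => y _; case: (_ != 0).
have sP (i : 'I_(size s)) : mdist x (tnth (in_tuple s) i) <= t /\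
    eval (@mdist R D) b (sel j) (tnth (in_tuple s) i) != 0.
  have := mem_tnth i (in_tuple s); rewrite mem_filter in_nb.
  by case/andP.
have us : uniq s by rewrite filter_uniq// fset_uniq.
have pb : (size s)%:R <= (2 * t + 1) ^+ k.
  apply: (@packing_bound R k (size s) (fun i => val (tnth (in_tuple s) i)) (val x) t t0).
    by move=> i; exact: (sP i).1.
  move=> i i' ii'; have [_ si] := sP i; have [_ si'] := sP i'.
  have := @select_separated R cand D b (l j) _ _ (l0 j) si si'.
  rewrite (mem_l (selectP (l0 j) si).1) (mem_l (selectP (l0 j) si').1) => H.
  have -> : 1 = c0 + c0 :> R by rewrite /c0; field.
  apply/ltW/H => E; move/negP: ii'; apply; apply/eqP.
  exact: (elimT (@tuple_uniqP _ _ (in_tuple s)) us).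
have pb' : (2 * t + 1) ^+ k <= (3 * t) ^+ k.
  by rewrite lerXn2r ?nnegrE//; lra.
apply: (@le_trans _ _ (t ^+ k)).
  rewrite mulrC ler_pdivrMr ?exprn_gt0// (le_trans pb)// (le_trans pb')//.
  by rewrite exprMn mulrC.
by rewrite -powR_mulrn ?(ltW t0)// ler_powR.
Qed.

(** After [j] rounds, balls of radius 1 around the chosen points and around the few uncovered ones
    form a covering. Each costs 1, so the content is at most the probability that the root is chosen
    plus a small error. *)
Lemma content_le_chosen :
  ((3 ^- k)%:E * content <= \int[P]_x \int[coin (R := R)]_w
    (lower_limit (fun n => eval (@mdist R (at0 (Phi x))) (@coins R (at0 (Phi x)) w)
      (chosen_rule n) (ps_root (at0 (Phi x)))))%:E)%E.
Proof.
set mean := (\int[P]_x _)%E.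
apply/lee_addgt0Pr => e e0.
have [j Hj] : exists j, (\int[P]_x chance (uncovered cand 2 (l j)) 1%R (at0 (Phi x)) <= e%:E)%E.
  apply: (@dominated_small _ _ _ P (fun j x => chance (uncovered cand 2 (l j)) 1%R (at0 (Phi x)))) => //.
  - by move=> n; exact: (measurable_at0 mPhi (psm_chance _ _)).
  - by move=> n x; rewrite chance_ge0 chance_le1.
  move=> x; exists 0%N; apply: (@chance_uncovered_small R (fun=> cand) [:: c0] 2 _ c0
    (ps_root (at0 (Phi x))) 0%N) => //=.
  - by rewrite c0_gt0.
  - by rewrite ler1n.
  - by rewrite mem_head.
  - by rewrite mdistxx subrr mul0r.
have H1 : (content <= \int[P]_x chance (sel j) c0 (at0 (Phi x)) + e%:E)%E.
  apply: le_trans (_ : _ <= \int[P]_x cover_cost cand 2 (l j) a (at0 (Phi x)))%E _.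
    apply: content_le_cost => //.
    - by apply/allP => c /mem_l ->; rewrite /c0 mulfV.
    - by rewrite ler1n.
  apply: le_trans (leeD2l _ Hj).
  rewrite -ge0_integralD//; last 2 first.
  - exact: (measurable_at0 mPhi (psm_chance _ _)).
  - exact: (measurable_at0 mPhi (psm_chance _ _)).
  apply: ae_le_integral.
  - move=> x; apply: adde_ge0; last exact: chance_ge0.
    by apply: sume_ge0 => c _; rewrite mule_ge0 ?chance_ge0// lee_fin powR_ge0.
  - by move=> x; apply: adde_ge0; exact: chance_ge0.
  apply: aeW => x; apply: leeD; last first.
    exact: bad_le_uncovered.
  (* Without rounds the list of radii is empty and there is no selected ball to pay for. *)
  case: j {Hj} => [|j].
    by rewrite (_ : undup (l 0) = [::])// big_nil chance_ge0.
  have -> : undup (l j.+1) = [:: c0].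
    have -> : l j.+1 = nseq j.+1 c0 by rewrite /l /rounds/= cats0.
    exact: undup_nseq.
  by rewrite big_seq1 mulfV// powR1 mul1e.
have VE0 : (0 <= (3 ^- k)%:E :> \bar R)%E by rewrite lee_fin ltW.
apply: (le_trans (lee_wpmul2l VE0 H1)).
have I0 : (0 <= \int[P]_x chance (sel j) c0 (at0 (Phi x)))%E.
  by apply: integral_ge0 => x _; exact: chance_ge0.
have E0 : (0 <= e%:E)%E by rewrite lee_fin ltW.
rewrite ge0_muleDr//.
have He : ((3 ^- k)%:E * e%:E <= e%:E)%E.
  rewrite -EFinM lee_fin ler_piMl ?(ltW e0)//.
  by rewrite invf_le1 ?exprn_gt0// exprn_ege1// ler1n.
suff Hm : ((3 ^- k)%:E * \int[P]_x chance (sel j) c0 (at0 (Phi x)) <= mean)%E.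
  exact: leeD Hm He.
rewrite /mean.
rewrite -ge0_integralZl//; last first.
  exact: (measurable_at0 mPhi (psm_chance _ _)).
have LL01 x w : 0 <= lower_limit (fun n => eval (@mdist R (at0 (Phi x))) (@coins R (at0 (Phi x)) w)
      (chosen_rule n) (ps_root (at0 (Phi x)))).
  by apply: lower_limit_ge0 => n; exact: chosen01.
apply: ae_le_integral.
- by move=> x; rewrite mule_ge0 ?chance_ge0.
- by move=> x; apply: integral_ge0 => w _; rewrite lee_fin.
apply: aeW => x; set p := at0 (Phi x).
have mA : measurable [set w | eval (@mdist R p) (@coins R p w) (sel j) (ps_root p) = c0].
  exact: measurable_eval_eq.
have -> : chance (sel j) c0 p = (\int[coin (R := R)]_w
    (\1_[set w | eval (@mdist R p) (@coins R p w) (sel j) (ps_root p) = c0] w)%:E)%E.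
  by rewrite integral_indic// setIT.
rewrite -ge0_integralZl//; last by apply/measurable_EFinP; exact: measurable_indic.
apply: ae_le_integral.
- by move=> w; rewrite mule_ge0// lee_fin.
- by move=> w; rewrite lee_fin; exact: LL01.
apply: aeW => w; rewrite -EFinM lee_fin.
apply: (@lower_limit_ge _ _ (fun n => chosen01 n (@coins R p w) (ps_root p)) j) => n jn.
apply: le_trans (chosen_nondecreasing _ _ jn); rewrite chosenE ler_pM2l// indicE.
have [s0|s0] := eqVneq (eval (@mdist R p) (@coins R p w) (sel j) (ps_root p)) 0.
  rewrite memNset// /=; first by rewrite s0 => E; move: c0_gt0; rewrite -E ltxx.
by rewrite /= lern1 leq_b1.
Qed.

End Supercritical.

Lemma weight_rules (R : realType) (k : nat) d (T : measurableType d)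
    (P : probability T R) (Phi : T -> lfset R k) (a : R) :
  point_stationary P Phi -> 0 <= a -> exists r : nat -> rule R,
  [/\ forall n (D : discreteSpace R) b x, 0 <= eval (@mdist R D) b (r n) x <= 1,
    forall (phi : lfset R k) b (x : subspace_ds (svalP phi)) t, 1 <= t ->
      exists N, forall n, (N <= n)%N ->
        nbsum t x (eval (@mdist R (subspace_ds (svalP phi))) b (r n)) <= t `^ a &
    ((3 ^- k)%:E * hausdorff_content1 P (fun x => at0 (Phi x)) a <=
      \int[P]_x \int[coin (R := R)]_w
        (lower_limit (fun n => eval (@mdist R (at0 (Phi x))) (@coins R (at0 (Phi x)) w)
          (r n) (ps_root (at0 (Phi x)))))%:E)%E].
Proof.
move=> hPhi a0; have [ka|ak] := leP k%:R a.
  exists (chosen_rule R k); split.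
  - by move=> n D b x; exact: chosen01.
  - by move=> phi b x t t1; exists 0%N => n _; exact: chosen_packing.
  - exact: content_le_chosen.
have [r [r0 r01 rt H]] := subcritical_weight hPhi a0 ak.
exists r; split=> //.
  by move=> phi b x t; exact: rt.
rewrite lee_pdivrMl ?exprn_gt0//; apply: (le_trans H).
rewrite le_eqVlt; apply/orP; left; apply/eqP; congr (_ * _)%E.
apply: eq_integral => x _; set p := at0 (Phi x).
(* The rules have depth 0, so the integrand does not depend on the bits and the inner integral
   disappears. *)
have E w : lower_limit (fun n => eval (@mdist R p) (@coins R p w) (r n) (ps_root p)) =
    lower_limit (fun n => rule_value (r n) p).
  by congr lower_limit; apply/funext => n; exact: eval_bit_free.
under [RHS]eq_integral do rewrite E.
rewrite integral_cst// -[LHS]mule1; congr (_ * _)%E.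
by apply/esym; exact: (probability_setT (coin (R := R))).
Qed.

Theorem theorem4p15 (R : realType) (k : nat) (d : measure_display)
    (T : measurableType d) (P : probability T R) (Phi : T -> lfset R k)
    (hPhi : point_stationary P Phi) (alpha : R) (halpha : 0 <= alpha) :
  exists w : eqprocess (nnreal R),
    [/\ as_marked P (fun x => at0 (Phi x)) w
          (fun p => forall (v : p) (r : R), 1 <= r ->
             (weight p (cball v r) <= (r `^ alpha)%:E)%E),
        ((3 ^- k)%:E * hausdorff_content1 P (fun x => at0 (Phi x)) alpha
          <= mean_marked P (fun x => at0 (Phi x)) w
               (fun p => (root_mark p)%:E))%E &
        (0 < hausdorff_content1 P (fun x => at0 (Phi x)) alpha)%E ->
          ~ as_marked P (fun x => at0 (Phi x)) w (fun p => root_mark p = 0)].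
Proof.
have [r [r01 rt H]] := weight_rules hPhi halpha.
pose w := fiid (limit_factor r).
have mean_ge : ((3 ^- k)%:E * hausdorff_content1 P (fun x => at0 (Phi x)) alpha
    <= mean_marked P (fun x => at0 (Phi x)) w (fun p => (root_mark p)%:E))%E.
  apply: (le_trans H); rewrite le_eqVlt; apply/orP; left; apply/eqP.
  by apply: eq_integral => x _; rewrite mean_limit_factor.
exists w; split=> //.
(* Where 0 belongs to the configuration, the sampled space is a subset of Euclidean space, as the
   bound on the weights of balls in [weight_rules] requires. *)
- have [_ Phi0 _] := hPhi; apply: filterS Phi0 => x h.
  rewrite at0E (atxE h); apply: weight_ae => // b v t t1.
  have [N HN] := rt (Phi x) (coins b) v t t1.
  exact: (limit_factor_sum r01 HN).
(* A weight vanishing almost surely at the root would have mean 0, against the lower bound by the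
   positive content. *)
- move=> Hpos zero; have : (mean_marked P (fun x => at0 (Phi x)) w (fun p => (root_mark p)%:E) <= 0)%E.
    rewrite -(integral0 P setT); apply: ae_le_integral => //.
      by move=> x; apply: integral_ge0 => m _; rewrite lee_fin; exact: nnval_ge0.
    apply: filterS zero => x zx.
    rewrite -(integral0 (w (at0 (Phi x))) setT); apply: ae_le_integral => //.
      by move=> m; rewrite lee_fin; exact: nnval_ge0.
    have [N [mN N0 zN]] := zx; exists N; split=> // m nm; apply: zN => zm.
    by apply: nm; rewrite /= zm.
  apply/negP; rewrite -ltNge; apply: lt_le_trans mean_ge.
  by rewrite mule_gt0// lte_fin invr_gt0 exprn_gt0.
Qed.
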